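(* Consider a two-dimensional trimmed tensor-product B-spline discretization of degrees $p_1,p_2\ge1$, with stiffness matrix $K$ and row-sum lumped mass matrix $\hat M$, whose small basis functions are trimmed according to one of the configurations (a), (b), (c) described in the context, with trimming parameter $\delta$, and let $\Omega_\ell$ denote the active support of a small basis function. Let $\kappa_2$ be the continuity of the spline space across the knot $\xi^{(2)}_{\ell_2}$ in the second direction. Then, as $\delta\to0$: Configuration (a): $$\lambda_1(K,\hat M)\le\begin{cases}\mathcal O(1)&\text{if }p_2\le2,\\ \mathcal O(\delta^{p_2-2})=\mathcal O(|\Omega_\ell|^{p_2-2})&\text{otherwise,}\end{cases}\qquad \lambda_n(K,\hat M)\sim\begin{cases}\delta^{-1}\sim|\Omega_\ell|^{-1}&\text{if }\kappa_2=0,\\ 1&\text{otherwise.}\end{cases}$$ Configuration (b): $$\lambda_1(K,\hat M)\le\begin{cases}\mathcal O(1)&\text{if }p_2\le2,\\ \mathcal O(\delta^{p_2-2})=\mathcal O(|\Omega_\ell|^{\frac{p_2-2}{2}})&\text{otherwise,}\end{cases}\qquad \lambda_n(K,\hat M)\sim\begin{cases}\delta^{-1}\sim|\Omega_\ell|^{-\frac12}&\text{if }\kappa_2=0,\\ 1&\text{otherwise.}\end{cases}$$ Configuration (c): $$\lambda_1(K,\hat M)\le\begin{cases}\mathcal O(1)&\text{if }p_1=p_2=1,\\ \mathcal O(\delta^{p_1+p_2-2})=\mathcal O(|\Omega_\ell|^{\frac{p_1+p_2-2}{2}})&\text{otherwise,}\end{cases}\qquad \lambda_n(K,\hat M)\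sim1.$$
   Context: $\Omega\subset\Omega_0\subset\mathbb R^2$ is a physical domain embedded in a fictitious domain carrying a fixed background mesh with tensor-product B-splines $\varphi(\xi_1,\xi_2)=\varphi_{i_1}(\xi_1)\varphi_{i_2}(\xi_2)$ of degrees $p_1,p_2\ge1$, built from open knot vectors with internal knots of multiplicity between $1$ and $p_j$ in direction $j$. If the knot $\xi^{(j)}_{\ell_j}$ has multiplicity $m_j$, the spline space is $C^{\kappa_j}$ across it with $\kappa_j=p_j-m_j$. The active basis $\Phi=\{\varphi_1,\dots,\varphi_n\}$ consists of B-splines whose support intersects $\Omega$, with homogeneous Dirichlet conditions strongly imposed on a nonempty part of the untrimmed boundary and homogeneous Neumann conditions on the trimmed boundary. The stiffness matrix is $K_{ij}=\int_\Omega\nabla\varphi_i\cdot\nabla\varphi_j$; the row-sum lumped mass matrix (row sums taken before elimination of Dirichlet degrees of freedom, using partition of unity) is diagonal with $\hat M_{ii}=\int_\Omega\varphi_i$. Generalized eigenvalues ($K\bm x=\lambda\hat M\bm x$, $\bm x\neq 0$) are ordered $\lambda_1(K,\hat M)\le\dots\le\lambda_n(K,\hat M)$. An active element $T$ (one with $T\cap\Omega\neq\emptyset$) is large if $|T\cap\Omega|\ge\gamma|T|$ for a given parameter $\gamma\in[0,1]$ and small otherwise; a basis function in $\Phi$ is large if its support contains at least one large element and small otherwise; $\Phi^S$ is the set of small basis functions. The active support of a basis function $\varphi$ is $\Omega\cap\operatorname{supp}(\varphi)$. As $\delta\to0$ only $\Omega$ varies (mesh and B-splines are fixed), and the trimming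 configurations are as follows; in each one, every $\varphi=\varphi_{i_1}\varphi_{i_2}\in\Phi^S$ has active support $\Omega_\ell$ of the form stated: (a) cut along one direction only: $\Omega_\ell=[c_1,c_2]\times[\xi^{(2)}_{\ell_2},\xi^{(2)}_{\ell_2}+\delta]$, where $c_1<c_2$ do not depend on $\delta$ (they may depend on $\varphi$), the support of $\varphi_{i_2}$ begins at $\xi^{(2)}_{\ell_2}$, and $\varphi_{i_1}$ is of order $1$; (b) cut in two directions but not around a corner of the support: $\Omega_\ell=[z_1,z_1+\delta]\times[\xi^{(2)}_{\ell_2},\xi^{(2)}_{\ell_2}+\delta]$, where $z_1$ does not depend on $\delta$, $\varphi_{i_1}(z_1)\ne0$, and the support of $\varphi_{i_2}$ begins at $\xi^{(2)}_{\ell_2}$; (c) cut in two directions and around a corner of the support: $\Omega_\ell=[\xi^{(1)}_{\ell_1},\xi^{(1)}_{\ell_1}+\delta]\times[\xi^{(2)}_{\ell_2},\xi^{(2)}_{\ell_2}+\delta]$, and the support of $\varphi_{i_j}$ begins at $\xi^{(j)}_{\ell_j}$ for $j=1,2$. In (a) and (b), all B-splines $\varphi_{i_2}$ whose support begins at $\xi^{(2)}_{\ell_2}$ occur as factors of small basis functions; in (c), all pairs of B-splines beginning at $\xi^{(1)}_{\ell_1}$ and $\xi^{(2)}_{\ell_2}$ occur. (For each $k=\kappa_j,\dots,p_j-1$ there is a B-spline beginning at $\xi^{(j)}_{\ell_j}$ that is $C^k$ but not $C^{k+1}$ there.) For positive functions $f,g$ of $\delta$, $f\sim g$ as $\delta\to0$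 means $c\,g\le f\le C\,g$ for all sufficiently small $\delta$ with constants $0<c\le C$ independent of $\delta$; $f\le\mathcal O(g)$ means $f\le Cg$ for small $\delta$ with $C$ independent of $\delta$.
   Formalization: The first direction is required to carry more than two B-splines, which excludes only p_1=1 with a single element there; in that case, with Dirichlet conditions on both lateral sides up to the knot, all active functions are small and the bound on λ_1 fails. *)

(* Defs.v *)
From HB Require Import structures.
From mathcomp Require Import all_boot all_order all_algebra.
From mathcomp Require Import all_classical all_reals all_analysis.

Set Implicit Arguments.
Unset Strict Implicit.
Unset Printing Implicit Defensive.

Import Order.TTheory GRing.Theory Num.Theory.
Import numFieldNormedType.Exports.

Local Open Scope classical_set_scope.
Local Open Scope ring_scope.

Section Asymptotics.
Context {R : realType}.
Implicit Types f g : R -> R.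

Definition bigO_at0 f g : Prop :=
  exists2 C : R, 0 < C & \forall d \near 0^'+, f d <= C * g d.

Definition equiv_at0 f g : Prop :=
  exists c C : R, 0 < c <= C /\
    \forall d \near 0^'+, c * g d <= f d <= C * g d.

End Asymptotics.

Section GeneralizedEigenvalues.
Context {R : realType} (n : nat).
Implicit Types K M : 'M[R]_n.

(* The columns of X form a basis of eigenvectors, so that s lists the
   eigenvalues of the pencil with their multiplicities.  For K symmetric and M
   diagonal with positive entries such an s exists and is unique. *)
Definition ordered_eigenvalues K M (s : seq R) : Prop :=
  [/\ size s = n, sorted <=%R s &
      exists2 X : 'M[R]_n, X \in unitmx &
        K *m X = M *m X *m diag_mx (\row_i s`_i)].

(* k is numbered from 1 to n. *)
Definition gen_eigenvalue K M (k : nat) : R :=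
  (xget [::] [set s | ordered_eigenvalues K M s])`_k.-1.

End GeneralizedEigenvalues.

Section Univariate.
Context {R : realType}.

(* Internal knots have multiplicity at most deg, and at least 1 by virtue of
   belonging to the sequence. *)
Record spline_space := SplineSpace {
  deg : nat;
  knots : seq R;
  deg_gt0 : (0 < deg)%N;
  knots_sorted : sorted <=%R knots;
  knots_proper : head 0 knots < last 0 knots;
  mult_first : count_mem (head 0 knots) knots = deg.+1;
  mult_last : count_mem (last 0 knots) knots = deg.+1;
  mult_internal : forall x, x \in knots ->
    head 0 knots < x < last 0 knots -> (count_mem x knots <= deg)%N }.

Implicit Type U : spline_space.

Definition first_knot U : R := head 0 (knots U).
Definition last_knot U : R := last 0 (knots U).

Definition internal_knot U (xi : R) : Prop :=
  xi \in knots U /\ first_knot U < xi < last_knot U.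

Definition nbasis U : nat := size (knots U) - (deg U).+1.

(* Continuity of the spline space across an internal knot; no truncation occurs
   in the subtraction, by mult_internal. *)
Definition continuity_at U (xi : R) : nat := deg U - count_mem xi (knots U).

(* Cox-de Boor recursion; the convention that a quotient with a vanishing
   denominator is 0 is that of the inverse in R.  The last nonempty knot span is
   closed on the right, so that the last B-spline equals 1 at the last knot. *)
Fixpoint cox_de_boor (t : seq R) (p i : nat) (x : R) : R :=
  if p is q.+1 then
    (x - t`_i) / (t`_(i + p) - t`_i) * cox_de_boor t q i x +
    (t`_(i + p).+1 - x) / (t`_(i + p).+1 - t`_i.+1) * cox_de_boor t q i.+1 x
  else if (t`_i <= x < t`_i.+1) ||
          [&& t`_i < t`_i.+1, t`_i.+1 == last 0 t & x == last 0 t]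
  then 1 else 0.

Definition bspline U (i : nat) : R -> R := cox_de_boor (knots U) (deg U) i.

End Univariate.

Arguments spline_space R : clear implicits.

Section Support.
Context {R : realType}.

Definition supp {T : topologicalType} (f : T -> R) : set T :=
  closure [set z | f z != 0].

Definition begins_at (f : R -> R) (xi : R) : Prop :=
  supp f xi /\ lbound (supp f) xi.

Definition boundary {T : topologicalType} (A : set T) : set T :=
  closure A `\` interior A.

Definition rectangle (a b c d : R) : set (R * R) := `[a, b] `*` `[c, d].

End Support.

Section Plane.
Context {R : realType}.

Definition mu2 := ((@lebesgue_measure R) \x (@lebesgue_measure R))%E.

Definition area (A : set (R * R)) : R := fine (mu2 A).

Definition integral2 (A : set (R * R)) (f : R * R -> R) : R :=
  Rintegral mu2 A f.

(* For B-splines of degree at least 1 in each direction, the partial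
   derivatives exist off the mesh lines, hence almost everywhere. *)
Definition grad_dot (f g : R * R -> R) (z : R * R) : R :=
  'D_(1, 0) f z * 'D_(1, 0) g z + 'D_(0, 1) f z * 'D_(0, 1) g z.

End Plane.

Section Discretization.
Context {R : realType} (U1 U2 : spline_space R).

Definition background_domain : set (R * R) :=
  rectangle (first_knot U1) (last_knot U1) (first_knot U2) (last_knot U2).

Definition bindex := ('I_(nbasis U1) * 'I_(nbasis U2))%type.

Definition tbspline (i : bindex) (z : R * R) : R :=
  bspline U1 i.1 z.1 * bspline U2 i.2 z.2.

Definition mesh_element (T : set (R * R)) : Prop :=
  exists a b : nat,
    [/\ (a.+1 < size (knots U1))%N, (b.+1 < size (knots U2))%N,
        (knots U1)`_a < (knots U1)`_a.+1, (knots U2)`_b < (knots U2)`_b.+1 &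
        T = rectangle (knots U1)`_a (knots U1)`_a.+1
                      (knots U2)`_b (knots U2)`_b.+1].

(* Om is the physical domain and GamD the part of its untrimmed boundary that
   carries the Dirichlet conditions. *)
Definition trimmed_domain (Om GamD : set (R * R)) : Prop :=
  [/\ open Om, connected Om, Om `<=` background_domain, GamD !=set0 &
      GamD `<=` boundary Om `&` boundary background_domain].

Definition active_support (Om : set (R * R)) (i : bindex) : set (R * R) :=
  Om `&` supp (tbspline i).

(* Before elimination of the Dirichlet degrees of freedom. *)
Definition all_active (Om : set (R * R)) : {set bindex} :=
  [set i | `[< active_support Om i !=set0 >]]%SET.

Definition active_basis (Om GamD : set (R * R)) : {set bindex} :=
  [set i in all_active Om | `[< forall z, GamD z -> tbspline i z = 0 >]]%SET.

Definition stiffness (Om GamD : set (R * R)) : 'M[R]_#|active_basis Om GamD| :=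
  \matrix_(i, j) integral2 Om
    (grad_dot (tbspline (enum_val i)) (tbspline (enum_val j))).

Definition lumped_mass (Om GamD : set (R * R)) :
    'M[R]_#|active_basis Om GamD| :=
  diag_mx (\row_i \sum_(j in all_active Om)
    integral2 Om (fun z => tbspline (enum_val i) z * tbspline j z)).

Definition eigenvalue_first (Om GamD : set (R * R)) : R :=
  gen_eigenvalue (stiffness Om GamD) (lumped_mass Om GamD) 1%N.

Definition eigenvalue_last (Om GamD : set (R * R)) : R :=
  gen_eigenvalue (stiffness Om GamD) (lumped_mass Om GamD)
    #|active_basis Om GamD|.

Definition large_element (gamma : R) (Om T : set (R * R)) : Prop :=
  [/\ mesh_element T, T `&` Om !=set0 &
      (gamma%:E * mu2 T <= mu2 (T `&` Om))%E].

Definition large_function (gamma : R) (Om : set (R * R)) (i : bindex) : Prop :=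
  exists2 T, large_element gamma Om T & T `<=` supp (tbspline i).

Definition small_basis (gamma : R) (Om GamD : set (R * R)) : {set bindex} :=
  [set i in active_basis Om GamD | ~~ `[< large_function gamma Om i >]]%SET.

(* Om is open, hence an active support agrees with a closed rectangle up to
   boundary points only. *)
Definition active_support_is (Om : set (R * R)) (i : bindex)
    (A : set (R * R)) : Prop :=
  interior (active_support Om i) = interior A.

(* In the three configurations, the trimming parameter d ranges over ]0, d0[. *)
Definition configuration_a (gamma : R) (Om GamD : R -> set (R * R))
    (d0 xi2 : R) : Prop :=
  exists2 c : bindex -> R * R, (forall i, (c i).1 < (c i).2) &
  forall d, 0 < d < d0 ->
    (forall i, i \in small_basis gamma (Om d) (GamD d) ->
       begins_at (bspline U2 i.2) xi2 /\
       active_support_is (Om d) i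
         (rectangle (c i).1 (c i).2 xi2 (xi2 + d))) /\
    (forall j : 'I_(nbasis U2), begins_at (bspline U2 j) xi2 ->
       exists i1, (i1, j) \in small_basis gamma (Om d) (GamD d)).

Definition configuration_b (gamma : R) (Om GamD : R -> set (R * R))
    (d0 xi2 : R) : Prop :=
  exists z1 : bindex -> R,
  forall d, 0 < d < d0 ->
    (forall i, i \in small_basis gamma (Om d) (GamD d) ->
       [/\ bspline U1 i.1 (z1 i) != 0, begins_at (bspline U2 i.2) xi2 &
           active_support_is (Om d) i
             (rectangle (z1 i) (z1 i + d) xi2 (xi2 + d))]) /\
    (forall j : 'I_(nbasis U2), begins_at (bspline U2 j) xi2 ->
       exists i1, (i1, j) \in small_basis gamma (Om d) (GamD d)).

Definition configuration_c (gamma : R) (Om GamD : R -> set (R * R))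
    (d0 xi1 xi2 : R) : Prop :=
  forall d, 0 < d < d0 ->
    (forall i, i \in small_basis gamma (Om d) (GamD d) ->
       [/\ begins_at (bspline U1 i.1) xi1, begins_at (bspline U2 i.2) xi2 &
           active_support_is (Om d) i
             (rectangle xi1 (xi1 + d) xi2 (xi2 + d))]) /\
    (forall i : bindex, begins_at (bspline U1 i.1) xi1 ->
       begins_at (bspline U2 i.2) xi2 ->
       i \in small_basis gamma (Om d) (GamD d)).

End Discretization.

Arguments small_basis {R} U1 U2 gamma Om GamD.
Arguments configuration_a {R} U1 U2 gamma Om GamD d0 xi2.
Arguments configuration_b {R} U1 U2 gamma Om GamD d0 xi2.
Arguments configuration_c {R} U1 U2 gamma Om GamD d0 xi1 xi2.

(* Main.v *)
(* A single basis function in the Rayleigh quotient gives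
   lambda_1 <= K_ii / M_ii <= lambda_n, and the Cauchy-Schwarz inequality for the
   energy form gives lambda_n <= n max_i K_ii / M_ii, so everything reduces to the
   ratios K_ii / M_ii.  For large functions they are bounded above uniformly in
   delta, and for at least one of them also away from 0.  A B-spline that begins
   at xi and is exactly C^k there behaves like (y - xi)^(k+1), and its derivative
   like (y - xi)^k.  Hence the ratio of a small function is of the order of
   delta^(k-1) on a strip, and O(delta^(k_1+k_2)) around a corner.  The smoothest
   functions, k = p - 1, bound lambda_1; the roughest one, k = kappa, decides
   lambda_n. *)

Require Import Defs.
From mathcomp Require Import all_boot all_order all_algebra.
From mathcomp Require Import all_classical all_reals all_analysis.
From mathcomp Require Import complex perm measurable_realfun ring lra zify.
Import Order.TTheory GRing.Theory Num.Theory.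
Import numFieldNormedType.Exports.
Local Open Scope classical_set_scope.
Local Open Scope ring_scope.

Set Implicit Arguments.
Unset Strict Implicit.
Unset Printing Implicit Defensive.

(** * Eigenvalues of a diagonal pencil *)

(** The obstacle is uniformity. [Om d], [GamD d], the active set and [ell d] may change arbitrarily
    with the parameter, so no constant may depend on the domain. Each constant is attached to a
    basis index, an element or a polynomial piece, of which there are finitely many, and the domain
    enters only through areas of its intersections with boxes. The configurations describe small
    functions only; that some active function has energy bounded away from 0 must be extracted from
    them. A B-spline that covers the span after [xi2] without beginning there cannot be small, and
    one with interior indices satisfies any Dirichlet conditions. The existence of a small function
    also forces [gamma] to be positive. On mesh lines the derivatives of B-splines are uncontrolled,
    so integrands are first replaced by piecewise polynomials that are 0 there. *)

Lemma symmetric_diagonalizable (R : realType) n (A : 'M[R]_n) : A^T = A ->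
  exists2 P : 'M[R]_n, P \in unitmx &
    exists d : 'rV[R]_n, P *m A = diag_mx d *m P.
Proof.
move=> symA.
(* The spectral theorem is applied to the complexification, which is Hermitian with real spectrum;
   real matrices that are similar over the complex numbers are similar over the reals. *)
pose AC : 'M[R[i]]_n := map_mx (real_complex R) A.
have ACreal : AC \is a mxOver Num.real.
  by apply/mxOverP => i j; rewrite mxE complex_real.
have ACsym : AC \is symmetricmx.
  by apply/is_hermitianmxP; rewrite expr0 scale1r map_mx_id// /AC map_trmx symA.
have ACherm := realsym_hermsym ACsym ACreal.
have /orthomx_spectralP ACE := hermitian_normalmx ACherm.
have dreal := hermitian_spectral_diag_real ACherm.
have Dreal : diag_mx (spectral_diag AC) \is a mxOver Num.real.
  apply/mxOverP => i j; rewrite !mxE; case: eqP => _; rewrite ?mulr0n ?mulr1n ?real0//.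
  by move/mxOverP: dreal; exact.
have [|P] := @real_similar _ _ AC (diag_mx (spectral_diag AC)) _ ACreal Dreal.
  exists (spectralmx AC); first exact: spectral_unit.
  apply/similarP; rewrite ?spectral_unit// {2}ACE !mulmxA mulmxV ?spectral_unit//.
  by rewrite mul1mx.
move=> /andP[Preal Punit] /(similarP Punit) PA.
have Re_map m1 m2 (X : 'M[R[i]]_(m1, m2)) : X \is a mxOver Num.real ->
    X = map_mx (real_complex R) (map_mx (@complex.Re R) X).
  by move=> /mxOverP Xr; apply/matrixP => i j; rewrite !mxE RRe_real.
have PE := Re_map _ _ _ Preal; have dE := Re_map _ _ _ dreal.
exists (map_mx (@complex.Re R) P); first by rewrite -(@map_unitmx _ _ (real_complex R)) -PE.
exists (map_mx (@complex.Re R) (spectral_diag AC)).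
apply/(@map_mx_inj _ _ (real_complex R)).
by rewrite !map_mxM map_diag_mx -PE -dE.
Qed.

Section Pencil.
Context {R : realType} {n : nat}.
Implicit Types K : 'M[R]_n.
Implicit Types m : 'rV[R]_n.

(** With S the square root of M, the pencil becomes the symmetric matrix S^-1 K S^-1. If P
    diagonalizes it from the left, the columns of S^-1 P^T are eigenvectors of the pencil, and a
    permutation matrix sorts them. *)
Lemma ordered_eigenvalues_exist K m : K^T = K -> (forall i, 0 < m 0 i) ->
  exists s, ordered_eigenvalues K (diag_mx m) s.
Proof.
move=> symK m_gt0; pose S : 'rV[R]_n := \row_i Num.sqrt (m 0 i).
have S_gt0 i : 0 < S 0 i by rewrite mxE sqrtr_gt0.
have SS : diag_mx S *m diag_mx S = diag_mx m.
  rewrite mulmx_diag; congr diag_mx; apply/rowP => i; rewrite !mxE.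
  by rewrite -expr2 sqr_sqrtr// ltW.
have Sunit : diag_mx S \in unitmx.
  by rewrite unitmxE det_diag unitfE; apply/prodf_neq0 => i _; rewrite gt_eqF.
have trS : (invmx (diag_mx S))^T = invmx (diag_mx S) by rewrite trmx_inv tr_diag_mx.
have [P Punit [d PA]] := @symmetric_diagonalizable R n
  (invmx (diag_mx S) *m K *m invmx (diag_mx S)) (ltac:(
    by rewrite !trmx_mul !trS symK mulmxA)).
pose dt := [tuple d 0 i | i < n].
have /tuple_permP[p pE] : perm_eq (sort <=%R dt) dt by rewrite perm_sort.
exists (sort <=%R dt); split.
- by rewrite size_sort size_tuple.
- by apply: sort_sorted; exact: le_total.
have sortE : diag_mx (\row_i (sort <=%R dt)`_i) =
    perm_mx p *m (diag_mx d *m perm_mx (p^-1)%g).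
  apply/matrixP => i j; rewrite -col_permE -row_permE !mxE.
  by rewrite pE (nth_map i) ?size_enum_ord// !tnth_mktuple nth_ord_enum (inj_eq perm_inj).
exists (invmx (diag_mx S) *m P^T *m perm_mx (p^-1)%g).
  by rewrite !unitmx_mul unitmx_inv Sunit unitmx_tr Punit unitmx_perm.
have AP : invmx (diag_mx S) *m K *m invmx (diag_mx S) *m P^T = P^T *m diag_mx d.
  by have /(congr1 trmx) := PA; rewrite !trmx_mul !trS symK tr_diag_mx mulmxA.
have QQ : perm_mx (p^-1)%g *m perm_mx p = 1%:M :> 'M[R]_n.
  by rewrite -perm_mxM mulVg perm_mx1.
rewrite sortE -SS !mulmxA mulmxK// -[_ *m perm_mx _ *m perm_mx p]mulmxA QQ mulmx1.
by rewrite -[_ *m P^T *m diag_mx d]mulmxA -AP !mulmxA mulmxV// mul1mx.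
Qed.

Lemma mulmx_trcE K (x : 'cV[R]_n) :
  (x^T *m K *m x) 0 0 = \sum_i \sum_j x i 0 * x j 0 * K i j.
Proof.
rewrite mxE; under eq_bigr => j _ do rewrite mxE mulr_suml.
rewrite exchange_big; apply: eq_bigr => i _; apply: eq_bigr => j _.
by rewrite !mxE mulrAC.
Qed.

Lemma mulmx_trc_diag m (x : 'cV[R]_n) :
  (x^T *m diag_mx m *m x) 0 0 = \sum_i m 0 i * x i 0 ^+ 2.
Proof.
rewrite mulmx_trcE; apply: eq_bigr => i _; rewrite (bigD1 i)//= big1 ?addr0.
  by rewrite mxE eqxx mulr1n mulrC expr2.
by move=> j ji; rewrite mxE eq_sym (negbTE ji) mulr0n mulr0.
Qed.

(* The Gram matrix [X^T M X] commutes with the diagonal of eigenvalues, so it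
   only couples equal eigenvalues. *)
Lemma eigen_form_ge0 K m (s : seq R) (X : 'M[R]_n) (phi : R -> R) (c : 'cV[R]_n) :
  K^T = K -> (forall i, 0 < m 0 i) ->
  K *m X = diag_mx m *m X *m diag_mx (\row_i s`_i) ->
  (forall i : 'I_n, 0 <= phi s`_i) ->
  0 <= (c^T *m (X^T *m diag_mx m *m X *m diag_mx (\row_i phi s`_i)) *m c) 0 0.
Proof.
move=> symK m_gt0 KX phi_ge0; pose G := X^T *m diag_mx m *m X.
pose D : 'M[R]_n := diag_mx (\row_i s`_i).
have GT : G^T = G by rewrite /G !trmx_mul trmxK tr_diag_mx mulmxA.
have GD : G *m D = D *m G.
  have E : X^T *m K *m X = G *m D by rewrite -mulmxA KX /G !mulmxA.
  by rewrite -E -[in RHS]GT -[D]tr_diag_mx -trmx_mul -E !trmx_mul trmxK symK mulmxA.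
have coupled i j : G i j != 0 -> s`_i = s`_j.
  move: (congr1 (fun Y : 'M[R]_n => Y i j) GD); move: (G) => H.
  by rewrite mul_mx_diag mul_diag_mx !mxE mulrC => + Hij => /(mulIf Hij).
pose E : 'M[R]_n := diag_mx (\row_i Num.sqrt (phi s`_i)).
(* G_ij is 0 unless s_i = s_j, so phi(D) can be split evenly between the two sides; this displays
   the form as a sum of squares weighted by [m]. *)
have -> : G *m diag_mx (\row_i phi s`_i) = E *m G *m E.
  apply/matrixP => i j; move: (G) coupled => H coupled.
  rewrite !mul_mx_diag !mul_diag_mx !mxE; have [->|Hij] := eqVneq (H i j) 0; first by rewrite mulr0 !mul0r.
  by rewrite (coupled _ _ Hij) mulrAC -expr2 sqr_sqrtr// mulrC.
have -> : c^T *m (E *m G *m E) *m c =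
    (X *m E *m c)^T *m diag_mx m *m (X *m E *m c).
  by rewrite !trmx_mul tr_diag_mx /G !mulmxA.
by rewrite mulmx_trc_diag sumr_ge0// => i _; rewrite mulr_ge0 ?sqr_ge0// ltW.
Qed.

(** The forms of K - s_0 M and s_(n-1) M - K are those of [eigen_form_ge0] for the affine functions
    t - s_0 and s_(n-1) - t, both nonnegative on the sorted spectrum. *)
Lemma rayleigh_bounds K m (s : seq R) (x : 'cV[R]_n) :
  K^T = K -> (forall i, 0 < m 0 i) -> ordered_eigenvalues K (diag_mx m) s ->
  s`_0 * \sum_i m 0 i * x i 0 ^+ 2 <= (x^T *m K *m x) 0 0
    <= s`_n.-1 * \sum_i m 0 i * x i 0 ^+ 2.
Proof.
move=> symK m_gt0 [ssz ssort [X Xunit KX]].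
pose c := invmx X *m x; have xE : x = X *m c by rewrite mulKVmx.
have s_le (i j : nat) : (i <= j < n)%N -> s`_i <= s`_j.
  move=> /andP[ij jn]; rewrite (sorted_leq_nth le_trans)// inE ssz//.
  exact: leq_ltn_trans jn.
have form phi : (c^T *m (X^T *m diag_mx m *m X *m diag_mx (\row_i phi s`_i)) *m c) 0 0
    = \sum_i \sum_j c i 0 * c j 0 * ((X^T *m diag_mx m *m X) i j * phi s`_j).
  rewrite mulmx_trcE; apply: eq_bigr => i _; apply: eq_bigr => j _.
  by rewrite mul_mx_diag !mxE.
have Mx : \sum_i m 0 i * x i 0 ^+ 2 =
    \sum_i \sum_j c i 0 * c j 0 * ((X^T *m diag_mx m *m X) i j).
  by rewrite -mulmx_trc_diag -mulmx_trcE {1 2}xE trmx_mul !mulmxA.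
have Kx : (x^T *m K *m x) 0 0 =
    \sum_i \sum_j c i 0 * c j 0 * ((X^T *m diag_mx m *m X) i j * s`_j).
  rewrite -(form id) {1 2}xE trmx_mul; congr (_ 0 0).
  by rewrite -!mulmxA (mulmxA K) KX !mulmxA.
have lin a b : (c^T *m (X^T *m diag_mx m *m X *m
      diag_mx (\row_i (fun t => a * t + b) s`_i)) *m c) 0 0 =
    a * (x^T *m K *m x) 0 0 + b * \sum_i m 0 i * x i 0 ^+ 2.
  rewrite (form (fun t => a * t + b)) Kx Mx !mulr_sumr -big_split.
  apply: eq_bigr => i _; rewrite !mulr_sumr -big_split.
  by apply: eq_bigr => j _; rewrite /=; ring.
apply/andP; split; rewrite -subr_ge0.
  have := @eigen_form_ge0 K m s X (fun t => 1 * t + - s`_0) c symK m_gt0 KX.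
  rewrite lin mul1r mulNr; apply => i.
  by rewrite mul1r subr_ge0 s_le//= ltn_ord.
have := @eigen_form_ge0 K m s X (fun t => - 1 * t + s`_n.-1) c symK m_gt0 KX.
rewrite lin mulN1r addrC; apply => i.
rewrite mulN1r addrC subr_ge0 s_le//.
by have := ltn_ord i; case: n i => [|k] i; rewrite ?ltn0//= !ltnS leqnn andbT.
Qed.

(** Existence of a sorted spectrum makes the choice of [xget] a genuine one; otherwise its default,
    the empty list, would turn every eigenvalue into 0. *)
Lemma gen_eigenvalueP K m : K^T = K -> (forall i, 0 < m 0 i) ->
  ordered_eigenvalues K (diag_mx m) (xget [::] [set s | ordered_eigenvalues K (diag_mx m) s]).
Proof.
move=> symK m_gt0; have [s] := ordered_eigenvalues_exist symK m_gt0.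
by case: xgetP => [//|none /none].
Qed.

Lemma gen_eigenvalue_diag_bounds K m i : K^T = K -> (forall i, 0 < m 0 i) ->
  gen_eigenvalue K (diag_mx m) 1 <= K i i / m 0 i <= gen_eigenvalue K (diag_mx m) n.
Proof.
move=> symK m_gt0; have := rayleigh_bounds (delta_mx i 0) symK m_gt0 (gen_eigenvalueP symK m_gt0).
have -> : \sum_j m 0 j * (delta_mx i 0 : 'cV[R]_n) j 0 ^+ 2 = m 0 i.
  rewrite (bigD1 i)//= big1 ?addr0; first by rewrite mxE !eqxx expr1n mulr1.
  by move=> j ji; rewrite mxE (negbTE ji) expr0n mulr0.
rewrite trmx_delta -rowE -colE !mxE /gen_eigenvalue /=.
by rewrite ler_pdivlMr// ler_pdivrMr.
Qed.

(** For an eigenvector x of the last eigenvalue, x^T K x equals that eigenvalue times x^T M x. The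
    last hypothesis, Cauchy-Schwarz in Young form, bounds each of the n^2 terms of x^T K x by the
    mean of two diagonal terms, and in the sum every diagonal term is counted n times. *)
Lemma gen_eigenvalue_last_le K m (r : R) : (0 < n)%N -> K^T = K -> (forall i, 0 < m 0 i) ->
  (forall i, K i i <= r * m 0 i) ->
  (forall i j y z, 2 * (y * z * K i j) <= y ^+ 2 * K i i + z ^+ 2 * K j j) ->
  gen_eigenvalue K (diag_mx m) n <= n%:R * r.
Proof.
move=> n_gt0 symK m_gt0 Kr CS; have := gen_eigenvalueP symK m_gt0.
rewrite /gen_eigenvalue; set s := xget _ _ => -[ssz _ [X Xunit KX]].
have l_lt : (n.-1 < n)%N by rewrite prednK.
pose l := Ordinal l_lt; pose x := col l X.
have Kx : K *m x = s`_n.-1 *: (diag_mx m *m x).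
  rewrite /x !colE mulmxA KX -[LHS]mulmxA -[X in _ *m X]colE.
  have -> : col l (diag_mx (\row_i s`_i)) = s`_n.-1 *: delta_mx l 0.
    apply/matrixP => i j; rewrite !mxE ord1 eqxx andbT.
    by case: (eqVneq i l) => [->|_]; rewrite ?mulr1n ?mulr1 ?mulr0n ?mulr0.
  by rewrite -scalemxAr mulmxA.
have x_neq0 : x != 0.
  apply: contraTneq Xunit => x0; rewrite -unitmx_tr -row_free_unit; apply/negP.
  move=> /row_freeP[Y XY]; have /(congr1 (row l)) := XY.
  rewrite row_mul -tr_col -/x x0 trmx0 mul0mx => /rowP/(_ l)/eqP.
  by rewrite !mxE eqxx eq_sym oner_eq0.
pose N := \sum_i m 0 i * x i 0 ^+ 2.
have N_gt0 : 0 < N.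
  rewrite lt0r sumr_ge0 ?andbT; last by move=> i _; rewrite mulr_ge0 ?sqr_ge0// ltW.
  apply: contra x_neq0; rewrite psumr_eq0; last first.
    by move=> i _; rewrite mulr_ge0 ?sqr_ge0// ltW.
  move=> /allP x0; apply/eqP/colP => i; rewrite [RHS]mxE; apply/eqP.
  have := x0 i (mem_index_enum _); rewrite mulf_eq0 sqrf_eq0 => /orP[|//].
  by rewrite gt_eqF.
rewrite -(ler_pM2r N_gt0).
have -> : s`_n.-1 * N = (x^T *m K *m x) 0 0.
  by rewrite -mulmxA Kx -scalemxAr mxE mulmxA mulmx_trc_diag.
rewrite mulmx_trcE.
apply: (@le_trans _ _ (\sum_i \sum_j 2^-1 * (x i 0 ^+ 2 * K i i + x j 0 ^+ 2 * K j j))).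
  by apply: ler_sum => i _; apply: ler_sum => j _; rewrite ler_pdivlMl.
apply: (@le_trans _ _ (\sum_i n%:R * (x i 0 ^+ 2 * K i i))).
  rewrite le_eqVlt; apply/orP; left; apply/eqP.
  under eq_bigr do rewrite -mulr_sumr big_split /= sumr_const card_ord -[X in X + _]mulr_natl.
  rewrite -[LHS]mulr_sumr big_split /= sumr_const card_ord -[X in _ + X]mulr_natl -!mulr_sumr.
  by field.
rewrite /N -!mulr_sumr -mulrA ler_wpM2l// mulr_sumr; apply: ler_sum => i _.
by rewrite mulrC [leRHS]mulrA ler_wpM2r ?sqr_ge0.
Qed.

End Pencil.

(** * B-splines as piecewise polynomials *)

Section PolynomialPieces.
Context {R : realType} (t : seq R).

(* The polynomial with which the B-spline number i of degree p coincides on the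
   knot span number a. *)
Fixpoint bpoly (p i a : nat) : {poly R} :=
  if p is q.+1 then
    (t`_(i + p) - t`_i)^-1 *: ('X - (t`_i)%:P) * bpoly q i a +
    (t`_(i + p).+1 - t`_i.+1)^-1 *: ((t`_(i + p).+1)%:P - 'X) * bpoly q i.+1 a
  else (i == a)%:R.

Lemma bpolyS q i a x : (bpoly q.+1 i a).[x] =
  (x - t`_i) / (t`_(i + q.+1) - t`_i) * (bpoly q i a).[x] +
  (t`_(i + q.+1).+1 - x) / (t`_(i + q.+1).+1 - t`_i.+1) * (bpoly q i.+1 a).[x].
Proof.
by rewrite /= hornerD !hornerM !hornerZ !hornerE ![_^-1 * (_ - _)]mulrC.
Qed.

Lemma bpoly_eq0 p i a : ~~ (i <= a <= i + p)%N -> bpoly p i a = 0.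
Proof.
elim: p i => [|p IHp] i ia /=.
  by case: eqP => // ia'; move: ia; rewrite ia' addn0 leqnn.
by rewrite !IHp ?mulr0 ?addr0//; lia.
Qed.

Hypothesis t_sorted : sorted <=%R t.

Lemma knot_le i j : (i <= j < size t)%N -> t`_i <= t`_j.
Proof.
move=> /andP[ij jt]; apply: (sorted_leq_nth le_trans) => //; rewrite inE//.
exact: leq_ltn_trans jt.
Qed.

Lemma cox_de_boor_bpoly p i a (x : R) : (a.+1 < size t)%N -> t`_a <= x < t`_a.+1 ->
  (i + p.+1 < size t)%N -> cox_de_boor t p i x = (bpoly p i a).[x].
Proof.
move=> a_lt /andP[ax xa]; elim: p i => [|p IHp] i; last first.
  by move=> ip; rewrite bpolyS /= !IHp//; lia.
rewrite addn1 => i_lt; rewrite /= hornerMn hornerC.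
(* Strictly before the last knot, the right-closed clause of the recursion is inactive. *)
have xl : x < last 0 t.
  apply: (lt_le_trans xa); rewrite -nth_last; apply: knot_le.
  by case: (size t) a_lt => // n; rewrite ltnS /= ltnSn andbT.
rewrite [x == last _ _]lt_eqF// !andbF orbF.
have [->|ia] := eqVneq i a; first by rewrite ax xa.
case: ifP => // /andP[ix xi]; exfalso; move: ia; rewrite neq_ltn => /orP[ia|ia].
  by have := @knot_le i.+1 a; rewrite ia ltnW// => /(_ isT); lra.
by have := @knot_le a.+1 i; rewrite ia ltnW// => /(_ isT); lra.
Qed.

Section Span.
Variable a : nat.
Hypotheses (a_lt : (a.+1 < size t)%N) (ta : t`_a < t`_a.+1).

Lemma bpoly_ge0 p i (x : R) : (i + p.+1 < size t)%N -> t`_a <= x <= t`_a.+1 ->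
  0 <= (bpoly p i a).[x].
Proof.
elim: p i => [|p IHp] i it ax; first by rewrite hornerMn hornerC ler0n.
have [ia|/bpoly_eq0->] := boolP (i <= a <= i + p.+1)%N; last by rewrite horner0.
have [it1 it2] : (i + p.+1 < size t)%N /\ (i.+1 + p.+1 < size t)%N by lia.
rewrite bpolyS addr_ge0// mulr_ge0 ?IHp// divr_ge0// subr_ge0.
- by have := @knot_le i a ltac:(lia); lra.
- by have := @knot_le i (i + p.+1) ltac:(lia); lra.
- by have := @knot_le a.+1 (i + p.+1).+1 ltac:(lia); lra.
- by have := @knot_le i.+1 (i + p.+1).+1 ltac:(lia); lra.
Qed.

(** One of the two nonnegative terms of the recursion is positive: the first while [a] still lies in
    the support of B-spline i of the lower degree, the second on the last span of the support. *)
Lemma bpoly_gt0 p i (x : R) : (i <= a <= i + p)%N -> (i + p.+1 < size t)%N ->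
  t`_a < x < t`_a.+1 -> 0 < (bpoly p i a).[x].
Proof.
elim: p i => [|p IHp] i ia it ax.
  have -> : i = a by lia.
  by rewrite /= eqxx hornerC.
have ax' : t`_a <= x <= t`_a.+1 by lra.
have [it1 it2] : (i + p.+1 < size t)%N /\ (i.+1 + p.+1 < size t)%N by lia.
have c1 : 0 <= (x - t`_i) / (t`_(i + p.+1) - t`_i).
  have := @knot_le i a ltac:(lia).
  by have := @knot_le i (i + p.+1) ltac:(lia) => *; rewrite divr_ge0// subr_ge0; lra.
have c2 : 0 <= (t`_(i + p.+1).+1 - x) / (t`_(i + p.+1).+1 - t`_i.+1).
  have := @knot_le a.+1 (i + p.+1).+1 ltac:(lia).
  by have := @knot_le i.+1 (i + p.+1).+1 ltac:(lia) => *; rewrite divr_ge0// subr_ge0; lra.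
have P1 := bpoly_ge0 it1 ax'; have P2 := bpoly_ge0 it2 ax'.
rewrite bpolyS; have [iap|] := leqP a (i + p).
  apply: ltr_pwDl; last exact: mulr_ge0.
  apply: mulr_gt0; last by apply: IHp => //; lia.
  have := @knot_le i a ltac:(lia); have := @knot_le a.+1 (i + p.+1) ltac:(lia) => *.
  by rewrite divr_gt0 ?subr_gt0; lra.
move=> iap; apply: ltr_wpDl; first exact: mulr_ge0.
apply: mulr_gt0; last by apply: IHp => //; lia.
have := @knot_le i.+1 a ltac:(lia); have := @knot_le a.+1 (i + p.+1).+1 ltac:(lia) => *.
by rewrite divr_gt0 ?subr_gt0; lra.
Qed.

(** Each B-spline of the lower degree enters two consecutive B-splines of the higher degree, with a
    falling and a rising weight that add up to 1. Since a = b + p, the indices b, ..., a are exactly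
    those whose support contains the span. *)
Lemma bpoly_sum1 p b : a = (b + p)%N -> (b + p + p.+1 < size t)%N ->
  \sum_(b <= i < a.+1) bpoly p i a = 1.
Proof.
elim: p b => [|p IHp] b ab bt.
  by rewrite addn0 in ab; rewrite -ab big_nat1 /= eqxx.
rewrite /= big_split /= big_ltn ?ab; last by lia.
rewrite -ab (@bpoly_eq0 p b) ?mulr0 ?add0r; last by lia.
rewrite [X in _ + X]big_nat_recr /=; last by lia.
rewrite (@bpoly_eq0 p a.+1) ?mulr0 ?addr0; last by lia.
rewrite big_add1 /= -big_split /= -[RHS](IHp b.+1) ?addSnnS//; last by lia.
rewrite big_add1 /=; apply: eq_big_nat => i /andP[bi ia].
rewrite -mulrDl addSn -scalerDr.
have -> : 'X - (t`_i.+1)%:P + ((t`_(i + p.+1).+1)%:P - 'X) =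
    (t`_(i + p.+1).+1 - t`_i.+1)%:P by rewrite polyCB; ring.
rewrite -mul_polyC -polyCM mulVf ?mul1r//.
have h1 := @knot_le i.+1 a ltac:(lia); have h2 := @knot_le a.+1 (i + p.+1).+1 ltac:(lia).
by rewrite subr_eq0 gt_eqF// (le_lt_trans h1)// (lt_le_trans ta).
Qed.

(** The knots j, ..., a coincide, so B-spline j starts at a knot of multiplicity a - j + 1 and
    vanishes there to order p - (a - j); positivity of the cofactor makes the order exact. In the
    recursion the first term gains a factor X - t_a, while the second has the right order already,
    its B-spline having one coinciding knot fewer. *)
Lemma bpoly_begins p j : (j <= a <= j + p)%N -> (j + p.+1 < size t)%N ->
  t`_j = t`_a ->
  exists2 Q : {poly R}, bpoly p j a = ('X - (t`_a)%:P) ^+ (p - (a - j)) * Q & 0 < Q.[t`_a].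
Proof.
elim: p j => [|p IHp] j ja jt tj.
  have -> : j = a by lia.
  by exists 1; rewrite /= ?eqxx ?mulr1// hornerC.
have le_ta i : (j <= i <= a)%N -> t`_i = t`_a.
  move=> /andP[ji ia]; apply/le_anti; have := @knot_le j i ltac:(lia).
  by have := @knot_le i a ltac:(lia); lra.
(* If a = j + p + 1, the multiplicity exceeds the degree by one: the order is 0, the first term
   vanishes, and the B-spline jumps to a positive value. *)
have [jap|jap] := leqP a (j + p); last first.
  have aE : a = (j + p).+1 by lia.
  rewrite /= (@bpoly_eq0 p j) ?mulr0 ?add0r; last by lia.
  have [|||Q -> Q_gt0] := IHp j.+1; [lia..|by apply: le_ta; lia|].
  have -> : (p.+1 - (a - j) = 0)%N by lia.
  have -> : (p - (a - j.+1) = 0)%N by lia.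
  eexists; first by rewrite !expr0 !mul1r.
  rewrite hornerM mulr_gt0// hornerZ !hornerE mulr_gt0 ?invr_gt0 ?subr_gt0//.
  - by rewrite [t`_j.+1]le_ta; [|lia]; rewrite addnS -aE.
  - by rewrite addnS -aE.
have ta' : t`_a.+1 <= t`_(j + p.+1) by apply: knot_le; lia.
have [|||Q1 E1 Q1_gt0] := IHp j; [lia..|by []|].
have E2 : exists2 Q2 : {poly R}, bpoly p j.+1 a = ('X - (t`_a)%:P) ^+ (p.+1 - (a - j)) * Q2 &
    0 <= Q2.[t`_a].
  have [aj|ja'] := leqP a j.
    by exists 0; rewrite ?horner0// mulr0 bpoly_eq0//; lia.
  have [|||Q2 E2 Q2_gt0] := IHp j.+1; [lia..|by apply: le_ta; lia|].
  by exists Q2; rewrite ?ltW// E2; congr (_ ^+ _ * _); lia.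
case: E2 => Q2 E2 Q2_ge0.
exists ((t`_(j + p.+1) - t`_j)^-1 *: Q1 +
    (t`_(j + p.+1).+1 - t`_j.+1)^-1 *: ((t`_(j + p.+1).+1)%:P - 'X) * Q2).
  have -> : (p.+1 - (a - j) = (p - (a - j)).+1)%N by lia.
  rewrite /= E1 E2 tj -!mul_polyC exprS.
  have -> : (p.+1 - (a - j) = (p - (a - j)).+1)%N by lia.
  by rewrite exprS; ring.
have le1 := @knot_le (j + p.+1) (j + p.+1).+1 ltac:(lia).
have le2 := @knot_le j.+1 (j + p.+1).+1 ltac:(lia).
have ta0 := ta; have gt1 : 0 < t`_(j + p.+1) - t`_a by lra.
have ge1 : 0 <= t`_(j + p.+1).+1 - t`_j.+1 by lra.
have ge2 : 0 <= t`_(j + p.+1).+1 - t`_a by lra.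
rewrite hornerD hornerM !hornerZ !hornerE tj.
by rewrite ltr_pwDl ?mulr_ge0 ?mulr_gt0 ?invr_gt0 ?invr_ge0.
Qed.

(** On its first span, and in [bpoly_last] on its last one, a B-spline is a pure power with no zero
    of its derivative inside the span. This later supplies a function whose energy is bounded
    below. *)
Lemma bpoly_first p : (a + p.+1 < size t)%N ->
  exists2 C, 0 < C & bpoly p a a = C *: ('X - (t`_a)%:P) ^+ p.
Proof.
have ta0 := ta; elim: p => [|p IHp] at_; first by exists 1; rewrite //= eqxx scale1r.
have [|C C_gt0 E] := IHp; first by lia.
exists ((t`_(a + p.+1) - t`_a)^-1 * C).
  rewrite mulr_gt0// invr_gt0 subr_gt0.
  by have := @knot_le a.+1 (a + p.+1) ltac:(lia); lra.
rewrite /= E (@bpoly_eq0 p a.+1) ?mulr0 ?addr0; last by lia.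
by rewrite -!mul_polyC exprS polyCM; ring.
Qed.

Lemma bpoly_last p b : a = (b + p)%N -> (b + p.+1 < size t)%N ->
  exists2 C, 0 < C & bpoly p b a = C *: ((t`_a.+1)%:P - 'X) ^+ p.
Proof.
have ta0 := ta; elim: p b => [|p IHp] b ab bt; first by exists 1; rewrite //= ab addn0 eqxx scale1r.
have [||C C_gt0 E] := IHp b.+1; [lia..|].
exists ((t`_a.+1 - t`_b.+1)^-1 * C).
  rewrite mulr_gt0// invr_gt0 subr_gt0.
  by have := @knot_le b.+1 a ltac:(lia); lra.
rewrite /= E (@bpoly_eq0 p b) ?mulr0 ?add0r; last by lia.
have -> : (b + p.+1).+1 = a.+1 by lia.
by rewrite -!mul_polyC exprS polyCM; ring.
Qed.

End Span.
End PolynomialPieces.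

(** * Open knot vectors: multiplicities, index blocks and nonempty spans *)

Section SplineSpace.
Context {R : realType} (U : spline_space R).
Local Notation t := (knots U).
Local Notation p := (deg U).
Local Notation N := (nbasis U).

Lemma count_le_lt_mem (x : R) (s : seq R) :
  count (<= x)%O s = (count (< x)%O s + count_mem x s)%N.
Proof.
elim: s => //= y s ->.
have -> : (y <= x)%R = ((y < x)%R + (y == x))%N :> nat by case: ltgtP.
by rewrite addnACA.
Qed.

(** In a sorted sequence equal values occupy one block of indices, from the number of smaller
    entries to the number of entries not larger. This turns multiplicities into index ranges. *)
Lemma knot_count (j : nat) : (j < size t)%N ->
  (count (< (t`_j)%R)%O t <= j < count (<= (t`_j)%R)%O t)%N.
Proof.
move=> jt; rewrite leqNgt ltnNge; apply/andP; split; apply/negP => jc.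
  by move: jc; rewrite -ltnNge => /(nth_count_lt 0 (knots_sorted U)); rewrite ltxx.
have := @nth_count_gt _ _ t`_j 0 t j (knots_sorted U).
by move/negP: jc; rewrite -leqNgt => ->; rewrite jt ltxx => /(_ isT).
Qed.

Lemma knots_neq0 : t != [::].
Proof. by apply/eqP => t0; have := knots_proper U; rewrite t0 ltxx. Qed.

Lemma mem_last_knot : last_knot U \in t.
Proof. by rewrite /last_knot; case: (t) knots_neq0 => // y s _ /=; exact: mem_last. Qed.

Lemma first_knot_nth : first_knot U = t`_0.
Proof. by rewrite /first_knot -nth0. Qed.

Lemma last_knot_nth : last_knot U = t`_(size t).-1.
Proof. by rewrite /last_knot -nth_last. Qed.

Lemma knot_ge_first i : (i < size t)%N -> first_knot U <= t`_i.
Proof. by move=> it; rewrite first_knot_nth (knot_le (knots_sorted U)). Qed.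

Lemma knot_le_last i : (i < size t)%N -> t`_i <= last_knot U.
Proof.
move=> it; rewrite last_knot_nth (knot_le (knots_sorted U))//.
by case: (size t) it => // n; rewrite ltnS => -> /=.
Qed.

Lemma first_lt_last : first_knot U < last_knot U.
Proof. exact: knots_proper. Qed.

Lemma count_lt_first : count (< first_knot U)%O t = 0%N.
Proof.
apply/eqP; rewrite -leqn0 leqNgt -has_count; apply/hasPn => x /(nthP 0)[i it <-].
by rewrite -leNgt knot_ge_first.
Qed.

Lemma count_le_first : count (<= first_knot U)%O t = p.+1.
Proof. by rewrite count_le_lt_mem count_lt_first (mult_first U). Qed.

Lemma count_le_last : count (<= last_knot U)%O t = size t.
Proof.
apply/eqP; rewrite -all_count; apply/allP => x /(nthP 0)[i it <-].
exact: knot_le_last.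
Qed.

Lemma nbasis_count : N = count (< last_knot U)%O t.
Proof.
by rewrite /nbasis -count_le_last count_le_lt_mem (mult_last U) addnK.
Qed.

Lemma size_knots : size t = (N + p.+1)%N.
Proof.
by rewrite -count_le_last count_le_lt_mem (mult_last U) nbasis_count.
Qed.

Lemma knot_first i : (i <= p)%N -> t`_i = first_knot U.
Proof.
move=> ip; apply: (nth_count_eq _ (knots_sorted U)).
by rewrite count_lt_first count_le_first ltnS.
Qed.

Lemma knot_last i : (N <= i < size t)%N -> t`_i = last_knot U.
Proof.
by move=> ip; apply: (nth_count_eq _ (knots_sorted U)); rewrite -nbasis_count count_le_last.
Qed.

Lemma span_bounds a : (a.+1 < size t)%N -> t`_a < t`_a.+1 -> (p <= a < N)%N.
Proof.
move=> at_ ta; apply/andP; split.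
  rewrite leqNgt; apply/negP => ap; move: ta.
  by rewrite !knot_first ?ltxx// ltnW.
rewrite ltnNge; apply/negP => Na; move: ta.
by rewrite !knot_last ?ltxx//; lia.
Qed.

Lemma half_open_span x : first_knot U <= x < last_knot U ->
  exists2 a, (a.+1 < size t)%N & t`_a <= x < t`_a.+1.
Proof.
move=> /andP[fx xl].
have c_gt0 : (0 < count (<= x)%O t)%N.
  rewrite -has_count; apply/hasP; exists t`_0; last by rewrite -first_knot_nth.
  by apply: mem_nth; rewrite lt0n size_eq0 knots_neq0.
have c_lt : (count (<= x)%O t < size t)%N.
  rewrite ltn_neqAle count_size andbT -all_count; apply/allPn.
  exists t`_(size t).-1; last by rewrite -last_knot_nth -ltNge.
  by apply: mem_nth; case: (size t) c_gt0 (count_size (<= x)%O t) => //; case: (count _ _).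
exists (count (<= x)%O t).-1; rewrite prednK//; apply/andP; split.
  by apply: (nth_count_le _ (knots_sorted U)); rewrite prednK.
by apply: (nth_count_gt _ (knots_sorted U)); rewrite leqnn.
Qed.

Lemma open_span x : first_knot U <= x <= last_knot U -> x \notin t ->
  exists2 a, (a.+1 < size t)%N & t`_a < x < t`_a.+1.
Proof.
move=> /andP[fx xl] xt.
have xl' : x < last_knot U.
  rewrite lt_neqAle xl andbT; apply: contraNneq xt => ->.
  exact: mem_last_knot.
have [|a at_ /andP[ax xa]] := @half_open_span x; first by rewrite fx.
exists a => //; rewrite xa andbT lt_neqAle ax andbT; apply: contraNneq xt => <-.
by rewrite mem_nth// ltnW.
Qed.

Lemma count_mem_knots (x : R) : (count_mem x t <= p.+1)%N.
Proof.
have [xt|/count_memPn->//] := boolP (x \in t).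
have [i it xE] := nthP 0 xt.
have := knot_ge_first it; rewrite xE le_eqVlt => /predU1P[<-|fx].
  by rewrite (mult_first U).
have := knot_le_last it; rewrite xE le_eqVlt => /predU1P[->|xl].
  by rewrite (mult_last U).
by apply: leqW; apply: mult_internal => //; rewrite -/(first_knot U) fx.
Qed.

(** The witness is the last index whose knot equals knot j; multiplicities of at most p + 1 keep it
    within the support of B-spline j. *)
Lemma first_span j : (j < N)%N ->
  exists a, [/\ (j <= a <= j + p)%N, (a.+1 < size t)%N, t`_a = t`_j & t`_a < t`_a.+1].
Proof.
move=> jN; have szE := size_knots; have jt : (j < size t)%N by lia.
have /andP[cj jc] := knot_count jt.
have cc : (count (<= (t`_j)%R)%O t <= j + p.+1)%N.
  by rewrite count_le_lt_mem leq_add// count_mem_knots.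
have c_gt0 : (0 < count (<= (t`_j)%R)%O t)%N by exact: leq_ltn_trans jc.
exists (count (<= (t`_j)%R)%O t).-1; rewrite prednK//.
have tc : t`_(count (<= (t`_j)%R)%O t).-1 = t`_j.
  apply: (nth_count_eq _ (knots_sorted U)); rewrite prednK// leqnn andbT.
  by apply: (leq_trans cj); rewrite -ltnS prednK.
split => //; [by lia|by lia|].
by rewrite tc; apply: (nth_count_gt _ (knots_sorted U)); rewrite leqnn /= (leq_ltn_trans cc)// szE ltn_add2r.
Qed.

(** Here k is the last occurrence of [xi], so the B-splines beginning at [xi] are those with the m
    indices k - m + 1, ..., k, m being the multiplicity. Index k gives the smoothest one and k - m +
    1 the roughest. *)
Lemma internal_knotP xi : internal_knot U xi ->
  exists k, [/\ (k.+1 < size t)%N, t`_k = xi, t`_k < t`_k.+1,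
    (0 < count_mem xi t <= p)%N &
    forall j, (j < size t)%N -> (t`_j == xi) = (j <= k < j + count_mem xi t)%N].
Proof.
move=> [xit fxl].
have /andP[c_gt0 cp] : (0 < count_mem xi t <= p)%N.
  by rewrite -has_count has_pred1 xit mult_internal.
have cE := count_le_lt_mem xi t.
have c_lt : (count (<= xi)%O t < size t)%N.
  rewrite ltn_neqAle count_size andbT -all_count; apply/allPn.
  exists (last_knot U); last by rewrite -ltNge; case/andP: fxl.
  exact: mem_last_knot.
have tc i : (count (< xi)%O t <= i < count (<= xi)%O t)%N -> t`_i = xi.
  by move=> ic; exact: (nth_count_eq _ (knots_sorted U)).
exists (count (<= xi)%O t).-1; rewrite prednK; last by lia.
have tk : t`_(count (<= xi)%O t).-1 = xi by apply: tc; lia.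
split => //; last 2 first.
- by rewrite c_gt0.
- move=> j jt; apply/eqP/idP => [tj|jc]; last by apply: tc; lia.
  have := knot_count jt; rewrite tj cE.
  by move: (count _ _) (count_mem xi t) c_gt0 => c m m_gt0; lia.
by rewrite tk; apply: (nth_count_gt _ (knots_sorted U)); rewrite leqnn.
Qed.

End SplineSpace.

(** * B-splines: pieces, values at the end knots, beginning of the support *)

Section BSplines.
Context {R : realType} (U : spline_space R).
Local Notation t := (knots U).
Local Notation p := (deg U).
Local Notation N := (nbasis U).

Definition is_span a := (a.+1 < size t)%N && (t`_a < t`_a.+1).

Definition piece i a := bpoly t p i a.

Lemma bspline_piece i a x : (i < N)%N -> (a.+1 < size t)%N -> t`_a <= x < t`_a.+1 ->
  bspline U i x = (piece i a).[x].
Proof.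
move=> iN at_ ax; apply: cox_de_boor_bpoly => //; first exact: knots_sorted.
by rewrite size_knots ltn_add2r.
Qed.

Lemma piece_gt0 i a x : (i < N)%N -> is_span a -> (i <= a <= i + p)%N -> t`_a < x < t`_a.+1 ->
  0 < (piece i a).[x].
Proof.
move=> iN /andP[at_ ta] ia ax; apply: bpoly_gt0 => //; first exact: knots_sorted.
by rewrite size_knots ltn_add2r.
Qed.

Lemma piece_eq0 i a : ~~ (i <= a <= i + p)%N -> piece i a = 0.
Proof. exact: bpoly_eq0. Qed.

Lemma piece_ge0 i a x : (i < N)%N -> is_span a -> t`_a < x < t`_a.+1 ->
  0 <= (piece i a).[x].
Proof.
move=> iN sa ax; have [ia|/piece_eq0->] := boolP (i <= a <= i + p)%N.
  by rewrite ltW// piece_gt0.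
by rewrite horner0.
Qed.

Lemma piece_sum1 a : is_span a -> \sum_(i < N) piece i a = 1.
Proof.
move=> /andP[at_ ta]; have /andP[pa aN] := span_bounds at_ ta.
have szE := size_knots U.
rewrite -(big_mkord xpredT (fun i => piece i a)) (big_cat_nat _ (n := (a - p)%N)) //=; last by lia.
rewrite big_nat_cond big1 ?add0r; last by move=> i ?; rewrite piece_eq0//; lia.
rewrite (big_cat_nat _ (n := a.+1))//=; last by lia.
rewrite [X in _ + X]big_nat_cond [X in _ + X]big1 ?addr0; last first.
  by move=> i ?; rewrite piece_eq0//; lia.
by apply: bpoly_sum1 => //; [exact: knots_sorted|lia|lia].
Qed.

Lemma cox_de_boor_outside q i x : (i + q.+1 < size t)%N ->
  x < first_knot U \/ last_knot U < x -> cox_de_boor t q i x = 0.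
Proof.
move=> + xout; elim: q i => [|q IHq] i iq; last first.
  by rewrite /= !IHq ?mulr0 ?addr0//; lia.
rewrite /= addn1 in iq *; have := @knot_ge_first _ U i ltac:(lia).
have := @knot_le_last _ U i.+1 ltac:(lia) => il fi.
case: ifP => // /orP[/andP[ix xi]|/and3P[_ _ /eqP xl]]; first by exfalso; lra.
have := first_lt_last U; rewrite /first_knot /last_knot in xout *.
by rewrite -xl in xout * => *; exfalso; lra.
Qed.

Lemma bspline_outside i x : (i < N)%N -> x < first_knot U \/ last_knot U < x ->
  bspline U i x = 0.
Proof.
by move=> iN; apply: cox_de_boor_outside; rewrite size_knots ltn_add2r.
Qed.

Lemma cox_de_boor_last q i : (q <= p)%N -> (i + q.+1 < size t)%N -> i != N.-1 ->
  cox_de_boor t q i (last_knot U) = 0.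
Proof.
have szE := size_knots U.
elim: q i => [|q IHq] i qp iq iN.
  rewrite /= addn1 in iq *; have := @knot_le_last _ U i.+1 ltac:(lia) => il.
  rewrite -/(last_knot U) eqxx andbT ltNge il andbF /=; case: ifP => // /andP[ti /eqP tl].
  by have := span_bounds iq ti; have := knot_count iq; rewrite tl -nbasis_count; lia.
rewrite /= IHq ?mulr0 ?add0r; [|lia..|by []].
(* The B-spline N - 1 of lower degree may be nonzero at the last knot, but its weight is 0 because
   the knot in that weight is the last one. *)
have [i1|i1] := eqVneq i.+1 N.-1; last by rewrite IHq ?mulr0//; lia.
by rewrite (@knot_last _ U (i + q.+1).+1) ?subrr ?mul0r//; lia.
Qed.

Lemma bspline_last i : (i < N)%N -> i != N.-1 -> bspline U i (last_knot U) = 0.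
Proof.
by move=> iN; apply: cox_de_boor_last => //; rewrite size_knots ltn_add2r.
Qed.

Lemma bspline_first i : (0 < i < N)%N -> bspline U i (first_knot U) = 0.
Proof.
move=> /andP[i0 iN]; have szE := size_knots U.
have [|a at_ /andP[ax xa]] := @half_open_span _ U (first_knot U).
  by rewrite lexx first_lt_last.
have ta : t`_a = first_knot U.
  by apply/le_anti; rewrite ax knot_ge_first// ltnW.
have tta : t`_a < t`_a.+1 by rewrite ta.
have aE : a = p.
  have := span_bounds at_ tta; have := @knot_count _ U a (ltnW at_).
  by rewrite ta count_le_first; lia.
rewrite (bspline_piece iN at_) ?ax//.
have [ip|pi] := leqP i p; last first.
  by rewrite piece_eq0 ?horner0//; lia.
have [|||Q QE _] := @bpoly_begins _ t (knots_sorted U) a at_ tta p i; [lia|lia|..].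
  by rewrite ta knot_first.
rewrite /piece QE ta hornerM horner_exp !hornerE subrr expr0n.
(* Since a = p, the order of vanishing p - (a - i) is i, which is positive. *)
have -> : (p - (a - i) == 0 = false)%N by lia.
by rewrite mul0r.
Qed.

Lemma bspline_neq0_ge i x : (i < N)%N -> bspline U i x != 0 -> t`_i <= x.
Proof.
move=> iN; have szE := size_knots U; have [xf|fx] := ltP x (first_knot U).
  by rewrite bspline_outside ?eqxx//; left.
have [xl|] := ltP x (last_knot U); last first.
  by move=> lx _; apply: (le_trans _ lx); apply: knot_le_last; lia.
have [|a at_ ax] := @half_open_span _ U x; first by rewrite fx.
rewrite (bspline_piece iN at_ ax) => Bx.
have [ia|ia] := leqP i a; last first.
  by move: Bx; rewrite piece_eq0 ?horner0 ?eqxx//; lia.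
case/andP: ax => ax _; apply: (le_trans _ ax).
by apply: knot_le; [exact: knots_sorted|lia].
Qed.

Lemma begins_at_unique (f : R -> R) (x y : R) : begins_at f x -> begins_at f y -> x = y.
Proof. by move=> [fx lx] [fy ly]; apply/le_anti; rewrite lx// ly. Qed.

(** By [first_span] a nonempty span starts at the value of knot j and lies in the support, so the
    B-spline is positive arbitrarily close to the right of that knot. *)
Lemma bspline_begins j : (j < N)%N -> begins_at (bspline U j) t`_j.
Proof.
move=> jN; have [a [ja at_ taj ta]] := first_span jN; split; last first.
  suff : supp (bspline U j) `<=` [set x | t`_j <= x] by move=> sub x /sub.
  have /closure_id-> : closed [set x : R | t`_j <= x] by exact: closed_ge.
  by apply: closureS => x /=; exact: bspline_neq0_ge.
move=> V /nbhs_ballP[e /= e_gt0 eV].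
pose x : R := Num.min (t`_a + e / 2) ((t`_a + t`_a.+1) / 2).
have [ax xe xa] : [/\ t`_a < x, x < t`_a + e & x < t`_a.+1].
  by rewrite /x; case: (ltP (t`_a + e / 2)) => *; split; lra.
exists x; split.
  rewrite /= (@bspline_piece _ a)//; last by rewrite ltW.
  by rewrite gt_eqF// piece_gt0 /is_span ?at_// ax.
by apply: eV; rewrite /ball /= -taj distrC ger0_norm; lra.
Qed.

Lemma begins_atP j xi : (j < N)%N -> begins_at (bspline U j) xi <-> t`_j = xi.
Proof.
move=> jN; split=> [b|<-]; last exact: bspline_begins.
exact: begins_at_unique (bspline_begins jN) b.
Qed.

End BSplines.

(** * Stiffness and mass as integrals of piecewise polynomials *)

Section NullSet.
Context d (T : measurableType d) (R : realType) (mu : {measure set T -> \bar R}).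
Import HBNNSimple.

(** No measurability of f or g is assumed, because derivatives of B-splines take uncontrolled values
    on mesh lines. The integral is a supremum over simple functions below the integrand: cutting
    such a function to 0 on N keeps its integral and puts it below the other integrand. *)
Lemma integral_eq_off_null (D N : set T) (f g : T -> \bar R) :
  measurable N -> mu N = 0%E -> (forall z, D z -> ~ N z -> f z = g z) ->
  (\int[mu]_(x in D) f x = \int[mu]_(x in D) g x)%E.
Proof.
move=> mN N0 fg.
have le_sup (F G : T -> \bar R) : (forall z, (0 <= G z)%E) ->
    (forall z, ~ N z -> F z = G z) ->
    (ereal_sup [set sintegral mu h | h in [set h : {nnsfun T >-> R} |
      forall x, (h x)%:E <= F x]] <=
    ereal_sup [set sintegral mu h | h in [set h : {nnsfun T >-> R} |
      forall x, (h x)%:E <= G x]])%E.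
  move=> G0 FG; apply: ge_ereal_sup => _ [h hF <-].
  pose h' := proj_nnsfun h (measurableC mN).
  have -> : sintegral mu h = sintegral mu h'.
    rewrite -!integralT_nnsfun; apply: ge0_ae_eq_integral => //.
    - exact/measurable_EFinP.
    - exact/measurable_EFinP.
    - by move=> x _; rewrite lee_fin.
    - by move=> x _; rewrite lee_fin.
    exists N; split => // z; apply: contra_notP => zN /= _.
    by rewrite /h' /= mindicE mem_set ?mulr1.
  apply: ereal_sup_ubound; exists h' => // z; rewrite /h' /= mindicE.
  have [zN|zN] := boolP (z \in ~` N); last by rewrite mulr0.
  by rewrite mulr1 -FG//; apply: set_mem.
have fgD z : ~ N z -> (f \_ D) z = (g \_ D) z.
  by move=> zN; rewrite !patchE; case: ifPn => // /set_mem Dz; exact: fg.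
rewrite /integral; congr (_ - _)%E; apply/le_anti/andP; split; apply: le_sup => //;
  by move=> z zN; rewrite ?funeposE ?funenegE fgD.
Qed.

End NullSet.

(** * Product Lebesgue measure on the plane *)

Section PlaneMeasure.
Context {R : realType}.
(* [measurableTypeR R] is the carrier of Lebesgue measure; [R] itself has
   another canonical sigma-algebra, convertible to the Borel one. *)
Local Notation RT := (measurableTypeR R).
Local Notation mu2 := ((@lebesgue_measure R) \x (@lebesgue_measure R))%E.

(** Second countability: an open set is the countable union of the rational boxes that it contains,
    and boxes are measurable rectangles. *)
Lemma open_measurable_plane (A : set (R * R)) : open A -> measurable (A : set (RT * RT)).
Proof.
move=> oA; pose box (q : (rat * rat) * (rat * rat)) : set (R * R) :=
  `](ratr q.1.1), (ratr q.1.2)[%classic `*` `](ratr q.2.1), (ratr q.2.2)[%classic.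
have -> : A = \bigcup_q (if `[< box q `<=` A >] then box q else set0).
  apply/seteqP; split => [z Az|z [q _]]; last first.
    by case: ifPn => // /asboolP sub /sub.
  have /(_ z Az) [[P Q] /= [zP zQ] PQ] : forall z, A z -> nbhs z A.
    by move=> y Ay; apply: open_nbhs_nbhs.
  pose I (q : rat * rat) : set R := `]ratr q.1, ratr q.2[%classic.
  have interval (x : R) (V : set R) : nbhs x V -> exists q, I q x /\ (I q `<=` V).
    move=> /nbhs_ballP[e /= e_gt0 eV].
    have [|q1] := @rat_in_itvoo R (x - e) x; first by lra.
    have [|q2] := @rat_in_itvoo R x (x + e); first by lra.
    rewrite !in_itv /= => /andP[? ?] /andP[? ?]; exists (q1, q2).
    rewrite /I /= in_itv /=; split; first by apply/andP.
    move=> y; rewrite /= in_itv /= => /andP[? ?]; apply: eV.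
    by rewrite /ball /= ltr_norml; lra.
  have [q1 [zq1 q1P]] := interval _ _ zP; have [q2 [zq2 q2Q]] := interval _ _ zQ.
  exists (q1, q2) => //; rewrite asboolT; first by split.
  by move=> y [/q1P ? /q2Q ?]; apply: PQ.
apply: countable_bigcupT_measurable => [|q]; first exact: countableP.
by case: ifPn => // _; apply: measurableX.
Qed.

Lemma null_lines (s1 s2 : seq R) :
  let N := [set z : R * R | z.1 \in s1 \/ z.2 \in s2] in
  measurable (N : set (RT * RT)) /\ mu2 N = 0%E.
Proof.
have ms (s : seq R) : measurable ([set` s] : set RT).
  by apply: countable_measurable => //; exact/finite_set_countable/finite_seq.
have s0 (s : seq R) : lebesgue_measure [set` s] = 0%E.
  exact/countable_lebesgue_measure0/finite_set_countable/finite_seq.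
move=> N; have -> : N = [set` s1] `*` setT `|` setT `*` [set` s2].
  by apply/seteqP; split => z /=; [case; [left|right]|case=> [][]; [left|right]].
split; first by apply: measurableU; exact: measurableX.
apply/eqP; rewrite -measure_le0.
apply: (@le_trans _ _ (mu2 ([set` s1] `*` setT) + mu2 (setT `*` [set` s2]))%E).
  by apply: measureU2; exact: measurableX.
rewrite !product_measure1E// [X in (X * _ + _)%E](_ : _ = 0%E); last exact: s0.
by rewrite [X in (_ + _ * X)%E](_ : _ = 0%E) ?mul0e ?mule0 ?adde0//; exact: s0.
Qed.

Lemma lebesgue_itv (a b : R) (l r : bool) : a <= b ->
  lebesgue_measure ([set` Interval (BSide l a) (BSide r b)] : set R) = (b - a)%:E.
Proof.
move=> ab; rewrite lebesgue_measure_itv /= lte_fin.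
by move: ab; rewrite le_eqVlt => /predU1P[->|ab]; rewrite ?ltxx ?subrr// ab -EFinB.
Qed.

Lemma mu2_box (a b c e : R) : a <= b -> c <= e ->
  mu2 (`]a, b[%classic `*` `]c, e[%classic) = ((b - a) * (e - c))%:E.
Proof.
move=> ab ce.
transitivity (lebesgue_measure `]a, b[%classic * lebesgue_measure `]c, e[%classic)%E.
  exact: product_measure1E.
by rewrite !lebesgue_itv.
Qed.

Lemma mu2_rectangle (a b c e : R) : a <= b -> c <= e ->
  mu2 (rectangle a b c e) = ((b - a) * (e - c))%:E.
Proof.
move=> ab ce.
transitivity (lebesgue_measure `[a, b]%classic * lebesgue_measure `[c, e]%classic)%E.
  exact: product_measure1E.
by rewrite !lebesgue_itv.
Qed.

Lemma measurable_box (a b c e : R) : measurable (`]a, b[%classic `*` `]c, e[%classic : set (RT * RT)).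
Proof. exact: measurableX. Qed.

Lemma measurable_rectangle (a b c e : R) : measurable (rectangle a b c e : set (RT * RT)).
Proof. exact: measurableX. Qed.

Lemma interior_rectangle (a b c e : R) :
  interior (rectangle a b c e) = `]a, b[%classic `*` `]c, e[%classic.
Proof.
apply/seteqP; split => [z [[P Q] /= [zP zQ] PQ]|z [z1 z2]].
  have zA : `[a, b]%classic^° z.1.
    apply: (filterS _ zP) => x Px; have := nbhs_singleton zQ => Qz.
    by have [] := PQ (x, z.2) (conj Px Qz).
  have zB : `[c, e]%classic^° z.2.
    apply: (filterS _ zQ) => y Qy; have := nbhs_singleton zP => Pz.
    by have [] := PQ (z.1, y) (conj Pz Qy).
  by split; [move: zA|move: zB]; rewrite interior_itv_bnd.
exists (`]a, b[%classic, `]c, e[%classic) => /=.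
  by split; apply: open_nbhs_nbhs; split => //; exact: interval_open.
move=> y [/= y1 y2]; split; [move: y1|move: y2]; rewrite /= !in_itv /=;
  by move=> /andP[? ?]; rewrite !ltW.
Qed.

Section BoundedIntegrands.
Variable D : set (RT * RT).
Hypotheses (mD : measurable D) (D_fin : (mu2 D < +oo)%E).

Lemma bounded_integrable (f : RT * RT -> R) (C : R) : measurable_fun setT f ->
  (forall z, `|f z| <= C) -> mu2.-integrable D (EFin \o f).
Proof.
move=> mf fC; apply: measurable_bounded_integrable => //.
  exact: measurable_funS mf.
exists C; split; first exact: num_real.
by move=> M CM z _ /=; apply: (le_trans (fC z)); exact: ltW.
Qed.

Lemma Rintegral_indic (A : set (RT * RT)) (c : R) : measurable A ->
  Rintegral mu2 D (fun z => c * \1_A z) = c * fine (mu2 (A `&` D)).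
Proof.
move=> mA; rewrite RintegralZl//.
  by rewrite /Rintegral integral_indic.
apply: (@bounded_integrable _ 1) => [|z]; first exact: measurable_indic.
by rewrite indicE ger0_norm// lern1 leq_b1.
Qed.

Lemma integrable_indicZ (A : set (RT * RT)) (c : R) : measurable A ->
  mu2.-integrable D (EFin \o (fun z => c * \1_A z)).
Proof.
move=> mA; apply: (@bounded_integrable _ `|c|) => [|z].
  by apply: measurable_funM => //; exact: measurable_indic.
by rewrite normrM ler_piMr// indicE ger0_norm// lern1 leq_b1.
Qed.

(** All mass and energy estimates below have this form: a constant bound on a set, times the area of
    the part of the domain in that set. *)
Lemma integral2_le (f : RT * RT -> R) (A : set (RT * RT)) (C : R) : measurable A ->
  mu2.-integrable D (EFin \o f) -> (forall z, D z -> f z <= C * \1_A z) ->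
  integral2 D f <= C * fine (mu2 (A `&` D)).
Proof.
move=> mA intf fC; rewrite -Rintegral_indic//; apply: le_Rintegral => //.
exact: integrable_indicZ.
Qed.

Lemma integral2_ge (f : RT * RT -> R) (A : set (RT * RT)) (c : R) : measurable A ->
  mu2.-integrable D (EFin \o f) -> (forall z, D z -> c * \1_A z <= f z) ->
  c * fine (mu2 (A `&` D)) <= integral2 D f.
Proof.
move=> mA intf fC; rewrite -Rintegral_indic//; apply: le_Rintegral => //.
exact: integrable_indicZ.
Qed.

End BoundedIntegrands.
End PlaneMeasure.

Section OpenSpans.
Context {R : realType} (U : spline_space R).
Local Notation t := (knots U).
Local Notation N := (nbasis U).
Local Notation RT := (measurableTypeR R).

(* Piecewise polynomial function with value 0 at the knots, where neither the
   one-sided values nor the derivatives of B-splines matter for integrals. *)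
Definition on_spans (F : nat -> {poly R}) (x : R) : R :=
  \sum_(a < (size t).-1) \1_(`]t`_a, t`_a.+1[%classic) x * (F a).[x].

Lemma on_spansE F a (x : R) : (a.+1 < size t)%N -> t`_a < x < t`_a.+1 -> on_spans F x = (F a).[x].
Proof.
move=> at_ /andP[ax xa]; have al : (a < (size t).-1)%N by case: (size t) at_.
rewrite /on_spans (bigD1 (Ordinal al))//= big1 ?addr0.
  by rewrite indicE mem_set ?mul1r//= in_itv /= ax.
move=> b; rewrite -val_eqE /= => ba; rewrite indicE memNset ?mul0r//= in_itv /=.
move=> /andP[bx xb]; have bt := ltn_ord b.
have [bla|alb|/eqP] := ltngtP b a; last by rewrite (negbTE ba).
  by have := @knot_le _ _ (knots_sorted U) b.+1 a ltac:(lia); lra.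
have bt' : (a.+1 <= b < size t)%N by rewrite alb (leq_trans bt (leq_pred _)).
by have := knot_le (knots_sorted U) bt'; lra.
Qed.

Lemma on_spans_eq0 F (x : R) : (forall a, (a.+1 < size t)%N -> ~~ (t`_a < x < t`_a.+1)) ->
  on_spans F x = 0.
Proof.
move=> nox; rewrite /on_spans big1// => a _; rewrite indicE memNset ?mul0r//= in_itv /=.
by apply/negP; apply: nox; have := ltn_ord a; lia.
Qed.

Lemma on_spans_knot F x : x \in t -> on_spans F x = 0.
Proof.
move=> /(nthP 0)[i it <-]; apply: on_spans_eq0 => a at_.
apply/negP => /andP[ai ia]; have [ila|ali] := leqP i a.
  by have := @knot_le _ _ (knots_sorted U) i a ltac:(lia); lra.
have ait : (a.+1 <= i < size t)%N by rewrite ali.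
by have := knot_le (knots_sorted U) ait; lra.
Qed.

Lemma measurable_on_spans F : measurable_fun setT (on_spans F : RT -> R).
Proof.
apply: measurable_sum => a; apply: measurable_funM; first exact: measurable_indic.
exact: (continuous_measurable_fun (@continuous_horner _ (F a))).
Qed.

Lemma horner_bounded (q : {poly R}) (a b : R) :
  exists2 C : R, 0 <= C & forall x, a <= x <= b -> `|q.[x]| <= C.
Proof.
elim/poly_ind: q => [|q c [C C0 qC]].
  by exists 0 => // x _; rewrite horner0 normr0.
exists (C * (`|a| + `|b|) + `|c|); first by rewrite addr_ge0// mulr_ge0// addr_ge0.
move=> x xab; rewrite !hornerE (le_trans (ler_normD _ _))// lerD2r normrM.
apply: ler_pM => //; first exact: qC.
have hb := ler_norm b; have ha := ler_norm (- a); rewrite normrN in ha.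
by rewrite ler_norml; have := normr_ge0 a; have := normr_ge0 b; lra.
Qed.

Lemma on_spans_bounded F : exists2 C : R, 0 <= C & forall x, `|on_spans F x| <= C.
Proof.
rewrite /on_spans; elim: (size t).-1 => [|n [C C0 bC]].
  by exists 0 => // x; rewrite big_ord0 normr0.
have [C' C'0 bC'] := horner_bounded (F n) t`_n t`_n.+1.
exists (C + C'); first exact: addr_ge0.
move=> x; rewrite big_ord_recr /= (le_trans (ler_normD _ _))// lerD//.
rewrite indicE; have [/set_mem|_] := boolP (x \in _); last by rewrite mul0r normr0.
by rewrite /= in_itv /= => /andP[nx xn]; rewrite mul1r bC'// !ltW.
Qed.

Definition bspl i := on_spans (piece U i).
Definition dbspl i := on_spans (fun a => (piece U i a)^`()).

Lemma on_spans_cases (x : R) : (forall F, on_spans F x = 0) \/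
  exists a, is_span U a /\ t`_a < x < t`_a.+1.
Proof.
have [[a [at_ ax]]|nox] := pselect (exists a, (a.+1 < size t)%N /\ t`_a < x < t`_a.+1).
  right; exists a; split => //; rewrite /is_span at_ /=.
  by case/andP: ax; exact: lt_trans.
left => F; apply: on_spans_eq0 => a at_; apply/negP => ax.
by apply: nox; exists a.
Qed.

Lemma bspl_ge0 i x : (i < N)%N -> 0 <= bspl i x.
Proof.
move=> iN; rewrite /bspl; have [->//|[a [sa ax]]] := on_spans_cases x.
by rewrite (on_spansE _ _ ax) ?piece_ge0//; case/andP: sa.
Qed.

End OpenSpans.

(** * Tensor-product B-splines and their gradients on mesh elements *)

Section Plane.
Context {R : realType} (U1 U2 : spline_space R).
Local Notation RT := (measurableTypeR R).
Implicit Types i j : bindex U1 U2.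

Definition phi i (z : R * R) : R := bspl U1 i.1 z.1 * bspl U2 i.2 z.2.
Definition phi_x i (z : R * R) : R := dbspl U1 i.1 z.1 * bspl U2 i.2 z.2.
Definition phi_y i (z : R * R) : R := bspl U1 i.1 z.1 * dbspl U2 i.2 z.2.

Definition mesh : set (R * R) := [set z | z.1 \in knots U1 \/ z.2 \in knots U2].

Definition element a b : set (R * R) :=
  `](knots U1)`_a, (knots U1)`_a.+1[%classic `*` `](knots U2)`_b, (knots U2)`_b.+1[%classic.

Lemma elementP a b z : element a b z <->
  ((knots U1)`_a < z.1 < (knots U1)`_a.+1) && ((knots U2)`_b < z.2 < (knots U2)`_b.+1).
Proof. by rewrite /element /= !in_itv /=; split => [[-> ->]//|/andP[]]. Qed.

Lemma open_element a b : open (element a b).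
Proof. by rewrite /element -interior_rectangle; exact: open_interior. Qed.

Lemma element_exists z : background_domain U1 U2 z -> ~ mesh z ->
  exists a b, [/\ is_span U1 a, is_span U2 b & element a b z].
Proof.
move=> [/= + +] /not_orP[/negP z1 /negP z2]; rewrite !in_itv /= => bz1 bz2.
have [a at_ az] := open_span bz1 z1; have [b bt bz] := open_span bz2 z2.
exists a, b; split; last by apply/elementP; rewrite az.
  by rewrite /is_span at_ /=; case/andP: az; exact: lt_trans.
by rewrite /is_span bt /=; case/andP: bz; exact: lt_trans.
Qed.

Section Element.
Variables (a b : nat).
Hypotheses (sa : is_span U1 a) (sb : is_span U2 b).

Let at_ : (a.+1 < size (knots U1))%N. Proof. by case/andP: sa. Qed.
Let bt : (b.+1 < size (knots U2))%N. Proof. by case/andP: sb. Qed.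

Lemma tbspline_element i z : element a b z ->
  tbspline i z = (piece U1 i.1 a).[z.1] * (piece U2 i.2 b).[z.2].
Proof.
move=> /elementP/andP[/andP[? ?] /andP[? ?]].
by rewrite /tbspline (@bspline_piece _ U1 _ a) ?(@bspline_piece _ U2 _ b)// ltW.
Qed.

Lemma phi_element i z : element a b z ->
  [/\ phi i z = (piece U1 i.1 a).[z.1] * (piece U2 i.2 b).[z.2],
      phi_x i z = (piece U1 i.1 a)^`().[z.1] * (piece U2 i.2 b).[z.2] &
      phi_y i z = (piece U1 i.1 a).[z.1] * (piece U2 i.2 b)^`().[z.2]].
Proof.
move=> /elementP/andP[? ?].
by split; rewrite /phi /phi_x /phi_y /bspl /dbspl (@on_spansE _ U1 _ a) ?(@on_spansE _ U2 _ b).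
Qed.

(** Along (1, 0) the second factor is frozen, so the difference quotients are literally those of a
    univariate polynomial, and so are their limits. *)
Lemma derive_fst (p q : {poly R}) z :
  'D_(1, 0) (fun w : R * R => p.[w.1] * q.[w.2]) z = p^`().[z.1] * q.[z.2].
Proof.
have -> : p^`().[z.1] * q.[z.2] = (q.[z.2] *: p)^`().[z.1].
  by rewrite derivZ hornerZ mulrC.
rewrite derivE derive1E /derive; set f := (X in lim (X @ _) = _).
set g := (X in _ = lim (X @ _)); suff -> : f = g by [].
by apply/funext => h; rewrite /f /g /= scaler0 add0r !hornerZ ![q.[_] * _]mulrC.
Qed.

Lemma derive_snd (p q : {poly R}) z :
  'D_(0, 1) (fun w : R * R => p.[w.1] * q.[w.2]) z = p.[z.1] * q^`().[z.2].
Proof.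
have -> : p.[z.1] * q^`().[z.2] = (p.[z.1] *: q)^`().[z.2].
  by rewrite derivZ hornerZ.
rewrite derivE derive1E /derive; set f := (X in lim (X @ _) = _).
set g := (X in _ = lim (X @ _)); suff -> : f = g by [].
by apply/funext => h; rewrite /f /g /= scaler0 add0r !hornerZ.
Qed.

Lemma derive_tbspline i z v : element a b z -> 'D_v (tbspline i) z =
  'D_v (fun w : R * R => (piece U1 i.1 a).[w.1] * (piece U2 i.2 b).[w.2]) z.
Proof.
move=> Ez; apply: near_eq_derive; near=> w; apply: tbspline_element.
by near: w; apply: open_nbhs_nbhs; split => //; exact: open_element.
Unshelve. all: by end_near. Qed.

Lemma grad_dot_element i j z : element a b z ->
  grad_dot (tbspline i) (tbspline j) z = phi_x i z * phi_x j z + phi_y i z * phi_y j z.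
Proof.
move=> Ez; have [_ -> ->] := phi_element i Ez; have [_ -> ->] := phi_element j Ez.
by rewrite /grad_dot !derive_tbspline// !derive_fst !derive_snd.
Qed.

End Element.

Lemma phi_mesh i z : mesh z -> [/\ phi i z = 0, phi_x i z = 0 & phi_y i z = 0].
Proof.
by move=> [zm|zm]; split; rewrite /phi /phi_x /phi_y /bspl /dbspl (on_spans_knot _ zm)
  ?mul0r ?mulr0.
Qed.

Lemma phi_ge0 i z : 0 <= phi i z.
Proof. by rewrite mulr_ge0// bspl_ge0// ltn_ord. Qed.

Lemma measurable_product (F1 F2 : nat -> {poly R}) :
  measurable_fun setT (fun z : RT * RT => on_spans U1 F1 z.1 * on_spans U2 F2 z.2).
Proof.
apply: measurable_funM.
  exact: (measurableT_comp (measurable_on_spans U1 F1) measurable_fst).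
exact: (measurableT_comp (measurable_on_spans U2 F2) measurable_snd).
Qed.

Lemma bounded_product (F1 F2 : nat -> {poly R}) :
  exists2 C : R, 0 <= C & forall z : R * R, `|on_spans U1 F1 z.1 * on_spans U2 F2 z.2| <= C.
Proof.
have [C1 C1_ge0 b1] := on_spans_bounded U1 F1; have [C2 C2_ge0 b2] := on_spans_bounded U2 F2.
by exists (C1 * C2) => [|z]; rewrite ?mulr_ge0// normrM ler_pM.
Qed.

End Plane.

(** * Stiffness and mass integrals over the trimmed domain *)

Section TrimmedIntegrals.
Context {R : realType} (U1 U2 : spline_space R).
Local Notation RT := (measurableTypeR R).
Local Notation mu2 := ((@lebesgue_measure R) \x (@lebesgue_measure R))%E.
Implicit Types i j : bindex U1 U2.
Variable Om : set (R * R).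
Hypotheses (oOm : open Om) (Om_bg : Om `<=` background_domain U1 U2).

Let mOm : measurable (Om : set (RT * RT)). Proof. exact: open_measurable_plane. Qed.

Lemma mu2_trimmed_fin (A : set (RT * RT)) : measurable A -> (mu2 (A `&` Om) < +oo)%E.
Proof.
move=> mA; apply: (@le_lt_trans _ _ (mu2 (background_domain U1 U2))).
  apply: le_measure; rewrite ?inE.
  - exact: measurableI.
  - exact: measurable_rectangle.
  - by move=> z [_ /Om_bg].
by rewrite mu2_rectangle ?ltry// ltW// first_lt_last.
Qed.

Lemma mu2_Om_fin : (mu2 Om < +oo)%E.
Proof. by rewrite -[Om]setTI; apply: mu2_trimmed_fin. Qed.

Lemma mesh_null : measurable (mesh U1 U2 : set (RT * RT)) /\ mu2 (mesh U1 U2) = 0%E.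
Proof. exact: null_lines. Qed.

Lemma integral2_eq_off_mesh (f g : R * R -> R) :
  (forall z, Om z -> ~ mesh U1 U2 z -> f z = g z) -> integral2 Om f = integral2 Om g.
Proof.
move=> fg; rewrite /integral2 /Rintegral; congr fine.
have [mm m0] := mesh_null; apply: (integral_eq_off_null mm m0) => z Oz zm.
by rewrite fg.
Qed.

Lemma Om_element z : Om z -> ~ mesh U1 U2 z ->
  exists a b, [/\ is_span U1 a, is_span U2 b & element U1 U2 a b z].
Proof. by move=> /Om_bg; exact: element_exists. Qed.

(** The matrix entries, with integrands that are bounded and measurable everywhere; [mass] is the
    form that the partition of unity gives to a row sum. *)
Definition stiff i j : R :=
  integral2 Om (fun z => phi_x i z * phi_x j z + phi_y i z * phi_y j z).
Definition mass i : R := integral2 Om (phi i).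

Lemma integral2_grad_dot i j :
  integral2 Om (grad_dot (tbspline i) (tbspline j)) = stiff i j.
Proof.
apply: integral2_eq_off_mesh => z Oz zm.
by have [a [b [sa sb Ez]]] := Om_element Oz zm; exact: grad_dot_element Ez.
Qed.

Lemma stiffC i j : stiff i j = stiff j i.
Proof.
apply: eq_Rintegral => z _; congr (_ + _); exact: mulrC.
Qed.

Lemma sum_phi z : Om z -> ~ mesh U1 U2 z -> \sum_(i : bindex U1 U2) phi i z = 1.
Proof.
move=> Oz zm; have [a [b [sa sb Ez]]] := Om_element Oz zm.
have -> : \sum_(i : bindex U1 U2) phi i z =
    \sum_(i < nbasis U1) \sum_(j < nbasis U2) (piece U1 i a).[z.1] * (piece U2 j b).[z.2].
  rewrite pair_big /=; apply: eq_bigr => i _.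
  by have [] := phi_element sa sb i Ez.
under eq_bigr do rewrite -mulr_sumr.
by rewrite -mulr_suml -!horner_sum !piece_sum1// !hornerC mulr1.
Qed.

Lemma integrable_product (F1 F2 : nat -> {poly R}) :
  mu2.-integrable Om (EFin \o (fun z => on_spans U1 F1 z.1 * on_spans U2 F2 z.2)).
Proof.
have [C C_ge0 bC] := bounded_product U1 U2 F1 F2.
exact: (bounded_integrable mOm mu2_Om_fin (measurable_product U1 U2 F1 F2) bC).
Qed.

Lemma integrable_product2 (F1 F2 G1 G2 : nat -> {poly R}) :
  mu2.-integrable Om (EFin \o (fun z => on_spans U1 F1 z.1 * on_spans U2 F2 z.2 *
    (on_spans U1 G1 z.1 * on_spans U2 G2 z.2))).
Proof.
have [C C_ge0 bC] := bounded_product U1 U2 F1 F2.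
have [C' C'_ge0 bC'] := bounded_product U1 U2 G1 G2.
apply: (bounded_integrable mOm mu2_Om_fin) (_ : forall z, _ <= C * C').
  by apply: measurable_funM; exact: measurable_product.
by move=> z; rewrite normrM ler_pM.
Qed.

Lemma integrable_phi i : mu2.-integrable Om (EFin \o phi i).
Proof. exact: integrable_product. Qed.

Lemma integrable_grad i j :
  mu2.-integrable Om (EFin \o (fun z => phi_x i z * phi_x j z + phi_y i z * phi_y j z)).
Proof.
have := integrableD mOm
  (integrable_product2 (fun a => (piece U1 i.1 a)^`()) (piece U2 i.2)
     (fun a => (piece U1 j.1 a)^`()) (piece U2 j.2))
  (integrable_product2 (piece U1 i.1) (fun a => (piece U2 i.2 a)^`())
     (piece U1 j.1) (fun a => (piece U2 j.2 a)^`())).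
by apply: eq_integrable => // z _; rewrite /= EFinD.
Qed.

Lemma RintegralD_sum (I : Type) (s : seq I) (F : I -> R * R -> R) :
  (forall k, mu2.-integrable Om (EFin \o F k)) ->
  \sum_(k <- s) integral2 Om (F k) = integral2 Om (fun z => \sum_(k <- s) F k z).
Proof.
move=> intF; elim: s => [|k s IHs].
  rewrite big_nil /integral2; under eq_Rintegral do rewrite big_nil.
  by rewrite Rintegral_cst// mul0r.
rewrite big_cons IHs; under [RHS]eq_Rintegral do rewrite big_cons.
rewrite [RHS]RintegralD//.
have := integrable_sum mOm s (P := xpredT) (h := fun k => EFin \o F k) (fun k _ => intF k).
by apply: eq_integrable => // z _; rewrite /= sumEFin.
Qed.

(** Inactive B-splines vanish on [Om], so the row sum may run over all indices, and the partition of
    unity then collapses it. *)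
Lemma integral2_lumped i :
  \sum_(j in all_active U1 U2 Om) integral2 Om (fun z => tbspline i z * tbspline j z) = mass i.
Proof.
have E j : integral2 Om (fun z => tbspline i z * tbspline j z) =
    integral2 Om (fun z => phi i z * phi j z).
  apply: integral2_eq_off_mesh => z Oz zm; have [a [b [sa sb Ez]]] := Om_element Oz zm.
  have [-> _ _] := phi_element sa sb i Ez; have [-> _ _] := phi_element sa sb j Ez.
  by rewrite !(tbspline_element sa sb _ Ez).
transitivity (\sum_(j : bindex U1 U2) integral2 Om (fun z => phi i z * phi j z)).
  rewrite big_mkcond; apply: eq_bigr => j _; rewrite inE; case: asboolP => // nact.
  rewrite -[LHS](mulr0 0) -E /integral2.
  rewrite (@eq_Rintegral _ _ _ _ _ (cst 0)) ?Rintegral_cst ?mul0r ?mulr0// => z /set_mem Oz.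
  have [->|jz] := eqVneq (tbspline j z) 0; first by rewrite mulr0.
  by exfalso; apply: nact; exists z; split => //; apply: subset_closure.
rewrite RintegralD_sum; last by move=> j; exact: integrable_product2.
apply: integral2_eq_off_mesh => z Oz zm.
by rewrite -mulr_sumr sum_phi// mulr1.
Qed.

(** The difference of the two sides is the integral of the squared length of y grad phi_i - z grad
    phi_j. *)
Lemma stiff_young i j y z :
  2 * (y * z * stiff i j) <= y ^+ 2 * stiff i i + z ^+ 2 * stiff j j.
Proof.
rewrite mulrA -[_ * stiff i j]RintegralZl//; last exact: integrable_grad.
rewrite -[_ * stiff i i]RintegralZl//; last exact: integrable_grad.
rewrite -[_ * stiff j j]RintegralZl//; last exact: integrable_grad.
have intZ c (k l : bindex U1 U2) : mu2.-integrable Om (EFin \o (fun w =>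
    c * (phi_x k w * phi_x l w + phi_y k w * phi_y l w))).
  have := integrableZl mOm c (integrable_grad k l).
  by apply: eq_integrable => // w _; rewrite /= EFinM.
rewrite -RintegralD//; apply: le_Rintegral => //.
  have := integrableD mOm (intZ (y ^+ 2) i i) (intZ (z ^+ 2) j j).
  by apply: eq_integrable => // w _; rewrite /= EFinD.
move=> w _; rewrite -subr_ge0.
rewrite [X in 0 <= X](_ : _ = (y * phi_x i w - z * phi_x j w) ^+ 2 +
  (y * phi_y i w - z * phi_y j w) ^+ 2); last by ring.
by rewrite addr_ge0// sqr_ge0.
Qed.

Definition covers i a b :=
  (i.1 <= a <= i.1 + deg U1)%N && (i.2 <= b <= i.2 + deg U2)%N.

Section Covers.
Variables (a b : nat).
Hypotheses (sa : is_span U1 a) (sb : is_span U2 b).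

Lemma tbspline_gt0 i z : covers i a b -> element U1 U2 a b z -> 0 < tbspline i z.
Proof.
move=> /andP[ia ib] Ez; rewrite (tbspline_element sa sb)//.
move/elementP: Ez => /andP[z1 z2].
by rewrite mulr_gt0// piece_gt0 ?ltn_ord.
Qed.

Lemma element_sub_supp i : covers i a b -> element U1 U2 a b `<=` supp (tbspline i).
Proof.
by move=> iab z Ez; apply: subset_closure; rewrite /= gt_eqF// tbspline_gt0.
Qed.

Lemma supp_covers i z : element U1 U2 a b z -> supp (tbspline i) z -> covers i a b.
Proof.
move=> Ez /(_ (element U1 U2 a b)) [|w [/= + Ew]].
  by apply: open_nbhs_nbhs; split => //; exact: open_element.
rewrite (tbspline_element sa sb)// mulf_eq0 negb_or => /andP[w1 w2].
by apply/andP; split; [apply: contraNT w1|apply: contraNT w2] => /piece_eq0->; rewrite horner0.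
Qed.

Lemma phi_covers i z : element U1 U2 a b z ->
  [\/ phi i z != 0, phi_x i z != 0 | phi_y i z != 0] -> covers i a b.
Proof.
move=> Ez; have [-> -> ->] := phi_element sa sb i Ez.
rewrite /covers; have [_|/piece_eq0->] := boolP (i.1 <= a <= _)%N; last first.
  by rewrite deriv0 !horner0 !mul0r eqxx => -[].
have [_ //|/piece_eq0->] := boolP (i.2 <= b <= _)%N.
by rewrite deriv0 !horner0 !mulr0 eqxx => -[].
Qed.

Lemma rectangle_sub_supp i : covers i a b ->
  rectangle (knots U1)`_a (knots U1)`_a.+1 (knots U2)`_b (knots U2)`_b.+1 `<=` supp (tbspline i).
Proof.
move=> iab z /= []; rewrite /= !in_itv /= => z1 z2 V /nbhs_ballP[e /= e_gt0 eV].
have [/andP[_ ta] /andP[_ tb]] := (sa, sb).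
(* In each coordinate the approximating point is the midpoint of the overlap of (u, v) with (x - e,
   x + e). *)
have inner (x u v : R) : u < v -> u <= x <= v ->
    exists y, [/\ u < y, y < v, x - e < y & y < x + e].
  move=> uv xuv; pose l : R := Num.max u (x - e); pose r : R := Num.min v (x + e).
  have [lu le] : u <= l /\ x - e <= l by rewrite /l; case: (leP u (x - e)); split; lra.
  have [rv re] : r <= v /\ r <= x + e by rewrite /r; case: (leP v (x + e)); split; lra.
  have lr : l < r by rewrite /l /r; case: (leP u (x - e)); case: (leP v (x + e)); lra.
  by exists ((l + r) / 2); split; lra.
have [x [? ? ? ?]] := inner z.1 _ _ ta z1; have [y [? ? ? ?]] := inner z.2 _ _ tb z2.
exists (x, y); split; last by apply: eV; split; rewrite /ball /= ltr_norml; lra.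
rewrite /= gt_eqF// tbspline_gt0//; apply/elementP => /=.
by apply/andP; split; apply/andP.
Qed.

End Covers.

Lemma active_interior a b i z : is_span U1 a -> is_span U2 b -> element U1 U2 a b z ->
  covers i a b -> Om z -> interior (active_support Om i) z.
Proof.
move=> sa sb Ez iab Oz; rewrite interiorI; split; first exact: open_nbhs_nbhs.
apply: (filterS (element_sub_supp sa sb iab)).
by apply: open_nbhs_nbhs; split => //; exact: open_element.
Qed.

(** This makes the prescribed shape of an active support usable: within [Om], the value and both
    derivatives vanish off its interior. *)
Lemma phi_interior i z : Om z ->
  [\/ phi i z != 0, phi_x i z != 0 | phi_y i z != 0] -> interior (active_support Om i) z.
Proof.
move=> Oz phiz; have [zm|zm] := pselect (mesh U1 U2 z).
  by move: phiz; have [-> -> ->] := phi_mesh i zm; rewrite eqxx => -[].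
have [a [b [sa sb Ez]]] := Om_element Oz zm.
exact: active_interior Ez (phi_covers sa sb Ez phiz) Oz.
Qed.

(** Off the mesh, a point of the active support has an open element of the support around it and
    lies in the open set [Om]. Hence the active support exceeds its interior by mesh points only, a
    null set. *)
Lemma area_active_support i :
  area (active_support Om i) = fine (mu2 (interior (active_support Om i))).
Proof.
have [mm m0] := mesh_null; rewrite /area; congr fine; apply/le_anti.
have mI : measurable (interior (active_support Om i) : set (RT * RT)).
  by apply: open_measurable_plane; exact: open_interior.
have mS : measurable (active_support Om i : set (RT * RT)).
  apply: measurableI => //; rewrite -[supp _]setCK; apply: measurableC.
  by apply: open_measurable_plane; apply: closed_openC; exact: closed_closure.
apply/andP; split; last by apply: le_measure; rewrite ?inE//; exact: interior_subset.
apply: (@le_trans _ _ (mu2 (interior (active_support Om i) `|` mesh U1 U2))).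
  apply: le_measure; rewrite ?inE//; first exact: measurableU.
  move=> z [Oz sz]; have [zm|zm] := pselect (mesh U1 U2 z); [by right|left].
  have [a [b [sa sb Ez]]] := Om_element Oz zm.
  exact: active_interior Ez (supp_covers sa sb Ez sz) Oz.
apply: (@le_trans _ _ (mu2 (interior (active_support Om i)) + mu2 (mesh U1 U2))%E).
  exact: measureU2.
by rewrite m0 adde0.
Qed.

End TrimmedIntegrals.

Section IntegralBounds.
Context {R : realType} (U1 U2 : spline_space R).
Local Notation RT := (measurableTypeR R).
Local Notation mu2 := ((@lebesgue_measure R) \x (@lebesgue_measure R))%E.
Implicit Types i j : bindex U1 U2.
Variable Om : set (R * R).
Hypotheses (oOm : open Om) (Om_bg : Om `<=` background_domain U1 U2).

Let mOm : measurable (Om : set (RT * RT)). Proof. exact: open_measurable_plane. Qed.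

Variables (i : bindex U1 U2) (A : set (RT * RT)).
Hypothesis mA : measurable A.

Lemma mass_ge v : (forall z, Om z -> A z -> v <= phi i z) ->
  v * fine (mu2 (A `&` Om)) <= mass Om i.
Proof.
move=> v_le; rewrite /mass; apply: (integral2_ge mOm (mu2_Om_fin oOm Om_bg) mA (integrable_phi oOm Om_bg i)).
move=> z Oz; rewrite indicE; have [/set_mem Az|_] := boolP (z \in A).
  by rewrite mulr1 v_le.
by rewrite mulr0 phi_ge0.
Qed.

Lemma mass_le v : (forall z, Om z -> A z -> phi i z <= v) ->
  (forall z, Om z -> ~ A z -> phi i z = 0) ->
  mass Om i <= v * fine (mu2 (A `&` Om)).
Proof.
move=> v_ge phi0; rewrite /mass.
apply: (integral2_le mOm (mu2_Om_fin oOm Om_bg) mA (integrable_phi oOm Om_bg i)).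
move=> z Oz; rewrite indicE; have [/set_mem Az|/negP Az] := boolP (z \in A).
  by rewrite mulr1 v_ge.
by rewrite mulr0 phi0//; apply: contra_not Az => /mem_set.
Qed.

Lemma stiff_ge v : (forall z, Om z -> A z -> v <= phi_x i z ^+ 2 + phi_y i z ^+ 2) ->
  v * fine (mu2 (A `&` Om)) <= stiff Om i i.
Proof.
move=> v_le; rewrite /stiff.
apply: (integral2_ge mOm (mu2_Om_fin oOm Om_bg) mA (integrable_grad oOm Om_bg i i)).
move=> z Oz; rewrite indicE -!expr2; have [/set_mem Az|_] := boolP (z \in A).
  by rewrite mulr1 v_le.
by rewrite mulr0 addr_ge0// sqr_ge0.
Qed.

Lemma stiff_le v : (forall z, Om z -> A z -> phi_x i z ^+ 2 + phi_y i z ^+ 2 <= v) ->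
  (forall z, Om z -> ~ A z -> phi_x i z = 0 /\ phi_y i z = 0) ->
  stiff Om i i <= v * fine (mu2 (A `&` Om)).
Proof.
move=> v_ge phi0; rewrite /stiff.
apply: (integral2_le mOm (mu2_Om_fin oOm Om_bg) mA (integrable_grad oOm Om_bg i i)).
move=> z Oz; rewrite indicE -!expr2; have [/set_mem Az|/negP Az] := boolP (z \in A).
  by rewrite mulr1 v_ge.
have [|-> ->] := phi0 z Oz; first by apply: contra_not Az => /mem_set.
by rewrite mulr0 expr0n addr0.
Qed.

End IntegralBounds.

(** * Trimmed basis functions *)

Section Asymptotics1D.
Context {R : realType} (U : spline_space R).
Local Notation t := (knots U).
Local Notation p := (deg U).
Local Notation N := (nbasis U).

Lemma horner_near (Q : {poly R}) (x : R) : 0 < Q.[x] ->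
  exists2 eta : R, 0 < eta & forall y, `|y - x| < eta -> Q.[x] / 2 <= Q.[y] <= 2 * Q.[x].
Proof.
move=> Qx; have Qx2 : 0 < Q.[x] / 2 by rewrite divr_gt0.
have /cvgrPdist_lt/(_ _ Qx2) /nbhs_ballP[e /= e_gt0 eQ] := @continuous_horner _ Q x.
exists e => // y yx; have /= := eQ y; rewrite /ball /= distrC => /(_ yx).
by rewrite ltr_norml => /andP[? ?]; apply/andP; split; lra.
Qed.

(* Order [q.+1] of vanishing from the right, and order [q] of the derivative. *)
Definition vanishes_to (j : nat) (xi : R) (q : nat) (c C eta : R) : Prop :=
  forall y, xi < y < xi + eta ->
    (c * (y - xi) ^+ q.+1 <= bspl U j y <= C * (y - xi) ^+ q.+1) /\
    (c * (y - xi) ^+ q <= dbspl U j y <= C * (y - xi) ^+ q).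

Lemma bspl_vanishes k j q : (k.+1 < size t)%N -> t`_k < t`_k.+1 -> (j <= k < j + p)%N ->
  (j < N)%N -> t`_j = t`_k -> (p - (k - j) = q.+1)%N ->
  exists c C eta : R, [/\ 0 < c, 0 < C, 0 < eta & vanishes_to j t`_k q c C eta].
Proof.
move=> kt tk jk jN tj qE; have szE := size_knots U.
have [|||Q PE Q_gt0] := @bpoly_begins _ t (knots_sorted U) k kt tk p j; [lia|lia|done|].
rewrite qE in PE; set x := t`_k in tk tj PE Q_gt0 *.
(* By the product rule this is the cofactor of (X - x)^q in the derivative of (X - x)^(q+1) Q; at x
   it equals (q + 1) Q(x), hence is positive. *)
pose Q' : {poly R} := q.+1%:R *: Q + ('X - x%:P) * Q^`().
have dPE : (bpoly t p j k)^`() = ('X - x%:P) ^+ q * Q'.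
  by rewrite PE derivM deriv_exp derivXsubC /= mul1r /Q' -mul_polyC exprS -mulr_natl
    -polyC_natr polyC_natr; ring.
have Q'_gt0 : 0 < Q'.[x] by rewrite /Q' hornerD hornerZ hornerM !hornerE subrr mul0r addr0 mulr_gt0.
clearbody Q'; have [e1 e1_gt0 Qb] := horner_near Q_gt0; have [e2 e2_gt0 Q'b] := horner_near Q'_gt0.
exists (Num.min (Q.[x] / 2) (Q'.[x] / 2)), (Num.max (2 * Q.[x]) (2 * Q'.[x])),
  (Num.min (t`_k.+1 - x) (Num.min e1 e2)).
split; rewrite ?lt_min ?lt_max ?mulr_gt0 ?invr_gt0 ?e1_gt0 ?e2_gt0 ?subr_gt0 ?tk//.
move=> y; rewrite -ltrBlDl !lt_min => /and4P[xy yt y1 y2].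
have yx_gt0 : 0 < y - x by rewrite subr_gt0.
have yx n : 0 <= (y - x) ^+ n by rewrite exprn_ge0// ltW.
have xyt : x < y < t`_k.+1 by rewrite xy; lra.
rewrite /bspl /dbspl !(on_spansE _ kt xyt) /piece dPE PE !hornerM !horner_exp !hornerE.
have /andP[? ?] : Q.[x] / 2 <= Q.[y] <= 2 * Q.[x] by apply: Qb; rewrite gtr0_norm.
have /andP[? ?] : Q'.[x] / 2 <= Q'.[y] <= 2 * Q'.[x] by apply: Q'b; rewrite gtr0_norm.
split; rewrite ![(y - x) ^+ _ * _]mulrC; apply/andP; split; rewrite ler_wpM2r//.
- by rewrite ge_min; apply/orP; left.
- by rewrite le_max; apply/orP; left.
- by rewrite ge_min; apply/orP; right.
- by rewrite le_max; apply/orP; right.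
Qed.

(** For configuration (a), where [x1, x2] is fixed and the first factor is of order 1: it may tend
    to 0 at the ends or at knots, so the lower bound is taken on a subinterval inside one span. *)
Lemma bspl_pos_near i x1 x2 : (i < N)%N -> x1 < x2 ->
  (forall x, x1 < x < x2 -> x \notin t -> bspl U i x != 0) ->
  first_knot U <= x1 -> x2 <= last_knot U ->
  exists c y1 y2 : R, [/\ 0 < c, x1 <= y1, y1 < y2, y2 <= x2 &
    forall x, y1 < x < y2 -> c <= bspl U i x].
Proof.
move=> iN x12 Bx fx xl; have [|a at_ /andP[ax xa]] := @half_open_span _ U x1.
  by rewrite fx /=; apply: lt_le_trans xl.
pose r : R := Num.min x2 t`_a.+1; pose x0 := (x1 + r) / 2.
have [rx rt x1r] : [/\ r <= x2, r <= t`_a.+1 & x1 < r].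
  by rewrite /r; case: (leP x2 t`_a.+1); split; lra.
have x0t : t`_a < x0 < t`_a.+1 by rewrite /x0; lra.
have Bx0 : 0 < (piece U i a).[x0].
  have ta : is_span U a by rewrite /is_span at_; lra.
  have notknot : x0 \notin t.
    apply/negP => /(on_spans_knot (fun=> 1)); rewrite (on_spansE _ at_ x0t) hornerC.
    by move/eqP; rewrite oner_eq0.
  have := Bx x0 _ notknot; rewrite /bspl (on_spansE _ at_ x0t) => B0.
  by rewrite lt0r piece_ge0// andbT B0// /x0; lra.
have [e e_gt0 eB] := horner_near Bx0; pose d : R := Num.min e ((r - x1) / 2).
have [de dr d_gt0] : [/\ d <= e, d <= (r - x1) / 2 & 0 < d].
  by rewrite /d; case: (leP e ((r - x1) / 2)); split; lra.
exists ((piece U i a).[x0] / 2), (x0 - d), (x0 + d).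
split; [by rewrite divr_gt0|rewrite /x0; lra|lra|rewrite /x0; lra|].
move=> x /andP[x0x xx0]; have xt : t`_a < x < t`_a.+1 by rewrite /x0 in x0x xx0; lra.
rewrite /bspl (on_spansE _ at_ xt).
by have /eB/andP[] : `|x - x0| < e by rewrite ltr_norml; lra.
Qed.

(** For configuration (b). Spans are closed on the left, so a nonzero value persists to the right
    even if x is a knot. *)
Lemma bspl_pos_right i x : (i < N)%N -> first_knot U <= x < last_knot U ->
  bspline U i x != 0 ->
  exists c eta : R, [/\ 0 < c, 0 < eta & forall y, x < y < x + eta -> c <= bspl U i y].
Proof.
move=> iN xfl; have [a at_ /andP[ax xa]] := half_open_span xfl.
rewrite (@bspline_piece _ U i a)// ?ax// => Bx.
have Bx_gt0 : 0 < (piece U i a).[x].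
  rewrite lt0r Bx; apply: bpoly_ge0; [exact: knots_sorted|done|..].
  - exact: le_lt_trans xa.
  - by rewrite size_knots ltn_add2r.
  - by rewrite ax ltW.
have [e e_gt0 eB] := horner_near Bx_gt0.
exists ((piece U i a).[x] / 2), (Num.min e (t`_a.+1 - x)).
split; [by rewrite divr_gt0|by rewrite lt_min e_gt0 subr_gt0|].
move=> y; rewrite -ltrBlDl lt_min => /and3P[xy ye yt].
have yat : t`_a < y < t`_a.+1 by lra.
rewrite /bspl (on_spansE _ at_ yat).
by have /eB/andP[] : `|y - x| < e by rewrite gtr0_norm// subr_gt0.
Qed.

Lemma horner_min (q : {poly R}) (u v : R) : u <= v ->
  (forall x, u <= x <= v -> q.[x] != 0) ->
  exists2 c : R, 0 < c & forall x, u <= x <= v -> c <= `|q.[x]|.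
Proof.
move=> uv q0; have [|x /[!in_itv] xuv xmin] := @EVT_min R (fun x => `|q.[x]|) u v uv.
  apply: continuous_subspaceT => x; apply: continuous_comp; last exact: norm_continuous.
  exact: continuous_horner.
exists `|q.[x]|; first by rewrite normr_gt0 q0.
by move=> y yuv; apply: xmin; rewrite in_itv.
Qed.

End Asymptotics1D.

(** * Mass and energy of a function trimmed to a box *)

Section BoxBounds.
Context {R : realType} (U1 U2 : spline_space R).
Local Notation mu2 := ((@lebesgue_measure R) \x (@lebesgue_measure R))%E.

Definition box (a b c e : R) : set (R * R) := `]a, b[%classic `*` `]c, e[%classic.

Lemma boxP a b c e z : box a b c e z <-> (a < z.1 < b) && (c < z.2 < e).
Proof. by rewrite /box /= !in_itv /=; split => [[-> ->]//|/andP[]]. Qed.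

Lemma nonknot_exists (U : spline_space R) (x1 x2 : R) : x1 < x2 ->
  exists2 x, x1 < x < x2 & x \notin knots U.
Proof.
move=> x12; apply: contrapT => nox.
have : (`]x1, x2[%classic : set R) `<=` [set` knots U].
  move=> x; rewrite /= in_itv /= => xx; apply: contrapT => /negP xk.
  by apply: nox; exists x.
move=> /(sub_finite_set)/(_ (finite_seq _)) /finite_set_countable.
move=> /countable_lebesgue_measure0; rewrite lebesgue_itv; last exact: ltW.
by move=> [/eqP]; rewrite subr_eq0 gt_eqF.
Qed.

Section Box.
Variables (Om : set (R * R)) (i : bindex U1 U2) (x1 x2 y1 y2 : R).
Hypotheses (oOm : open Om) (Om_bg : Om `<=` background_domain U1 U2).
Hypotheses (x12 : x1 < x2) (y12 : y1 < y2).
Hypothesis activeE : interior (active_support Om i) = box x1 x2 y1 y2.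

Lemma box_sub : box x1 x2 y1 y2 `<=` Om.
Proof. by rewrite -activeE => z /interior_subset[]. Qed.

Lemma sub_box_mu2 (u1 u2 v1 v2 : R) : x1 <= u1 -> u1 <= u2 -> u2 <= x2 ->
  y1 <= v1 -> v1 <= v2 -> v2 <= y2 ->
  fine (mu2 (box u1 u2 v1 v2 `&` Om)) = (u2 - u1) * (v2 - v1).
Proof.
move=> h1 h2 h3 h4 h5 h6; rewrite setIidl ?mu2_box//.
apply: subset_trans box_sub => z /boxP/andP[/andP[? ?] /andP[? ?]].
by apply/boxP/andP; split; apply/andP; split; lra.
Qed.

Lemma phi_off_box z : Om z -> ~ box x1 x2 y1 y2 z ->
  [/\ phi i z = 0, phi_x i z = 0 & phi_y i z = 0].
Proof.
move=> Oz zb; split; apply/eqP; apply: contra_notT zb => nz; rewrite -activeE;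
  apply: (phi_interior oOm Om_bg Oz); by [exact: Or31|exact: Or32|exact: Or33].
Qed.

Lemma box_upper (V S : R) :
  (forall z, box x1 x2 y1 y2 z -> phi i z <= V /\ phi_x i z ^+ 2 + phi_y i z ^+ 2 <= S) ->
  mass Om i <= V * ((x2 - x1) * (y2 - y1)) /\ stiff Om i i <= S * ((x2 - x1) * (y2 - y1)).
Proof.
move=> ub; have <- := sub_box_mu2 (lexx x1) (ltW x12) (lexx x2) (lexx y1) (ltW y12) (lexx y2).
split.
- apply: (mass_le oOm Om_bg (measurable_box _ _ _ _)) => z Oz; first by move=> /ub[].
  by move=> /(phi_off_box Oz)[].
- apply: (stiff_le oOm Om_bg (measurable_box _ _ _ _)) => z Oz; first by move=> /ub[].
  by move=> /(phi_off_box Oz)[].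
Qed.

Lemma box_lower (u1 u2 v1 v2 v s : R) : x1 <= u1 -> u1 <= u2 -> u2 <= x2 ->
  y1 <= v1 -> v1 <= v2 -> v2 <= y2 ->
  (forall z, box u1 u2 v1 v2 z -> v <= phi i z /\ s <= phi_x i z ^+ 2 + phi_y i z ^+ 2) ->
  v * ((u2 - u1) * (v2 - v1)) <= mass Om i /\ s * ((u2 - u1) * (v2 - v1)) <= stiff Om i i.
Proof.
move=> h1 h2 h3 h4 h5 h6 lb; rewrite -(@sub_box_mu2 u1 u2 v1 v2)//; split.
- by apply: (mass_ge oOm Om_bg (measurable_box _ _ _ _)) => z Oz /lb[].
- by apply: (stiff_ge oOm Om_bg (measurable_box _ _ _ _)) => z Oz /lb[].
Qed.

(* The active box lies in the support, and the B-spline is positive there. *)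
Lemma box_bspl_neq0 x : x1 < x < x2 -> x \notin knots U1 -> bspl U1 i.1 x != 0.
Proof.
move=> xx xk; have [y yy yk] := nonknot_exists U2 y12.
have zb : box x1 x2 y1 y2 (x, y) by apply/boxP; rewrite /= xx.
have [|a [b [sa sb Ez]]] := Om_element Om_bg (box_sub zb).
  by move=> [] /=; [rewrite (negbTE xk)|rewrite (negbTE yk)].
have zsupp : supp (tbspline i) (x, y).
  by move: zb; rewrite -activeE => /interior_subset[].
have /andP[ia ib] := supp_covers sa sb Ez zsupp.
have /elementP/andP[/= xa _] := Ez.
by rewrite /bspl (on_spansE _ _ xa) ?gt_eqF ?piece_gt0 ?ltn_ord//; case/andP: sa.
Qed.

Lemma box_in_background : first_knot U1 <= x1 /\ x2 <= last_knot U1.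
Proof.
have [x12' y12'] := (x12, y12).
have bb x : x1 < x < x2 -> first_knot U1 <= x <= last_knot U1.
  move=> xx; have [|] := Om_bg (@box_sub (x, (y1 + y2) / 2) _).
    by apply/boxP => /=; rewrite xx /=; lra.
  by rewrite /= in_itv.
split; rewrite leNgt; apply/negP => out.
  pose x : R := (x1 + Num.min x2 (first_knot U1)) / 2.
  have /bb : x1 < x < x2 by rewrite /x; case: (leP x2 (first_knot U1)); lra.
  by rewrite /x; case: (leP x2 (first_knot U1)); lra.
pose x : R := (x2 + Num.max x1 (last_knot U1)) / 2.
have /bb : x1 < x < x2 by rewrite /x; case: (leP x1 (last_knot U1)); lra.
by rewrite /x; case: (leP x1 (last_knot U1)); lra.
Qed.

End Box.

(** Here D stands for d^q and L for the width of the strip. The energy is of order D^2 times the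
    area L d, and the mass of order D d times that area, so the width cancels and the ratio is of
    order D / d. *)
Lemma ratio_bounds (K M D d L kap m mu k : R) :
  0 < d -> 0 < D -> 0 < L -> 0 < m -> 0 < mu -> 0 < kap -> 0 < k ->
  K <= kap * (D ^+ 2 * (L * d)) -> m * (D * (L * d ^+ 2)) <= M ->
  M <= mu * (D * (L * d ^+ 2)) -> k * (D ^+ 2 * (L * d)) <= K ->
  0 < M /\ k / mu * (D / d) * M <= K <= kap / m * (D / d) * M.
Proof.
move=> d0 D0 L0 m0 mu0 kap0 k0 Kup Mlo Mup Klo.
split; first by apply: lt_le_trans Mlo; rewrite !mulr_gt0// exprn_gt0.
apply/andP; split.
  apply: le_trans Klo.
  have -> : k * (D ^+ 2 * (L * d)) = k / mu * (D / d) * (mu * (D * (L * d ^+ 2))).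
    by field; rewrite !gt_eqF.
  by rewrite ler_wpM2l// !mulr_ge0 ?invr_ge0// ltW.
apply: (le_trans Kup).
have -> : kap * (D ^+ 2 * (L * d)) = kap / m * (D / d) * (m * (D * (L * d ^+ 2))).
  by field; rewrite !gt_eqF.
by rewrite ler_wpM2l// !mulr_ge0 ?invr_ge0// ltW.
Qed.

Lemma expr_between (y d : R) n : 0 < d -> d / 2 <= y <= d ->
  (2^-1 ^+ n) * d ^+ n <= y ^+ n <= d ^+ n.
Proof.
move=> d0 /andP[yl yu]; have y0 : 0 <= y by apply: le_trans yl; rewrite divr_ge0// ltW.
by rewrite -exprMn; apply/andP; split; rewrite lerXn2r ?nnegrE//; lra.
Qed.

Lemma vanishes_abs (U : spline_space R) j (xi : R) q (c C eta d y : R) :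
  0 < c -> 0 < C -> vanishes_to U j xi q c C eta -> 0 < d -> d <= 1 -> d <= eta ->
  xi < y < xi + d ->
  [/\ 0 <= bspl U j y <= C * d ^+ q, bspl U j y <= C * d ^+ q.+1 &
      0 <= dbspl U j y <= C * d ^+ q].
Proof.
move=> c0 C0 van d0 d1 de yy; have [|/andP[b1 b2] /andP[d1' d2]] := van y; first by lra.
have yd n : 0 <= (y - xi) ^+ n <= d ^+ n.
  by rewrite exprn_ge0 ?lerXn2r ?nnegrE; lra.
have bq : bspl U j y <= C * d ^+ q.+1.
  by apply: (le_trans b2); rewrite ler_wpM2l ?(ltW C0)//; case/andP: (yd q.+1).
have dq : d ^+ q.+1 <= d ^+ q by rewrite exprS ler_piMl// exprn_ge0 ?(ltW d0).
split => //; apply/andP; split.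
- by apply: le_trans b1; rewrite mulr_ge0 ?(ltW c0)//; case/andP: (yd q.+1).
- by apply: (le_trans bq); rewrite ler_wpM2l ?(ltW C0).
- by apply: le_trans d1'; rewrite mulr_ge0 ?(ltW c0)//; case/andP: (yd q).
- by apply: (le_trans d2); rewrite ler_wpM2l ?(ltW C0)//; case/andP: (yd q).
Qed.

(** In the upper half of the strip the distance from the knot is comparable with d, which costs only
    powers of 1/2. *)
Lemma vanishes_lower (U : spline_space R) j (xi : R) q (c C eta d y : R) :
  0 < c -> vanishes_to U j xi q c C eta -> 0 < d -> d <= eta ->
  xi + d / 2 < y < xi + d ->
  c * (2^-1 ^+ q.+1 * d ^+ q.+1) <= bspl U j y /\ c * (2^-1 ^+ q * d ^+ q) <= dbspl U j y.
Proof.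
move=> c0 van d0 de yy; have [|/andP[b1 _] /andP[d1 _]] := van y; first by lra.
have yd n : 2^-1 ^+ n * d ^+ n <= (y - xi) ^+ n.
  have yd0 : d / 2 <= y - xi <= d by lra.
  by case/andP: (expr_between n d0 yd0).
by split; [apply: le_trans b1|apply: le_trans d1]; rewrite ler_wpM2l ?(ltW c0).
Qed.

(** One estimate serves (a) and (b): the width x2 - x1 may be fixed or shrink with d, provided that
    the first factor is bounded below on a fraction [lam] of it. The derivative across the strip
    dominates, and it alone gives the lower bound for the energy. *)
Lemma strip_bounds (i : bindex U1 U2) xi q (c1 C1 c2 C2 eta lam : R) :
  0 < c1 -> 0 < C1 -> 0 < c2 -> 0 < C2 -> 0 < lam ->
  (forall x, `|bspl U1 i.1 x| <= C1) -> (forall x, `|dbspl U1 i.1 x| <= C1) ->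
  vanishes_to U2 i.2 xi q c2 C2 eta ->
  exists c C : R, [/\ 0 < c, 0 < C & forall (Om : set (R * R)) (d x1 x2 u1 u2 : R),
    open Om -> Om `<=` background_domain U1 U2 ->
    0 < d -> d <= 1 -> d <= eta ->
    interior (active_support Om i) = box x1 x2 xi (xi + d) ->
    x1 <= u1 -> u1 < u2 -> u2 <= x2 -> lam * (x2 - x1) <= u2 - u1 ->
    (forall x, u1 < x < u2 -> c1 <= bspl U1 i.1 x) ->
    0 < mass Om i /\ c * (d ^+ q / d) * mass Om i <= stiff Om i i
                     <= C * (d ^+ q / d) * mass Om i].
Proof.
move=> c1_gt0 C1_gt0 c2_gt0 C2_gt0 lam_gt0 B1 dB1 van.
pose h : R := 2^-1 ^+ q; have h_gt0 : 0 < h by rewrite exprn_gt0// invr_gt0.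
(* The factor 2 in [kap] counts the partial derivatives. In [m] and [k], [h] comes from evaluating
   powers at d / 2 and [lam] from the window; one division by 2 is the half height of the strip, and
   the second one in [m] is the extra power of 1/2 in the function value. *)
pose kap := 2 * (C1 * C2) ^+ 2; pose m := c1 * (c2 * h) * lam / 4.
pose mu := C1 * C2; pose k := (c1 * (c2 * h)) ^+ 2 * lam / 2.
have kap_gt0 : 0 < kap by rewrite mulr_gt0 ?exprn_gt0 ?mulr_gt0.
have m_gt0 : 0 < m by rewrite divr_gt0 ?mulr_gt0.
have mu_gt0 : 0 < mu by rewrite mulr_gt0.
have k_gt0 : 0 < k by rewrite divr_gt0 ?mulr_gt0 ?exprn_gt0 ?mulr_gt0.
exists (k / mu), (kap / m); split; [exact: divr_gt0..|].
move=> Om d x1 x2 u1 u2 oOm Om_bg d0 d1 de actE xu u12 ux lamu B1lo.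
have x12 : x1 < x2 by lra.
have y12 : xi < xi + d by lra.
have D0 : 0 < d ^+ q by rewrite exprn_gt0.
have [|Mup Kup] := @box_upper Om i x1 x2 xi (xi + d) oOm Om_bg x12 y12 actE
    (mu * (d ^+ q * d)) (kap * (d ^+ q) ^+ 2).
  move=> z /boxP/andP[z1 z2].
  have [/andP[b0 bq] bq1 /andP[db0 dbq]] := vanishes_abs c2_gt0 C2_gt0 van d0 d1 de z2.
  rewrite exprSr in bq1; split.
    rewrite /phi /mu -mulrA; apply: (le_trans (ler_norm _)); rewrite normrM.
    by apply: ler_pM => //; rewrite ger0_norm.
  have sq (f g G : R) : `|f| <= C1 -> 0 <= g <= G -> (f * g) ^+ 2 <= (C1 * G) ^+ 2.
    move=> fC /andP[g0 gG]; rewrite -[leLHS]real_normK ?num_real//.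
    rewrite lerXn2r ?nnegrE ?mulr_ge0 ?(ltW C1_gt0)//; first exact: le_trans gG.
    by rewrite normrM ler_pM// ger0_norm.
  rewrite /phi_x /phi_y.
  have -> : kap * (d ^+ q) ^+ 2 = (C1 * (C2 * d ^+ q)) ^+ 2 + (C1 * (C2 * d ^+ q)) ^+ 2.
    by rewrite /kap; ring.
  by rewrite lerD// sq// ?b0 ?db0.
have [|||||||Mlo Klo] := @box_lower Om i x1 x2 xi (xi + d) oOm Om_bg actE
    u1 u2 (xi + d / 2) (xi + d) (c1 * (c2 * (h / 2 * (d ^+ q * d)))) ((c1 * (c2 * (h * d ^+ q))) ^+ 2).
- exact: xu.
- exact: ltW.
- exact: ux.
- by lra.
- by lra.
- by lra.
- move=> z /boxP/andP[z1 z2].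
  have [b db] := vanishes_lower c2_gt0 van d0 de z2; have b1 := B1lo _ z1.
  rewrite !exprSr -/h in b; have chD : 0 < c2 * (h * d ^+ q) by rewrite !mulr_gt0.
  split.
    have ch2 : 0 < c2 * (h / 2 * (d ^+ q * d)) by rewrite !mulr_gt0 ?invr_gt0.
    by rewrite /phi ler_pM ?(ltW c1_gt0) ?(ltW ch2).
  apply: (@le_trans _ _ (phi_y i z ^+ 2)); last by rewrite lerDr sqr_ge0.
  rewrite lerXn2r ?nnegrE//.
  - exact: ltW (mulr_gt0 c1_gt0 chD).
  - by apply: mulr_ge0; [apply: le_trans b1; exact: ltW|apply: le_trans db; exact: ltW].
  - by rewrite /phi_y ler_pM ?(ltW c1_gt0) ?(ltW chD).
have xid : xi + d - xi = d by rewrite addrC addKr.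
have xid2 : xi + d - (xi + d / 2) = d / 2 by field.
rewrite xid in Mup Kup; rewrite xid2 in Mlo Klo.
apply: (@ratio_bounds _ _ (d ^+ q) d (x2 - x1) kap m mu k) => //.
- by rewrite subr_gt0.
- by apply: (le_trans Kup); rewrite -mulrA.
- apply: le_trans Mlo.
  have -> : m * (d ^+ q * ((x2 - x1) * d ^+ 2)) =
      c1 * (c2 * (h / 2 * (d ^+ q * d))) * (lam * (x2 - x1) * (d / 2)) by rewrite /m; field.
  apply: ler_wpM2l; first by rewrite ltW// !mulr_gt0.
  by apply: ler_wpM2r => //; rewrite divr_ge0// ltW.
- by apply: (le_trans Mup); rewrite le_eqVlt; apply/orP; left; apply/eqP; ring.
apply: le_trans Klo.
have -> : k * ((d ^+ q) ^+ 2 * ((x2 - x1) * d)) =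
    (c1 * (c2 * (h * d ^+ q))) ^+ 2 * (lam * (x2 - x1) * (d / 2)) by rewrite /k; field.
apply: ler_wpM2l; first exact: sqr_ge0.
by apply: ler_wpM2r => //; rewrite divr_ge0// ltW.
Qed.

(** On a square of area d^2 each squared partial derivative is O(d^(2 (q1 + q2 + 1))), since one
    factor is differentiated and the other is not, while on the far quarter of the square the
    function is at least of order d^(q1 + q2 + 2). The quotient is d^(q1 + q2). *)
Lemma corner_bounds (i : bindex U1 U2) (xi1 xi2 : R) q1 q2 (c1 C1 eta1 c2 C2 eta2 : R) :
  0 < c1 -> 0 < C1 -> 0 < c2 -> 0 < C2 ->
  vanishes_to U1 i.1 xi1 q1 c1 C1 eta1 -> vanishes_to U2 i.2 xi2 q2 c2 C2 eta2 ->
  exists2 C : R, 0 < C & forall (Om : set (R * R)) (d : R),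
    open Om -> Om `<=` background_domain U1 U2 ->
    0 < d -> d <= 1 -> d <= eta1 -> d <= eta2 ->
    interior (active_support Om i) = box xi1 (xi1 + d) xi2 (xi2 + d) ->
    0 < mass Om i /\ stiff Om i i <= C * d ^+ (q1 + q2) * mass Om i.
Proof.
move=> c1_gt0 C1_gt0 c2_gt0 C2_gt0 van1 van2.
pose h1 : R := 2^-1 ^+ q1.+1; pose h2 : R := 2^-1 ^+ q2.+1.
have h1_gt0 : 0 < h1 by rewrite exprn_gt0// invr_gt0.
have h2_gt0 : 0 < h2 by rewrite exprn_gt0// invr_gt0.
pose kap := 2 * (C1 * C2) ^+ 2; pose m := (c1 * h1) * (c2 * h2) / 4.
have kap_gt0 : 0 < kap by rewrite mulr_gt0 ?exprn_gt0 ?mulr_gt0.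
have m_gt0 : 0 < m by rewrite divr_gt0 ?mulr_gt0.
exists (kap / m); first exact: divr_gt0.
move=> Om d oOm Om_bg d0 d1 de1 de2 actE.
have x12 : xi1 < xi1 + d by lra.
have y12 : xi2 < xi2 + d by lra.
have [D1 D2] : 0 < d ^+ q1 /\ 0 < d ^+ q2 by rewrite !exprn_gt0.
have [|_ Kup] := @box_upper Om i xi1 (xi1 + d) xi2 (xi2 + d) oOm Om_bg x12 y12 actE
    (C1 * C2) (kap * (d ^+ q1 * d ^+ q2 * d) ^+ 2).
  move=> z /boxP/andP[z1 z2].
  have [/andP[a0 aq] aq1 /andP[da0 daq]] := vanishes_abs c1_gt0 C1_gt0 van1 d0 d1 de1 z1.
  have [/andP[b0 bq] bq1 /andP[db0 dbq]] := vanishes_abs c2_gt0 C2_gt0 van2 d0 d1 de2 z2.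
  rewrite exprSr in aq1; rewrite exprSr in bq1.
  have dle n : d ^+ n <= 1 by rewrite exprn_ile1// ltW.
  split.
    rewrite /phi ler_pM//; [apply: (le_trans aq)|apply: (le_trans bq)];
      by rewrite ler_piMr// ltW.
  have sq (f g F G : R) : 0 <= f <= F -> 0 <= g <= G -> (f * g) ^+ 2 <= (F * G) ^+ 2.
    move=> /andP[f0 fF] /andP[g0 gG]; have F0 := le_trans f0 fF; have G0 := le_trans g0 gG.
    by rewrite lerXn2r ?nnegrE ?mulr_ge0// ler_pM.
  rewrite /phi_x /phi_y.
  have -> : kap * (d ^+ q1 * d ^+ q2 * d) ^+ 2 =
      ((C1 * d ^+ q1) * (C2 * (d ^+ q2 * d))) ^+ 2 +
      ((C1 * (d ^+ q1 * d)) * (C2 * d ^+ q2)) ^+ 2 by rewrite /kap; ring.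
  by rewrite lerD// sq// ?a0 ?da0 ?b0 ?db0.
have [|||||||Mlo _] := @box_lower Om i xi1 (xi1 + d) xi2 (xi2 + d) oOm Om_bg actE
    (xi1 + d / 2) (xi1 + d) (xi2 + d / 2) (xi2 + d)
    ((c1 * (h1 * (d ^+ q1 * d))) * (c2 * (h2 * (d ^+ q2 * d)))) 0.
- by lra.
- by lra.
- by lra.
- by lra.
- by lra.
- by lra.
- move=> z /boxP/andP[z1 z2].
  have [a _] := vanishes_lower c1_gt0 van1 d0 de1 z1.
  have [b _] := vanishes_lower c2_gt0 van2 d0 de2 z2.
  rewrite [d ^+ _.+1]exprSr -/h1 in a; rewrite [d ^+ _.+1]exprSr -/h2 in b.
  split; last by rewrite addr_ge0 ?sqr_ge0.
  by rewrite /phi ler_pM// ltW// !mulr_gt0.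
have sub1 (x : R) : x + d - (x + d / 2) = d / 2 by field.
have sub2 (x : R) : x + d - x = d by ring.
rewrite !sub1 in Mlo; rewrite !sub2 in Kup.
have -> : kap / m * d ^+ (q1 + q2) * mass Om i =
    kap / m * (d ^+ q1 * d ^+ q2) * mass Om i by rewrite exprD.
split; first by apply: lt_le_trans Mlo; rewrite !mulr_gt0 ?invr_gt0.
apply: (le_trans Kup).
have -> : kap * (d ^+ q1 * d ^+ q2 * d) ^+ 2 * (d * d) = kap / m * (d ^+ q1 * d ^+ q2) *
    (c1 * (h1 * (d ^+ q1 * d)) * (c2 * (h2 * (d ^+ q2 * d))) * (d / 2 * (d / 2))).
  by rewrite /m; field; rewrite !gt_eqF.
by rewrite ler_wpM2l// ltW// !mulr_gt0 ?invr_gt0.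
Qed.

End BoxBounds.

(** * Bounds for large functions, independent of the trimmed domain *)

Section LargeBounds.
Context {R : realType} (U1 U2 : spline_space R).
Local Notation RT := (measurableTypeR R).
Local Notation mu2 := ((@lebesgue_measure R) \x (@lebesgue_measure R))%E.
Variable i : bindex U1 U2.

Lemma phi_bounded : exists2 C : R, 0 < C &
  forall z, phi i z <= C /\ phi_x i z ^+ 2 + phi_y i z ^+ 2 <= C.
Proof.
have [C C0 bC] := bounded_product U1 U2 (piece U1 i.1) (piece U2 i.2).
have [Cx Cx0 bCx] := bounded_product U1 U2 (fun a => (piece U1 i.1 a)^`()) (piece U2 i.2).
have [Cy Cy0 bCy] := bounded_product U1 U2 (piece U1 i.1) (fun a => (piece U2 i.2 a)^`()).
have [Cx2 Cy2] := (sqr_ge0 Cx, sqr_ge0 Cy).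
exists (C + Cx ^+ 2 + Cy ^+ 2 + 1); first by lra.
have sq (f F : R) : `|f| <= F -> f ^+ 2 <= F ^+ 2.
  move=> fF; have F0 := le_trans (normr_ge0 f) fF.
  by rewrite -[leLHS]real_normK ?num_real// lerXn2r ?nnegrE.
move=> z; have := ler_norm (phi i z); have := bC z.
have := sq _ _ (bCx z); have := sq _ _ (bCy z); rewrite -/(phi_x i z) -/(phi_y i z).
by rewrite -/(phi i z) => *; split; lra.
Qed.

Lemma global_upper : exists2 C : R, 0 < C & forall Om : set (R * R),
  open Om -> Om `<=` background_domain U1 U2 -> mass Om i <= C /\ stiff Om i i <= C.
Proof.
have [C C0 bC] := phi_bounded.
pose S := (last_knot U1 - first_knot U1) * (last_knot U2 - first_knot U2).
have S0 : 0 < S by rewrite mulr_gt0// subr_gt0 first_lt_last.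
exists (C * S); first exact: mulr_gt0.
move=> Om oOm Om_bg.
have muS : fine (mu2 (setT `&` Om)) <= S.
  rewrite -lee_fin fineK; last first.
    by rewrite ge0_fin_numE; [apply: mu2_trimmed_fin oOm Om_bg _ _|exact: measure_ge0].
  rewrite -(mu2_rectangle (ltW (first_lt_last U1)) (ltW (first_lt_last U2))).
  apply: le_measure; rewrite ?inE ?setTI//; first exact: open_measurable_plane.
  exact: measurable_rectangle.
split.
  apply: le_trans (_ : C * fine (mu2 (setT `&` Om)) <= _); last by rewrite ler_wpM2l// ltW.
  apply: (mass_le oOm Om_bg measurableT) => z _; last by case.
  by case: (bC z).
apply: le_trans (_ : C * fine (mu2 (setT `&` Om)) <= _); last by rewrite ler_wpM2l// ltW.
apply: (stiff_le oOm Om_bg measurableT) => z _; last by case.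
by case: (bC z).
Qed.

Section Element.
Variables (a b : nat) (gamma : R).
Hypotheses (sa : is_span U1 a) (sb : is_span U2 b) (iab : covers i a b).
Hypotheses (gamma_gt0 : 0 < gamma) (gamma_le1 : gamma <= 1).
Local Notation T :=
  (rectangle (knots U1)`_a (knots U1)`_a.+1 (knots U2)`_b (knots U2)`_b.+1).

(* Shrinking the element by a small margin loses at most half of the area
   guaranteed inside the trimmed domain. *)
Lemma shrink_element : exists u1 u2 v1 v2 m : R,
  [/\ (knots U1)`_a < u1, u1 < u2, u2 < (knots U1)`_a.+1 &
   [/\ (knots U2)`_b < v1, v1 < v2, v2 < (knots U2)`_b.+1, 0 < m &
    forall Om : set (R * R), open Om -> Om `<=` background_domain U1 U2 ->
      (gamma%:E * mu2 T <= mu2 (T `&` Om))%E -> m <= fine (mu2 (box u1 u2 v1 v2 `&` Om))]].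
Proof.
have [/andP[_ ta] /andP[_ tb]] := (sa, sb); have [g0 g1] := (gamma_gt0, gamma_le1).
move: (knots U1)`_a (knots U1)`_a.+1 (knots U2)`_b (knots U2)`_b.+1 ta tb.
move=> x1 x2 y1 y2 x12 y12; pose L := x2 - x1; pose H := y2 - y1.
have [L0 H0] : 0 < L /\ 0 < H by rewrite !subr_gt0.
(* Shrinking by e on all sides loses the area 2 e (L + H) - 4 e^2; this e makes the first term half
   of gamma L H. *)
pose e := gamma * L * H / (4 * (L + H)).
have LH0 : 0 < 4 * (L + H) by rewrite mulr_gt0// addr_gt0.
have e0 : 0 < e by rewrite divr_gt0// !mulr_gt0.
have eE : 4 * e * (L + H) = gamma * L * H.
  by rewrite /e; field; rewrite gt_eqF// addr_gt0.
have eL : 2 * e < L.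
  rewrite -(ltr_pM2r LH0) (_ : 2 * e * (4 * (L + H)) = 2 * (4 * e * (L + H))); last by ring.
  rewrite eE; have : gamma * L * H <= L * H by rewrite -mulrA ler_piMl// ltW// mulr_gt0.
  by have := mulr_gt0 L0 L0; have := mulr_gt0 L0 H0; nra.
have eH : 2 * e < H.
  rewrite -(ltr_pM2r LH0) (_ : 2 * e * (4 * (L + H)) = 2 * (4 * e * (L + H))); last by ring.
  rewrite eE; have : gamma * L * H <= L * H by rewrite -mulrA ler_piMl// ltW// mulr_gt0.
  by have := mulr_gt0 H0 H0; have := mulr_gt0 L0 H0; nra.
exists (x1 + e), (x2 - e), (y1 + e), (y2 - e), (gamma * L * H / 2).
rewrite /L /H in eL eH; split; [lra|lra|lra|split; [lra|lra|lra| |]].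
  by rewrite divr_gt0// !mulr_gt0.
move=> Om oOm Om_bg.
have mOm : measurable (Om : set (RT * RT)) by exact: open_measurable_plane.
set B := box _ _ _ _; set Q := rectangle _ _ _ _.
have mB : measurable (B : set (RT * RT)) by exact: measurable_box.
have mQ : measurable (Q : set (RT * RT)) by exact: measurable_rectangle.
have BQ : B `<=` Q.
  move=> z /boxP/andP[/andP[? ?] /andP[? ?]]; rewrite /Q /rectangle /= !in_itv /=.
  by split; apply/andP; split; lra.
have muQ : mu2 Q = (L * H)%:E by rewrite mu2_rectangle// ltW.
have muB : mu2 B = ((L - 2 * e) * (H - 2 * e))%:E.
  by rewrite mu2_box; [congr (_ %:E); rewrite /L /H; ring|lra|lra].
have muD : mu2 (Q `\` B) = (L * H - (L - 2 * e) * (H - 2 * e))%:E.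
  transitivity (mu2 Q - mu2 (Q `&` B))%E; last by rewrite setIidr// muQ muB EFinB.
  by apply: measureD => //; rewrite [X in (X < _)%E](_ : _ = (L * H)%:E) ?ltry//; exact: muQ.
rewrite muQ -EFinM => QOm.
have finB : mu2 (B `&` Om) \is a fin_num.
  by rewrite ge0_fin_numE; [apply: mu2_trimmed_fin oOm Om_bg _ _|exact: measure_ge0].
have : ((gamma * (L * H))%:E <= mu2 (B `&` Om) + mu2 (Q `\` B))%E.
  apply: (le_trans QOm); apply: (@le_trans _ _ (mu2 ((B `&` Om) `|` (Q `\` B)))).
    apply: le_measure; rewrite ?inE.
    - exact: measurableI.
    - by apply: measurableU; [exact: measurableI|exact: measurableD].
    - by move=> z [Qz Oz]; have [Bz|Bz] := pselect (B z); [left|right].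
  by apply: measureU2; [exact: measurableI|exact: measurableD].
rewrite muD -[mu2 (B `&` Om)]fineK// -EFinD lee_fin.
rewrite /=; move: (fine _) => f h.
have : (L - 2 * e) * (H - 2 * e) = L * H - 4 * e * (L + H) / 2 + 4 * e ^+ 2 by field.
by rewrite eE mulrA in h * => E; have := sqr_ge0 e; lra.
Qed.

(** The pieces are positive inside the element but may vanish on its edges. On the shrunken closed
    rectangle compactness gives positive minima, and [Om] covers an area of at least [m] of it,
    wherever that part lies. *)
Lemma large_bounds : exists2 c : R, 0 < c & forall Om : set (R * R),
  open Om -> Om `<=` background_domain U1 U2 ->
  (gamma%:E * mu2 T <= mu2 (T `&` Om))%E -> c <= mass Om i /\
  ((forall y : R, (knots U2)`_b < y < (knots U2)`_b.+1 -> (piece U2 i.2 b)^`().[y] != 0) ->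
   c <= stiff Om i i).
Proof.
have [u1 [u2 [v1 [v2 [m [au1 u12 u2a [bv1 v12 v2b m0 shrink]]]]]]] := shrink_element.
have /andP[ia ib] := iab.
have [|c1 c1_gt0 P1] := @horner_min R (piece U1 i.1 a) u1 u2 (ltW u12).
  by move=> x xu; rewrite gt_eqF// piece_gt0 ?ltn_ord//; lra.
have [|c2 c2_gt0 P2] := @horner_min R (piece U2 i.2 b) v1 v2 (ltW v12).
  by move=> y yv; rewrite gt_eqF// piece_gt0 ?ltn_ord//; lra.
have [c3 c3_gt0 P3] : exists2 c3 : R, 0 < c3 &
    (forall y : R, (knots U2)`_b < y < (knots U2)`_b.+1 -> (piece U2 i.2 b)^`().[y] != 0) ->
    forall y, v1 <= y <= v2 -> c3 <= `|(piece U2 i.2 b)^`().[y]|.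
  (* The constant is chosen before the derivative is assumed not to vanish; if it does vanish
     somewhere, any value will do. *)
  have [d2|d2] := pselect (forall y : R, (knots U2)`_b < y < (knots U2)`_b.+1 ->
      (piece U2 i.2 b)^`().[y] != 0); last by exists 1.
  have [|c3 c3_gt0 P3] := @horner_min R (piece U2 i.2 b)^`() v1 v2 (ltW v12).
    by move=> y yv; apply: d2; lra.
  by exists c3.
have boxE z : box u1 u2 v1 v2 z ->
    [/\ element U1 U2 a b z, u1 <= z.1 <= u2 & v1 <= z.2 <= v2].
  move=> /boxP/andP[z1 z2]; split; [apply/elementP|lra|lra].
  by apply/andP; split; lra.
pose c := Num.min (c1 * c2 * m) ((c1 * c3) ^+ 2 * m).
exists c; first by rewrite lt_min !mulr_gt0// exprn_gt0// mulr_gt0.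
move=> Om oOm Om_bg /(shrink Om oOm Om_bg) mB; split; last move=> d2.
  apply: le_trans (_ : c1 * c2 * fine (mu2 (box u1 u2 v1 v2 `&` Om)) <= _).
    by rewrite ge_min ler_pM2l ?mB// mulr_gt0.
  apply: (mass_ge oOm Om_bg (measurable_box _ _ _ _)) => z _ /boxE[Ez z1 z2].
  have [-> _ _] := phi_element sa sb i Ez; have /elementP/andP[e1 e2] := Ez.
  have := P1 _ z1; have := P2 _ z2.
  rewrite !ger0_norm ?piece_ge0 ?ltn_ord// => p2 p1.
  by rewrite ler_pM// ltW.
apply: le_trans (_ : (c1 * c3) ^+ 2 * fine (mu2 (box u1 u2 v1 v2 `&` Om)) <= _).
  by rewrite ge_min ler_pM2l ?mB ?orbT// exprn_gt0// mulr_gt0.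
apply: (stiff_ge oOm Om_bg (measurable_box _ _ _ _)) => z _ /boxE[Ez z1 z2].
have [_ _ ->] := phi_element sa sb i Ez.
apply: le_trans (_ : _ <= ((piece U1 i.1 a).[z.1] * (piece U2 i.2 b)^`().[z.2]) ^+ 2) _.
  rewrite -[leRHS]real_normK ?num_real// normrM lerXn2r ?nnegrE ?mulr_ge0 ?normr_ge0 ?(ltW c1_gt0) ?(ltW c3_gt0)//.
  by rewrite ler_pM ?(ltW c1_gt0) ?(ltW c3_gt0)// ?P1// P3.
by rewrite lerDr sqr_ge0.
Qed.

End Element.
End LargeBounds.

(** Only the first and last B-splines are nonzero at the ends of the interval. Moving one step back
    from the last index stays interior because n > 2. *)
Lemma interior_cover_index (n p a : nat) : (2 < n)%N -> (0 < p)%N -> (p <= a < n)%N ->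
  exists i, (0 < i < n.-1)%N /\ (i <= a <= i + p)%N.
Proof. by move=> *; have [an|an] := leqP a n.-2; [exists a|exists a.-1]; lia. Qed.

(** The candidates b and b - p are the B-splines having span b as their first or last one, where
    they are pure powers; at least one of them is interior. *)
Lemma interior_edge_index (n p b : nat) : (p.+1 < n)%N -> (0 < p)%N -> (p <= b < n)%N ->
  exists j, [/\ j = b \/ j = (b - p)%N, (0 < j < n.-1)%N & (j <= b <= j + p)%N].
Proof.
move=> pn p0 pb; have [bn|bn] := leqP b n.-2; first by exists b; split; [left|lia|lia].
by exists (b - p)%N; split; [right|lia|lia].
Qed.

(** * The matrix pencil of a trimmed discretization *)

Section Discretized.
Context {R : realType} (U1 U2 : spline_space R).
Local Notation mu2 := ((@lebesgue_measure R) \x (@lebesgue_measure R))%E.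
Local Notation n1 := (nbasis U1).
Local Notation n2 := (nbasis U2).
Variables Om GamD : set (R * R).
Hypothesis trimmed : trimmed_domain U1 U2 Om GamD.

Let oOm : open Om. Proof. by case: trimmed. Qed.
Let Om_bg : Om `<=` background_domain U1 U2. Proof. by case: trimmed. Qed.

Lemma stiffnessE (i j : 'I_#|active_basis U1 U2 Om GamD|) :
  stiffness U1 U2 Om GamD i j = stiff Om (enum_val i) (enum_val j).
Proof. by rewrite mxE integral2_grad_dot. Qed.

Lemma lumped_massE : lumped_mass U1 U2 Om GamD = diag_mx (\row_i mass Om (enum_val i)).
Proof.
by congr diag_mx; apply/rowP => i; rewrite !mxE integral2_lumped.
Qed.

Lemma trmx_stiffness : (stiffness U1 U2 Om GamD)^T = stiffness U1 U2 Om GamD.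
Proof. by apply/matrixP => i j; rewrite mxE !stiffnessE stiffC. Qed.

Section Eigenvalues.
Hypothesis mass_gt0 : forall i, i \in active_basis U1 U2 Om GamD -> 0 < mass Om i.

Lemma eigenvalue_bounds i : i \in active_basis U1 U2 Om GamD ->
  eigenvalue_first U1 U2 Om GamD <= stiff Om i i / mass Om i
    <= eigenvalue_last U1 U2 Om GamD.
Proof.
move=> iA; rewrite /eigenvalue_first /eigenvalue_last lumped_massE.
have := @gen_eigenvalue_diag_bounds R _ (stiffness U1 U2 Om GamD)
  (\row_k mass Om (enum_val k)) (enum_rank_in iA i) trmx_stiffness.
rewrite stiffnessE !mxE enum_rankK_in//; apply => k.
by rewrite mxE mass_gt0// enum_valP.
Qed.

(** The dimension of the pencil varies with the domain; the total number of B-splines bounds it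
    uniformly. *)
Lemma eigenvalue_last_upper i0 (r : R) : i0 \in active_basis U1 U2 Om GamD -> 0 <= r ->
  (forall i, i \in active_basis U1 U2 Om GamD -> stiff Om i i <= r * mass Om i) ->
  eigenvalue_last U1 U2 Om GamD <= #|{: bindex U1 U2}|%:R * r.
Proof.
move=> i0A r0 ub.
apply: (@le_trans _ _ (#|active_basis U1 U2 Om GamD|%:R * r)); last first.
  by rewrite ler_wpM2r// ler_nat max_card.
rewrite /eigenvalue_last lumped_massE; apply: gen_eigenvalue_last_le.
- by apply/card_gt0P; exists i0.
- exact: trmx_stiffness.
- by move=> k; rewrite mxE mass_gt0// enum_valP.
- by move=> k; rewrite stiffnessE mxE ub// enum_valP.
- by move=> k l y z; rewrite !stiffnessE; exact: (stiff_young oOm Om_bg).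
Qed.

End Eigenvalues.

(* These B-splines vanish on the boundary of the background domain, so that they
   satisfy any Dirichlet conditions. *)
Definition interior_index (i : bindex U1 U2) :=
  (0 < i.1 < n1.-1)%N && (0 < i.2 < n2.-1)%N.

Lemma bspline_boundary (U : spline_space R) (j : 'I_(nbasis U)) x :
  (0 < j < (nbasis U).-1)%N -> bspline U j x != 0 -> first_knot U < x < last_knot U.
Proof.
move=> /andP[j0 jn] Bx; have jN := ltn_ord j.
have [|fx] := leP x (first_knot U).
  rewrite le_eqVlt => /predU1P[xf|xf]; move: Bx.
    by rewrite xf bspline_first ?eqxx// j0.
  by rewrite bspline_outside ?eqxx//; left.
have [|//] := leP (last_knot U) x; rewrite le_eqVlt => /predU1P[xl|xl]; move: Bx.
  by rewrite -xl bspline_last ?eqxx// ltn_eqF.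
by rewrite bspline_outside ?eqxx//; right.
Qed.

Lemma interior_index_dirichlet i : interior_index i ->
  forall z, GamD z -> tbspline i z = 0.
Proof.
move=> /andP[i1 i2] z Gz; apply/eqP; apply: contrapT => /negP.
rewrite mulf_eq0 negb_or => /andP[/(bspline_boundary i1) z1 /(bspline_boundary i2) z2].
have [_ _ _ _ /(_ z Gz) [_ [_]]] := trimmed; apply.
by rewrite /background_domain interior_rectangle; apply/boxP; rewrite z1.
Qed.

Lemma interior_index_active i z : interior_index i -> Om z -> supp (tbspline i) z ->
  i \in active_basis U1 U2 Om GamD.
Proof.
move=> ii Oz sz; rewrite !inE; apply/andP; split; apply/asboolP.
  by exists z.
exact: interior_index_dirichlet.
Qed.

Lemma piece_edge_deriv (U : spline_space R) b (y : R) : is_span U b ->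
  (knots U)`_b < y < (knots U)`_b.+1 ->
  (piece U b b)^`().[y] != 0 /\ (piece U (b - deg U) b)^`().[y] != 0.
Proof.
move=> /andP[bt tb] /andP[by_ yb]; have /andP[pb bN] := span_bounds bt tb.
have szE := size_knots U; have p0 := deg_gt0 U.
rewrite /piece; split.
  have [|C C0 ->] := @bpoly_first _ _ (knots_sorted U) b bt tb (deg U); first by lia.
  rewrite derivZ deriv_exp derivXsubC mul1r hornerZ hornerMn horner_exp !hornerE.
  by rewrite mulf_neq0 ?gt_eqF// mulrn_wgt0 ?exprn_gt0 ?subr_gt0.
have [||C C0 ->] := @bpoly_last _ _ (knots_sorted U) b bt tb (deg U) (b - deg U); [lia|lia|].
rewrite derivZ deriv_exp derivB derivC derivX hornerZ hornerMn hornerM horner_exp !hornerE.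
rewrite mulf_neq0 ?(gt_eqF C0)// -mulr_natr mulf_neq0 ?pnatr_eq0 -?lt0n// mulN1r oppr_eq0.
by rewrite expf_neq0// subr_eq0 gt_eqF.
Qed.

Section Small.
Variables (gamma xi2 d x1 x2 : R) (ell : bindex U1 U2).
Hypotheses (gamma_ge0 : 0 <= gamma) (xi2_internal : internal_knot U2 xi2).
Hypotheses (d_gt0 : 0 < d) (x12 : x1 < x2) (two_lt_n1 : (2 < n1)%N).
Hypothesis ell_small : ell \in small_basis U1 U2 gamma Om GamD.
Hypothesis ellE : interior (active_support Om ell) = box x1 x2 xi2 (xi2 + d).

Lemma point_after_knot k : (k.+1 < size (knots U2))%N -> (knots U2)`_k = xi2 ->
  (knots U2)`_k < (knots U2)`_k.+1 ->
  exists a z, [/\ is_span U1 a, element U1 U2 a k z & box x1 x2 xi2 (xi2 + d) z].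
Proof.
move=> kt tk tkk; have d0 := d_gt0; have [x xx xk] := nonknot_exists U1 x12.
pose e : R := Num.min d ((knots U2)`_k.+1 - xi2).
have [e0 ed ek] : [/\ 0 < e, e <= d & e <= (knots U2)`_k.+1 - xi2].
  by rewrite /e; case: (leP d ((knots U2)`_k.+1 - xi2)); split; lra.
have zb : box x1 x2 xi2 (xi2 + d) (x, xi2 + e / 2).
  by apply/boxP => /=; rewrite xx /=; lra.
have [/= xbg _] := Om_bg (box_sub ellE zb).
have [|a at_ ax] := open_span (_ : first_knot U1 <= x <= last_knot U1) xk.
  by move: xbg; rewrite /= in_itv.
exists a, (x, xi2 + e / 2); split => //.
  by rewrite /is_span at_; case/andP: ax; exact: lt_trans.
by apply/elementP => /=; rewrite ax /=; lra.
Qed.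

(** For gamma = 0 every active element would be large, and [ell], whose support contains one, could
    not be small. *)
Lemma gamma_gt0 : 0 < gamma.
Proof.
rewrite lt0r gamma_ge0 andbT; apply/eqP => g0.
have [k [kt tk tkk _ _]] := internal_knotP xi2_internal.
have [a [z [sa Ez zb]]] := point_after_knot kt tk tkk.
have sk : is_span U2 k by rewrite /is_span kt.
have zs : supp (tbspline ell) z by move: zb; rewrite -ellE => /interior_subset[].
move: ell_small; rewrite inE => /andP[_ /negP]; apply; apply/asboolP.
exists (rectangle (knots U1)`_a (knots U1)`_a.+1 (knots U2)`_k (knots U2)`_k.+1).
  have /andP[at_ ta] := sa; split; first by exists a, k.
  - exists z; split; last exact: box_sub ellE _ zb.
    move/elementP: Ez => /andP[/andP[? ?] /andP[? ?]].
    by rewrite /rectangle /= !in_itv /= !ltW.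
  - by rewrite g0 mul0e measure_ge0.
exact: rectangle_sub_supp sa sk _ (supp_covers sa sk Ez zs).
Qed.

Hypothesis small_begins : forall i, i \in small_basis U1 U2 gamma Om GamD ->
  begins_at (bspline U2 i.2) xi2.

Lemma large_function_span (i : bindex U1 U2) : large_function gamma Om i -> exists a b,
  [/\ is_span U1 a, is_span U2 b, covers i a b &
   (exists z, (rectangle (knots U1)`_a (knots U1)`_a.+1 (knots U2)`_b (knots U2)`_b.+1 `&` Om) z) /\
   (gamma%:E * mu2 (rectangle (knots U1)`_a (knots U1)`_a.+1 (knots U2)`_b (knots U2)`_b.+1) <=
    mu2 (rectangle (knots U1)`_a (knots U1)`_a.+1 (knots U2)`_b (knots U2)`_b.+1 `&` Om))%E].
Proof.
move=> [T [[a [b [at_ bt ta tb TE]]] T0 Tg] Ts]; exists a, b.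
have [sa sb] : is_span U1 a /\ is_span U2 b by rewrite /is_span at_ bt.
split => //; last by rewrite -TE.
pose z := (((knots U1)`_a + (knots U1)`_a.+1) / 2, ((knots U2)`_b + (knots U2)`_b.+1) / 2).
have Ez : element U1 U2 a b z by apply/elementP; rewrite /z /=; lra.
apply: (supp_covers sa sb Ez); apply: Ts.
by rewrite TE /rectangle /z /= !in_itv /=; split; lra.
Qed.

(** All small functions begin at [xi2], so an interior function that is active just after [xi2] but
    begins earlier is large. From it only a large element is kept. The second factor is then
    exchanged for one that is a pure power on that element, so that its derivative has no zero there
    and the energy is bounded below. *)
Lemma large_exists : exists (i : bindex U1 U2) a b, [/\ i \in active_basis U1 U2 Om GamD,
  is_span U1 a, is_span U2 b, covers i a b &
  (gamma%:E * mu2 (rectangle (knots U1)`_a (knots U1)`_a.+1 (knots U2)`_b (knots U2)`_b.+1) <=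
   mu2 (rectangle (knots U1)`_a (knots U1)`_a.+1 (knots U2)`_b (knots U2)`_b.+1 `&` Om))%E /\
  (forall y : R, (knots U2)`_b < y < (knots U2)`_b.+1 -> (piece U2 i.2 b)^`().[y] != 0)].
Proof.
have [k [kt tk tkk /andP[m0 mp] beginE]] := internal_knotP xi2_internal.
have [a [z [sa Ez zb]]] := point_after_knot kt tk tkk.
have sk : is_span U2 k by rewrite /is_span kt.
have /andP[at_ ta] := sa.
have /andP[p2k kn2] := span_bounds kt tkk.
have p1_gt0 := deg_gt0 U1; have p2_gt0 := deg_gt0 U2.
have sz2 := size_knots U2.
have p2k' : (deg U2 < k)%N.
  rewrite ltn_neqAle p2k andbT; apply/eqP => pk; have [_ /andP[+ _]] := xi2_internal.
  by rewrite -tk -pk knot_first// ltxx.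
have Oz : Om z by exact: box_sub ellE _ zb.
have [i1 [i1n i1a]] := interior_cover_index two_lt_n1 p1_gt0 (span_bounds at_ ta).
have i1_lt : (i1 < n1)%N by case/andP: i1n => _ /leq_trans; apply; exact: leq_pred.
have j_lt : (k - deg U2 < n2)%N by lia.
(* Index k - p2 is the first to cover span k; beginning at [xi2] would require multiplicity p2 + 1,
   but internal knots have at most p2. *)
pose i0 : bindex U1 U2 := (Ordinal i1_lt, Ordinal j_lt).
have i0A : i0 \in active_basis U1 U2 Om GamD.
  apply: (@interior_index_active _ z) => //.
    by rewrite /interior_index /= i1n /=; lia.
  apply: (element_sub_supp sa sk _ Ez).
  by rewrite /covers /= i1a /=; lia.
have /asboolP : `[< large_function gamma Om i0 >].
  apply/negPn; apply/negP => i0S.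
  have /small_begins /= : i0 \in small_basis U1 U2 gamma Om GamD by rewrite inE i0A.
  move=> /(begins_atP _ j_lt)/eqP; rewrite beginE; last by lia.
  by lia.
move=> /large_function_span[a' [b' [sa' sb' /andP[ia' _] [[w [Tw Ow]] Tg]]]].
have /andP[bt' tb'] := sb'.
have [j [jn jb jd]] : exists j, [/\ (0 < j < n2.-1)%N, (j <= b' <= j + deg U2)%N &
    forall y : R, (knots U2)`_b' < y < (knots U2)`_b'.+1 -> (piece U2 j b')^`().[y] != 0].
  have [j [jE jn jb]] := interior_edge_index (leq_ltn_trans p2k' kn2) p2_gt0 (span_bounds bt' tb').
  by exists j; split => //; case: jE => -> y /(piece_edge_deriv sb')[].
have j2_lt : (j < n2)%N by case/andP: jn => _ /leq_trans; apply; exact: leq_pred.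
pose i : bindex U1 U2 := (Ordinal i1_lt, Ordinal j2_lt).
have ic : covers i a' b' by rewrite /covers /= jb andbT.
exists i, a', b'; split => //.
apply: (@interior_index_active _ w) => //; first by rewrite /interior_index /= i1n.
by have := rectangle_sub_supp sa' sb' ic; apply.
Qed.

End Small.
End Discretized.

(** * Uniform estimates as delta tends to 0 *)

Section AtZero.
Context {R : realType}.

Lemma near_at_right0 (P : R -> Prop) (e : R) : 0 < e ->
  (forall d, 0 < d < e -> P d) -> \forall d \near 0^'+, P d.
Proof.
move=> e0 HP; near=> d; apply: HP; apply/andP; split.
  by near: d; exact: nbhs_right_gt.
by near: d; exact: nbhs_right_lt.
Unshelve. all: by end_near. Qed.

Lemma bigO_at0_intro (f g : R -> R) (C e : R) : 0 < C -> 0 < e ->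
  (forall d, 0 < d < e -> f d <= C * g d) -> bigO_at0 f g.
Proof. by move=> C0 e0 fg; exists C => //; exact: near_at_right0 fg. Qed.

Lemma equiv_at0_intro (f g : R -> R) (c C e : R) : 0 < c -> 0 < e ->
  (forall d, 0 < d < e -> [/\ 0 <= g d, c * g d <= f d & f d <= C * g d]) ->
  equiv_at0 f g.
Proof.
move=> c0 e0 fg; exists c, (Num.max c C); split; first by rewrite c0 le_max lexx.
apply: (near_at_right0 e0) => d /fg[g0 cf fC]; rewrite cf (le_trans fC)//.
by rewrite ler_wpM2r// le_max lexx orbT.
Qed.

(** The basis function in question may change with d, so constants found for each index separately
    are merged by a minimum over finitely many indices. *)
Lemma uniform_lower (T : finType) (P : T -> R -> Prop) :
  (forall t c c', 0 < c' -> c' <= c -> P t c -> P t c') ->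
  (forall t, exists2 c, 0 < c & P t c) -> exists2 c, 0 < c & forall t, P t c.
Proof.
move=> mono exP; have /choice[f fP] : forall t, exists c, 0 < c /\ P t c.
  by move=> t; have [c] := exP t; exists c.
exists (\big[Num.min/1]_t f t).
  by apply: lt_bigmin => // t _; case: (fP t).
move=> t; have [f0 Pf] := fP t; apply: mono Pf; last exact: bigmin_le.
by apply: lt_bigmin => // s _; case: (fP s).
Qed.

Lemma uniform_upper (T : finType) (P : T -> R -> Prop) :
  (forall t c c', c <= c' -> P t c -> P t c') ->
  (forall t, exists2 c, 0 < c & P t c) -> exists2 c, 0 < c & forall t, P t c.
Proof.
move=> mono exP; have [t c c' c'0 cc|t|c c0 cP] := @uniform_lower T (fun t c => P t c^-1).
- by apply: mono; rewrite lef_pV2// posrE// (lt_le_trans c'0).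
- by have [c c0 Pc] := exP t; exists c^-1; rewrite ?invr_gt0// invrK.
by exists c^-1; rewrite ?invr_gt0.
Qed.

End AtZero.

Section Uniform.
Context {R : realType} (U1 U2 : spline_space R).
Local Notation mu2 := ((@lebesgue_measure R) \x (@lebesgue_measure R))%E.
Local Notation elt a b :=
  (rectangle (knots U1)`_a (knots U1)`_a.+1 (knots U2)`_b (knots U2)`_b.+1).

Lemma uniform_global : exists2 C : R, 0 < C &
  forall (i : bindex U1 U2) (Om : set (R * R)), open Om -> Om `<=` background_domain U1 U2 ->
    mass Om i <= C /\ stiff Om i i <= C.
Proof.
apply: (@uniform_upper _ (bindex U1 U2) (fun i C => forall Om : set (R * R), open Om ->
  Om `<=` background_domain U1 U2 -> mass Om i <= C /\ stiff Om i i <= C)).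
  by move=> i c c' cc H Om oOm /(H _ oOm)[h1 h2]; split; apply: le_trans cc.
exact: global_upper.
Qed.

Lemma uniform_large (gamma : R) : 0 < gamma -> gamma <= 1 -> exists2 c : R, 0 < c &
  forall (i : bindex U1 U2) a b (Om : set (R * R)), open Om -> Om `<=` background_domain U1 U2 ->
    is_span U1 a -> is_span U2 b -> covers i a b ->
    (gamma%:E * mu2 (elt a b) <= mu2 (elt a b `&` Om))%E ->
    c <= mass Om i /\
    ((forall y : R, (knots U2)`_b < y < (knots U2)`_b.+1 -> (piece U2 i.2 b)^`().[y] != 0) ->
     c <= stiff Om i i).
Proof.
(* Spans are encoded as ordinals so that the index set is finite. *)
move=> g0 g1; pose T := (bindex U1 U2 * 'I_(size (knots U1)) * 'I_(size (knots U2)))%type.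
pose P (t : T) (c : R) := forall Om : set (R * R), open Om -> Om `<=` background_domain U1 U2 ->
    is_span U1 t.1.2 -> is_span U2 t.2 -> covers t.1.1 t.1.2 t.2 ->
    (gamma%:E * mu2 (elt t.1.2 t.2) <= mu2 (elt t.1.2 t.2 `&` Om))%E ->
    c <= mass Om t.1.1 /\
    ((forall y : R, (knots U2)`_t.2 < y < (knots U2)`_t.2.+1 ->
      (piece U2 t.1.1.2 t.2)^`().[y] != 0) -> c <= stiff Om t.1.1 t.1.1).
have [t c c' _ cc H Om oOm bg sa sb iab Tg|t|c c0 cP] := @uniform_lower _ T P.
- have [h1 h2] := H Om oOm bg sa sb iab Tg.
  by split; [exact: le_trans h1|move=> /h2; exact: le_trans].
- have [[sa [sb iab]]|nt] := pselect (is_span U1 t.1.2 /\ is_span U2 t.2 /\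
      covers t.1.1 t.1.2 t.2); last first.
    by exists 1 => // Om _ _ sa sb iab; exfalso; apply: nt.
  have [c c0 H] := large_bounds sa sb iab g0 g1.
  by exists c => // Om oOm bg _ _ _; exact: H.
exists c => // i a b Om oOm bg sa sb iab.
have at_ : (a < size (knots U1))%N by case/andP: sa => /ltnW.
have bt : (b < size (knots U2))%N by case/andP: sb => /ltnW.
exact: (cP (i, Ordinal at_, Ordinal bt) Om oOm bg sa sb iab).
Qed.

End Uniform.

(** If kappa is at least 1, every B-spline beginning at the knot is at least C^1 there, so the ratio
    d^(order - 1) stays bounded. *)
Lemma smooth_order p k j m : (p - m)%N <> 0%N -> (j <= k < j + m)%N ->
  (0 < (p - (k - j)).-1)%N.
Proof. lia. Qed.

Section Family.
Context {R : realType} (U1 U2 : spline_space R).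
Hypothesis two_lt_n1 : (2 < nbasis U1)%N.
Variables (gamma d0 xi2 : R) (Om GamD : R -> set (R * R)) (ell : R -> bindex U1 U2).
Hypotheses (gamma01 : 0 <= gamma <= 1) (d0_gt0 : 0 < d0).
Hypothesis trimmed : forall d, 0 < d < d0 -> trimmed_domain U1 U2 (Om d) (GamD d).
Hypothesis xi2_internal : internal_knot U2 xi2.
Hypothesis ell_small : forall d, 0 < d < d0 ->
  ell d \in small_basis U1 U2 gamma (Om d) (GamD d).

Local Notation S d := (small_basis U1 U2 gamma (Om d) (GamD d)).
Local Notation A d := (active_basis U1 U2 (Om d) (GamD d)).
Local Notation lambda_1 d := (eigenvalue_first U1 U2 (Om d) (GamD d)).
Local Notation lambda_n d := (eigenvalue_last U1 U2 (Om d) (GamD d)).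

Lemma small_active d i : i \in S d -> i \in A d.
Proof. by rewrite inE => /andP[]. Qed.

Section Shape.
Variables X1 X2 : bindex U1 U2 -> R -> R.
Hypothesis shape : forall d, 0 < d < d0 -> forall i, i \in S d ->
  [/\ begins_at (bspline U2 i.2) xi2, X1 i d < X2 i d &
      interior (active_support (Om d) i) = box (X1 i d) (X2 i d) xi2 (xi2 + d)].

Lemma large_ratios : exists c C : R, [/\ 0 < c, 0 < C & forall d, 0 < d < d0 ->
  (forall i, i \in A d -> i \notin S d -> 0 < mass (Om d) i /\
     stiff (Om d) i i <= C * mass (Om d) i) /\
  exists i, [/\ i \in A d, 0 < mass (Om d) i &
     c * mass (Om d) i <= stiff (Om d) i i <= C * mass (Om d) i]].
Proof.
have [ga0 ga1] := andP gamma01; have d00 := d0_gt0.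
have small_facts d : 0 < d < d0 -> [/\ 0 < d, ell d \in S d, X1 (ell d) d < X2 (ell d) d &
    interior (active_support (Om d) (ell d)) = box (X1 (ell d) d) (X2 (ell d) d) xi2 (xi2 + d)].
  move=> dd; have elS := ell_small dd; have [_ X12 iE] := shape dd elS.
  by split => //; case/andP: dd.
have g0 : 0 < gamma.
  have dd : 0 < d0 / 2 < d0 by lra.
  have [dp elS X12 iE] := small_facts _ dd.
  exact: (gamma_gt0 (trimmed dd) ga0 xi2_internal dp X12 elS iE).
have [C C0 Cb] := uniform_global U1 U2; have [c c0 cb] := @uniform_large R U1 U2 gamma g0 ga1.
(* Mass and energy are at most C and the mass is at least c, which bounds the ratio by C / c; where
   the energy is at least c too, it is at least c / C. *)
exists (c / C), (C / c); split; [exact: divr_gt0|exact: divr_gt0|].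
move=> d dd; have [oOm _ bg _ _] := trimmed dd.
have up (i : bindex U1 U2) : c <= mass (Om d) i -> 0 < mass (Om d) i /\
    stiff (Om d) i i <= C / c * mass (Om d) i.
  move=> cm; split; first exact: lt_le_trans cm.
  have [_ KC] := Cb i _ oOm bg; apply: (le_trans KC).
  by rewrite -mulrA ler_peMr ?(ltW C0)// mulrC ler_pdivlMr// mul1r.
split.
  move=> i iA iS; have /asboolP li : `[< large_function gamma (Om d) i >].
    by move: iS; rewrite inE iA /= negbK.
  have [a [b [sa sb iab [_ Tg]]]] := large_function_span li.
  by have [cm _] := cb i a b _ oOm bg sa sb iab Tg; exact: up.
have [dp elS X12 iE] := small_facts _ dd.
have sb i : i \in S d -> begins_at (bspline U2 i.2) xi2 by move=> /(shape dd)[].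
have [i [a [b [iA sa sb' iab [Tg dy]]]]] :=
  large_exists (trimmed dd) ga0 xi2_internal dp X12 two_lt_n1 elS iE sb.
have [cm cK] := cb i a b _ oOm bg sa sb' iab Tg; have [m0 KC] := up i cm.
exists i; split => //; rewrite KC andbT; apply: le_trans (cK dy).
have [mC _] := Cb i _ oOm bg.
by rewrite mulrAC ler_pdivrMr// ler_wpM2l// ltW.
Qed.

Section Strip.
Variable k : nat.
Hypotheses (kt : (k.+1 < size (knots U2))%N) (tk : (knots U2)`_k = xi2).
Hypothesis beginE : forall j, (j < size (knots U2))%N ->
  ((knots U2)`_j == xi2) = (j <= k < j + count_mem xi2 (knots U2))%N.

(** The k for which B-spline [i.2] is exactly C^k at [xi2], provided that it begins there. *)
Let order (i : bindex U1 U2) := (deg U2 - (k - i.2)).-1.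

Hypothesis strip : forall i, exists c C e : R, [/\ 0 < c, 0 < C, 0 < e &
  forall d, 0 < d < d0 -> d < e -> i \in S d ->
    0 < mass (Om d) i /\ c * (d ^+ order i / d) * mass (Om d) i <= stiff (Om d) i i
      <= C * (d ^+ order i / d) * mass (Om d) i].

Lemma uniform_strip : exists c C e : R, [/\ 0 < c, 0 < C, 0 < e &
  forall d, 0 < d < d0 -> d < e -> forall i, i \in S d ->
    0 < mass (Om d) i /\ c * (d ^+ order i / d) * mass (Om d) i <= stiff (Om d) i i
      <= C * (d ^+ order i / d) * mass (Om d) i].
Proof.
(* A single number e serves as lower constant, inverse of the upper constant and range of d, so that
   one minimum over the indices treats all three. *)
pose P (i : bindex U1 U2) (e : R) := forall d, 0 < d < d0 -> d < e -> i \in S d ->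
    0 < mass (Om d) i /\ e * (d ^+ order i / d) * mass (Om d) i <= stiff (Om d) i i
      <= e^-1 * (d ^+ order i / d) * mass (Om d) i.
have [i e e' e'0 ee H d dd de iS|i|e e0 eP] := @uniform_lower _ (bindex U1 U2) P.
- have /andP[dp _] := dd; have e_gt0 : 0 < e := lt_le_trans e'0 ee.
  have [m0 /andP[h1 h2]] := H d dd (lt_le_trans de ee) iS; split => //.
  have D0 : 0 <= d ^+ order i / d * mass (Om d) i.
    by rewrite mulr_ge0// ?ltW// divr_gt0// exprn_gt0.
  apply/andP; split; [apply: le_trans h1|apply: (le_trans h2)];
    rewrite -(mulrA _ (_ / _)) -[leRHS](mulrA _ (_ / _)) ler_wpM2r//.
  by rewrite lef_pV2 ?posrE.
- have [c [C [e [c0 C0 e0 H]]]] := strip i.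
  pose f : R := Num.min e (Num.min c C^-1).
  have f0 : 0 < f by rewrite /f !lt_min e0 c0 invr_gt0.
  exists f => // d dd df iS; have /andP[dp _] := dd.
  have fe : f <= e by rewrite /f ge_min lexx.
  have [m0 /andP[h1 h2]] := H d dd (lt_le_trans df fe) iS; split => //.
  have D0 : 0 <= d ^+ order i / d * mass (Om d) i.
    by rewrite mulr_ge0// ?ltW// divr_gt0// exprn_gt0.
  apply/andP; split; [apply: le_trans h1|apply: (le_trans h2)];
    rewrite -(mulrA _ (_ / _)) -[leRHS](mulrA _ (_ / _)) ler_wpM2r//.
    by rewrite /f !ge_min lexx orbT.
  by rewrite -[C]invrK lef_pV2 ?posrE ?invr_gt0// /f !ge_min lexx !orbT.
by exists e, e^-1, e; split => //; [rewrite invr_gt0|move=> d dd de i; exact: eP].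
Qed.

Lemma strip_conclusion :
  (forall d, 0 < d < d0 -> forall j : 'I_(nbasis U2), begins_at (bspline U2 j) xi2 ->
     exists i1, (i1, j) \in S d) ->
  (if (deg U2 <= 2)%N then bigO_at0 (fun d => lambda_1 d) (fun=> 1)
   else bigO_at0 (fun d => lambda_1 d) (fun d => d ^+ (deg U2 - 2))) /\
  (if continuity_at U2 xi2 == 0%N then equiv_at0 (fun d => lambda_n d) (fun d => d^-1)
   else equiv_at0 (fun d => lambda_n d) (fun=> 1)).
Proof.
move=> exS; have [c [C [e [c0 C0 e0 smallP]]]] := uniform_strip.
have [c' [C' [c'0 C'0 largeP]]] := large_ratios.
pose eta : R := Num.min (Num.min e d0) 1.
have eta0 : 0 < eta by rewrite /eta !lt_min e0 d0_gt0 ltr01.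
have etaP d : 0 < d < eta -> [/\ 0 < d, 0 < d < d0, d < e & d < 1].
  by rewrite /eta !lt_min => /andP[-> /andP[/andP[-> ->] ->]].
have mass0 d : 0 < d < eta -> forall i, i \in A d -> 0 < mass (Om d) i.
  move=> /etaP[dp dd de d1] i iA; have [iS|iS] := boolP (i \in S d).
    by have [] := smallP d dd de i iS.
  by have [/(_ i iA iS)[]] := largeP d dd.
have sz2 := size_knots U2.
have /andP[pk kN] : (deg U2 <= k < nbasis U2)%N.
  apply: (span_bounds kt); rewrite lt_neqAle (knot_le (knots_sorted U2)) ?leqnSn// andbT.
  by rewrite eq_sym tk beginE// ltnn.
have mcount : (0 < count_mem xi2 (knots U2) <= deg U2)%N.
  by have [k' [_ _ _ ->]] := internal_knotP xi2_internal.
have small_index d i : 0 < d < d0 -> i \in S d -> (i.2 <= k < i.2 + count_mem xi2 (knots U2))%N.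
  move=> dd /(shape dd)[/(begins_atP _ (ltn_ord _)) /eqP + _ _]; rewrite beginE//.
  by rewrite sz2 ltn_addr.
pose N : R := #|{: bindex U1 U2}|%:R + 1.
have N0 : 0 < N by rewrite ltr_wpDl.
have last_le d r : 0 < d < eta -> 0 <= r ->
    (forall i, i \in A d -> stiff (Om d) i i <= r * mass (Om d) i) -> lambda_n d <= N * r.
  move=> dd r0 ub; have [_ dd0 _ _] := etaP _ dd.
  have [_ [i [iA _ _]]] := largeP d dd0.
  apply: (le_trans (eigenvalue_last_upper (trimmed dd0) (mass0 d dd) iA r0 ub)).
  by rewrite ler_wpM2r// lerDl.
have first_le_large d : 0 < d < eta -> lambda_1 d <= C'.
  move=> dd; have [_ dd0 _ _] := etaP _ dd.
  have [_ [i [iA m0 /andP[_ KC]]]] := largeP d dd0.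
  have /andP[h _] := eigenvalue_bounds (trimmed dd0) (mass0 d dd) iA.
  by apply: (le_trans h); rewrite ler_pdivrMr.
have last_ge_large d : 0 < d < eta -> c' <= lambda_n d.
  move=> dd; have [_ dd0 _ _] := etaP _ dd.
  have [_ [i [iA m0 /andP[cK _]]]] := largeP d dd0.
  have /andP[_ h] := eigenvalue_bounds (trimmed dd0) (mass0 d dd) iA.
  by apply: le_trans h; rewrite ler_pdivlMr.
split.
  case: leqP => p2.
    by apply: (bigO_at0_intro C'0 eta0) => d dd; rewrite mulr1 first_le_large.
  apply: (bigO_at0_intro C0 eta0) => d dd; have [dp dd0 de d1] := etaP _ dd.
  (* Index k gives the smoothest small function, of order p2 - 1, whose ratio is O(d^(p2 - 2)). *)
  have [|i1 iS] := exS d dd0 (Ordinal kN); first by apply/begins_atP.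
  have [m0 /andP[_ KC]] := smallP d dd0 de _ iS.
  have /andP[h _] := eigenvalue_bounds (trimmed dd0) (mass0 d dd) (small_active iS).
  apply: (le_trans h); rewrite ler_pdivrMr//; apply: (le_trans KC).
  rewrite /order /= subnn subn0 (_ : (deg U2).-1 = (deg U2 - 2).+1)%N; last by clear -p2; lia.
  by rewrite exprSr mulfK ?gt_eqF.
rewrite /continuity_at; case: eqP => kap.
  have mE : count_mem xi2 (knots U2) = deg U2 by clear -kap mcount; lia.
  apply: (@equiv_at0_intro _ _ _ c (N * (C + C')) eta) => // d dd.
  have [dp dd0 de d1] := etaP _ dd; rewrite invr_ge0 ltW//; split => //.
    have jN : (k.+1 - deg U2 < nbasis U2)%N by have := deg_gt0 U2; clear -kN; lia.
    (* For kappa = 0 the multiplicity is p2, and index k + 1 - p2 gives the roughest function, of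
       order 0, with ratio of order 1 / d. *)
    have [|i1 iS] := exS d dd0 (Ordinal jN).
      have p0 := deg_gt0 U2; apply/begins_atP => //; apply/eqP.
      rewrite beginE /= ?mE; last by rewrite sz2; clear -jN; lia.
      by clear -pk p0; lia.
    have [m0 /andP[cK _]] := smallP d dd0 de _ iS.
    have /andP[_ h] := eigenvalue_bounds (trimmed dd0) (mass0 d dd) (small_active iS).
    apply: le_trans h; rewrite ler_pdivlMr//; apply: le_trans cK.
    have := small_index d _ dd0 iS; rewrite /order /= mE => kk.
    rewrite (_ : (deg U2 - (k - (k.+1 - deg U2))).-1 = 0%N); last by clear -kk pk; lia.
    by rewrite expr0 div1r.
  rewrite -mulrA; apply: last_le => //; first by rewrite mulr_ge0 ?addr_ge0 ?invr_ge0 ?ltW.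
  (* As d < 1, the bound by 1 / d also absorbs the bounded ratios of large functions. *)
  move=> i iA; have dV : 1 <= d^-1 by rewrite invf_ge1// ltW.
  have [iS|iS] := boolP (i \in S d).
    have [m0 /andP[_ KC]] := smallP d dd0 de _ iS; apply: (le_trans KC).
    rewrite ler_wpM2r ?(ltW m0)// ler_pM ?(ltW C0)//.
    - by rewrite divr_ge0 ?exprn_ge0// ltW.
    - by rewrite lerDl ltW.
    - by rewrite ler_piMl ?invr_ge0 ?(ltW dp)// exprn_ile1// ltW.
  have [/(_ i iA iS)[m0 KC] _] := largeP d dd0; apply: (le_trans KC).
  rewrite ler_wpM2r ?(ltW m0)// -[C']mulr1 ler_pM ?(ltW C'0)// mulr1 lerDr.
  exact: ltW.
apply: (@equiv_at0_intro _ _ _ c' (N * (C + C')) eta) => // d dd.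
have [dp dd0 de d1] := etaP _ dd; split => //; first by rewrite mulr1 last_ge_large.
rewrite mulr1; apply: last_le => //; first by rewrite addr_ge0// ltW.
move=> i iA; have [iS|iS] := boolP (i \in S d).
  have [m0 /andP[_ KC]] := smallP d dd0 de _ iS; apply: (le_trans KC).
  rewrite ler_wpM2r ?(ltW m0)//; apply: (@le_trans _ _ C); last by rewrite lerDl ltW.
  rewrite ler_piMr ?(ltW C0)// ler_pdivrMr// mul1r -[leRHS]expr1.
  apply: ler_wiXn2l; [exact: ltW|exact: ltW|].
  exact: smooth_order kap (small_index d i dd0 iS).
have [/(_ i iA iS)[m0 KC] _] := largeP d dd0; apply: (le_trans KC).
by rewrite ler_wpM2r ?(ltW m0)// lerDr ltW.
Qed.

End Strip.
End Shape.
End Family.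

(** * Powers of the size of the active support versus powers of delta *)

Section Sizes.
Context {R : realType}.

(** The width w may vary with d, since [ell d] may be a different small function for each d; only
    its bounds m and M matter. *)
Lemma equiv_width (f : R -> R) (m M e : R) n : 0 < m -> 0 < M -> 0 < e ->
  (forall d, 0 < d < e -> exists w, m <= w <= M /\ f d = w * d) ->
  equiv_at0 (fun d => d ^+ n) (fun d => f d ^+ n) /\
  equiv_at0 (fun d => d^-1) (fun d => (f d)^-1).
Proof.
move=> m0 M0 e0 fE; split.
  apply: (@equiv_at0_intro _ _ _ (M ^- n) (m ^- n) e); rewrite ?invr_gt0 ?exprn_gt0//.
  move=> d dd; have /andP[dp _] := dd; have [w [/andP[mw wM] ->]] := fE d dd.
  have w0 := lt_le_trans m0 mw; rewrite exprMn mulr_ge0 ?exprn_ge0 ?(ltW w0) ?(ltW dp)//.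
  split => //; rewrite mulrA.
    rewrite ler_piMl ?exprn_ge0 ?(ltW dp)// mulrC ler_pdivrMr ?exprn_gt0// mul1r.
    by rewrite lerXn2r ?nnegrE ?(ltW w0) ?(ltW M0).
  rewrite ler_peMl ?exprn_ge0 ?(ltW dp)// mulrC ler_pdivlMr ?exprn_gt0// mul1r.
  by rewrite lerXn2r ?nnegrE ?(ltW w0) ?(ltW m0).
apply: (@equiv_at0_intro _ _ _ m M e) => // d dd.
have /andP[dp _] := dd; have [w [/andP[mw wM] ->]] := fE d dd.
have w0 := lt_le_trans m0 mw; rewrite invr_ge0 mulr_ge0 ?(ltW w0) ?(ltW dp)//.
rewrite invfM !mulrA; split => //.
  by rewrite ler_piMl ?invr_ge0 ?(ltW dp)// ler_pdivrMr// mul1r.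
by rewrite ler_peMl ?invr_ge0 ?(ltW dp)// ler_pdivlMr// mul1r.
Qed.

Lemma powR_square (d : R) n : 0 < d ->
  (d * d) `^ (n%:R / 2) = d ^+ n /\ (d * d) `^ (- 2^-1) = d^-1.
Proof.
move=> d0; have dd r : (d * d) `^ (r / 2) = d `^ r.
  rewrite -expr2 -powR_mulrn ?(ltW d0)// -powRrM; congr (_ `^ _).
  by rewrite mulrCA mulfV ?mulr1// pnatr_eq0.
split; first by rewrite dd powR_mulrn// ltW.
by rewrite powRN -[2^-1]mul1r dd powRr1// ltW.
Qed.

Lemma equiv_square (f : R -> R) (e : R) n : 0 < e ->
  (forall d, 0 < d < e -> f d = d * d) ->
  equiv_at0 (fun d => d ^+ n) (fun d => f d `^ (n%:R / 2)) /\
  equiv_at0 (fun d => d^-1) (fun d => f d `^ (- 2^-1)).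
Proof.
move=> e0 fE; split; apply: (@equiv_at0_intro _ _ _ 1 1 e) => // d dd;
  have /andP[dp _] := dd; rewrite fE//; have [h1 h2] := powR_square n dp.
  by rewrite h1 mul1r exprn_ge0// ltW.
by rewrite h2 mul1r invr_ge0 ltW.
Qed.

End Sizes.

Section Knot.
Context {R : realType} (U : spline_space R).
Local Notation t := (knots U).
Local Notation p := (deg U).

Lemma bspl_dbspl_bounded j : exists2 C : R, 0 < C &
  forall x : R, `|bspl U j x| <= C /\ `|dbspl U j x| <= C.
Proof.
have [C C0 hC] := on_spans_bounded U (piece U j).
have [D D0 hD] := on_spans_bounded U (fun a => (piece U j a)^`()).
exists (C + D + 1) => [|x]; first by rewrite ltr_wpDl ?addr_ge0.
by split; [apply: (le_trans (hC x))|apply: (le_trans (hD x))]; lra.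
Qed.

Lemma begins_vanishes k (xi : R) (j : 'I_(nbasis U)) : internal_knot U xi ->
  (k.+1 < size t)%N -> t`_k = xi ->
  (forall j, (j < size t)%N -> (t`_j == xi) = (j <= k < j + count_mem xi t)%N) ->
  begins_at (bspline U j) xi ->
  exists c C eta : R, [/\ 0 < c, 0 < C, 0 < eta &
    vanishes_to U j xi (p - (k - j)).-1 c C eta].
Proof.
move=> internal kt tk beginE /(begins_atP _ (ltn_ord j)) tj.
have [_ [_ _ _ /andP[_ mp] _]] := internal_knotP internal.
have jt : (j < size t)%N by rewrite size_knots ltn_addr.
have := beginE j jt; rewrite tj eqxx => /esym jk.
rewrite -{1}tk; apply: bspl_vanishes => //.
- rewrite lt_neqAle (knot_le (knots_sorted U)) ?leqnSn// andbT.
  by rewrite eq_sym tk beginE// ltnn.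
- by clear -jk mp; case/andP: jk => -> /leq_trans; apply; rewrite leq_add2l.
- by rewrite tj.
by rewrite prednK// subn_gt0; clear -jk mp; lia.
Qed.

End Knot.

(** * The three trimming configurations *)

Section Configurations.
Context {R : realType} (U1 U2 : spline_space R).
Hypothesis two_lt_n1 : (2 < nbasis U1)%N.
Variables (gamma d0 xi2 : R) (Om GamD : R -> set (R * R)) (ell : R -> bindex U1 U2).
Hypotheses (gamma01 : 0 <= gamma <= 1) (d0_gt0 : 0 < d0).
Hypothesis trimmed : forall d : R, 0 < d < d0 -> trimmed_domain U1 U2 (Om d) (GamD d).
Hypothesis xi2_internal : internal_knot U2 xi2.
Hypothesis ell_small : forall d : R, 0 < d < d0 ->
  ell d \in small_basis U1 U2 gamma (Om d) (GamD d).

Local Notation S d := (small_basis U1 U2 gamma (Om d) (GamD d)).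
Local Notation A d := (active_basis U1 U2 (Om d) (GamD d)).
Local Notation lambda_1 d := (eigenvalue_first U1 U2 (Om d) (GamD d)).
Local Notation lambda_n d := (eigenvalue_last U1 U2 (Om d) (GamD d)).
Local Notation size_ell d := (area (active_support (Om d) (ell d))).

Lemma active_support_box (d : R) (i : bindex U1 U2) (a b c e : R) :
  active_support_is (Om d) i (rectangle a b c e) ->
  interior (active_support (Om d) i) = box a b c e.
Proof. by rewrite /active_support_is interior_rectangle. Qed.

Lemma area_box (d : R) (i : bindex U1 U2) (a b c e : R) : 0 < d < d0 -> a <= b -> c <= e ->
  interior (active_support (Om d) i) = box a b c e ->
  area (active_support (Om d) i) = (b - a) * (e - c).
Proof.
move=> /trimmed[oOm _ bg _ _] ab ce iE.
by rewrite area_active_support// iE mu2_box.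
Qed.

Section Strip.
Variables X1 X2 : bindex U1 U2 -> R -> R.
Hypothesis shape : forall d : R, 0 < d < d0 -> forall i, i \in S d ->
  [/\ begins_at (bspline U2 i.2) xi2, X1 i d < X2 i d &
      interior (active_support (Om d) i) = box (X1 i d) (X2 i d) xi2 (xi2 + d)].
Hypothesis cover : forall d : R, 0 < d < d0 -> forall j : 'I_(nbasis U2),
  begins_at (bspline U2 j) xi2 -> exists i1, (i1, j) \in S d.
Hypothesis thick : forall i d', 0 < d' < d0 -> i \in S d' ->
  exists c lam e : R, [/\ 0 < c, 0 < lam, 0 < e &
  forall d, 0 < d < d0 -> d < e -> exists u1 u2,
    [/\ [/\ X1 i d <= u1, u1 < u2 & u2 <= X2 i d], lam * (X2 i d - X1 i d) <= u2 - u1 &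
        forall x, u1 < x < u2 -> c <= bspl U1 i.1 x]].

(** Configurations (a) and (b) differ only in where the first factor is bounded below. [thick]
    isolates this: its constants depend on the index alone, and the window fills a fixed fraction of
    the active width. *)
Lemma strip_asymptotics :
  (if (deg U2 <= 2)%N then bigO_at0 (fun d => lambda_1 d) (fun=> 1)
   else bigO_at0 (fun d => lambda_1 d) (fun d => d ^+ (deg U2 - 2))) /\
  (if continuity_at U2 xi2 == 0%N then equiv_at0 (fun d => lambda_n d) (fun d => d^-1)
   else equiv_at0 (fun d => lambda_n d) (fun=> 1)).
Proof.
have [k [kt tk _ _ beginE]] := internal_knotP xi2_internal.
apply: (strip_conclusion two_lt_n1 gamma01 d0_gt0 trimmed xi2_internal ell_small shape
  kt tk beginE _ cover) => i.
(* A function that is never small imposes no condition; otherwise one d' at which it is small yields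
   the data that do not depend on d. *)
have [[d' [dd' iS']]|nS] := pselect (exists d' : R, 0 < d' < d0 /\ i \in S d'); last first.
  by exists 1, 1, 1; split => // d dd _ iS; exfalso; apply: nS; exists d.
have [c1 [lam [e [c10 lam0 e0 thickP]]]] := thick dd' iS'.
have [ib _ _] := shape dd' iS'.
have [c2 [C2 [eta [c20 C20 eta0 van]]]] := begins_vanishes xi2_internal kt tk beginE ib.
have [C1 C10 bound] := bspl_dbspl_bounded U1 i.1.
have [c [C [c0 C0 ratio]]] := strip_bounds c10 C10 c20 C20 lam0
  (fun x => proj1 (bound x)) (fun x => proj2 (bound x)) van.
exists c, C, (Num.min (Num.min e eta) 1); split => //; first by rewrite !lt_min e0 eta0 ltr01.
move=> d dd; rewrite !lt_min => /andP[/andP[de deta] d1] iS.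
have [oOm _ bg _ _] := trimmed dd; have /andP[dp _] := dd.
have [u1 [u2 [[xu uu ux] lamu cu]]] := thickP d dd de.
have [_ _ iE] := shape dd iS.
by apply: ratio oOm bg dp (ltW d1) (ltW deta) iE xu uu ux lamu cu.
Qed.

End Strip.

Lemma configuration_a_asymptotics :
  configuration_a U1 U2 gamma Om GamD d0 xi2 ->
  (if (deg U2 <= 2)%N then bigO_at0 (fun d => lambda_1 d) (fun=> 1)
   else bigO_at0 (fun d => lambda_1 d) (fun d => d ^+ (deg U2 - 2)) /\
        equiv_at0 (fun d => d ^+ (deg U2 - 2)) (fun d => size_ell d ^+ (deg U2 - 2))) /\
  (if continuity_at U2 xi2 == 0%N then
     equiv_at0 (fun d => lambda_n d) (fun d => d^-1) /\
     equiv_at0 (fun d => d^-1) (fun d => (size_ell d)^-1)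
   else equiv_at0 (fun d => lambda_n d) (fun=> 1)).
Proof.
move=> [c c12 conf].
have shape (d : R) : 0 < d < d0 -> forall i : bindex U1 U2, i \in S d ->
    [/\ begins_at (bspline U2 i.2) xi2, (c i).1 < (c i).2 &
      interior (active_support (Om d) i) = box (c i).1 (c i).2 xi2 (xi2 + d)].
  move=> dd i iS; have [/(_ i iS)[ib iE] _] := conf d dd; split => //.
  exact: active_support_box iE.
have [||first_ last_] := @strip_asymptotics (fun i _ => (c i).1) (fun i _ => (c i).2) shape.
- by move=> d /conf[].
- move=> i d' dd' iS'; have [_ _ iE] := shape d' dd' i iS'.
  have [_ _ bg _ _] := trimmed dd'; have /andP[dp' _] := dd'.
  have y12 : xi2 < xi2 + d' by rewrite ltrDl.
  have [x1 x2] := box_in_background bg (c12 i) y12 iE.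
  have [c1 [y1 [y2 [c10 xy yy yx cP]]]] := bspl_pos_near (ltn_ord i.1) (c12 i)
    (fun x => box_bspl_neq0 bg y12 iE (x := x)) x1 x2.
  (* The active interval is fixed in (a), so one window serves all d and [lam] is its share of the
     width. *)
  exists c1, ((y2 - y1) / ((c i).2 - (c i).1)), 1; split => //.
    by rewrite divr_gt0// subr_gt0.
  move=> d _ _; exists y1, y2; split => //.
  by rewrite divfK// gt_eqF// subr_gt0.
have [m m0 mP] : exists2 m : R, 0 < m & forall i : bindex U1 U2, m <= (c i).2 - (c i).1.
  apply: (@uniform_lower _ _ (fun i m => m <= (c i).2 - (c i).1)).
    by move=> i a b _; exact: le_trans.
  by move=> i; exists ((c i).2 - (c i).1) => //; rewrite subr_gt0.
have [M M0 MP] : exists2 M : R, 0 < M & forall i : bindex U1 U2, (c i).2 - (c i).1 <= M.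
  apply: (@uniform_upper _ _ (fun i M => (c i).2 - (c i).1 <= M)).
    by move=> i a b ab /le_trans; exact.
  by move=> i; exists ((c i).2 - (c i).1) => //; rewrite subr_gt0.
have [|sizeX sizeV] := @equiv_width _ (fun d => size_ell d) m M d0 (deg U2 - 2) m0 M0 d0_gt0.
  move=> d dd; exists ((c (ell d)).2 - (c (ell d)).1); rewrite mP MP; split => //.
  have [_ _ iE] := shape d dd _ (ell_small dd); have /andP[dp _] := dd.
  by rewrite (area_box dd _ _ iE) ?(ltW (c12 _)) ?lerDl ?(ltW dp)// addrAC subrr add0r.
by split; [case: ifP first_|case: ifP last_].
Qed.

Lemma square_size (z1 z2 : bindex U1 U2 -> R) n :
  (forall d : R, 0 < d < d0 -> forall i, i \in S d ->
    interior (active_support (Om d) i) = box (z1 i) (z1 i + d) (z2 i) (z2 i + d)) ->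
  equiv_at0 (fun d => d ^+ n) (fun d => size_ell d `^ (n%:R / 2)) /\
  equiv_at0 (fun d => d^-1) (fun d => size_ell d `^ (- 2^-1)).
Proof.
move=> shape; apply: equiv_square d0_gt0 _ => d dd; have /andP[dp _] := dd.
rewrite (area_box dd _ _ (shape d dd _ (ell_small dd))) ?lerDl ?(ltW dp)//.
by congr (_ * _); rewrite addrAC subrr add0r.
Qed.

Lemma configuration_b_asymptotics :
  configuration_b U1 U2 gamma Om GamD d0 xi2 ->
  (if (deg U2 <= 2)%N then bigO_at0 (fun d => lambda_1 d) (fun=> 1)
   else bigO_at0 (fun d => lambda_1 d) (fun d => d ^+ (deg U2 - 2)) /\
        equiv_at0 (fun d => d ^+ (deg U2 - 2))
                  (fun d => size_ell d `^ ((deg U2 - 2)%:R / 2))) /\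
  (if continuity_at U2 xi2 == 0%N then
     equiv_at0 (fun d => lambda_n d) (fun d => d^-1) /\
     equiv_at0 (fun d => d^-1) (fun d => size_ell d `^ (- 2^-1))
   else equiv_at0 (fun d => lambda_n d) (fun=> 1)).
Proof.
move=> [z1 conf].
have shape (d : R) : 0 < d < d0 -> forall i : bindex U1 U2, i \in S d ->
    [/\ begins_at (bspline U2 i.2) xi2, z1 i < z1 i + d &
      interior (active_support (Om d) i) = box (z1 i) (z1 i + d) xi2 (xi2 + d)].
  move=> dd i iS; have [/(_ i iS)[_ ib iE] _] := conf d dd; split => //.
    by rewrite ltrDl; case/andP: dd.
  exact: active_support_box iE.
have [||first_ last_] := @strip_asymptotics (fun i _ => z1 i) (fun i d => z1 i + d) shape.
- by move=> d /conf[].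
- move=> i d' dd' iS'; have [_ z12 iE] := shape d' dd' i iS'.
  have [_ _ bg _ _] := trimmed dd'; have /andP[dp' _] := dd'.
  have [/(_ i iS')[z1_neq0 _ _] _] := conf d' dd'.
  have y12 : xi2 < xi2 + d' by rewrite ltrDl.
  have [x1 x2] := box_in_background bg z12 y12 iE.
  have z1_in : first_knot U1 <= z1 i < last_knot U1 by rewrite x1 (lt_le_trans z12).
  have [c1 [e [c10 e0 cP]]] := bspl_pos_right (ltn_ord i.1) z1_in z1_neq0.
  (* The whole active interval is the window, hence [lam] = 1; e keeps it where the first factor is
     at least c1. *)
  exists c1, 1, e; split => // d /andP[dp _] de; exists (z1 i), (z1 i + d).
  split; [by rewrite !lexx ltrDl|by rewrite mul1r|].
  by move=> x /andP[zx xd]; apply: cP; rewrite zx (lt_trans xd)// ltrD2l.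
have [|sizeX sizeV] := @square_size z1 (fun=> xi2) (deg U2 - 2).
  by move=> d dd i iS; have [] := shape d dd i iS.
by split; [case: ifP first_|case: ifP last_].
Qed.

Lemma uniform_corner (xi1 : R) k1 k2 : internal_knot U1 xi1 ->
  configuration_c U1 U2 gamma Om GamD d0 xi1 xi2 ->
  (k1.+1 < size (knots U1))%N -> (knots U1)`_k1 = xi1 ->
  (forall j, (j < size (knots U1))%N ->
    ((knots U1)`_j == xi1) = (j <= k1 < j + count_mem xi1 (knots U1))%N) ->
  (k2.+1 < size (knots U2))%N -> (knots U2)`_k2 = xi2 ->
  (forall j, (j < size (knots U2))%N ->
    ((knots U2)`_j == xi2) = (j <= k2 < j + count_mem xi2 (knots U2))%N) ->
  exists2 e : R, 0 < e & forall (i : bindex U1 U2) (d : R), 0 < d < d0 -> d < e -> i \in S d ->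
    0 < mass (Om d) i /\ stiff (Om d) i i <=
      e^-1 * d ^+ ((deg U1 - (k1 - i.1)).-1 + (deg U2 - (k2 - i.2)).-1) * mass (Om d) i.
Proof.
move=> internal1 conf kt1 tk1 beginE1 kt2 tk2 beginE2.
apply: (@uniform_lower _ (bindex U1 U2) (fun i e => forall d : R, 0 < d < d0 -> d < e ->
    i \in S d -> 0 < mass (Om d) i /\ stiff (Om d) i i <=
      e^-1 * d ^+ ((deg U1 - (k1 - i.1)).-1 + (deg U2 - (k2 - i.2)).-1) * mass (Om d) i)).
  move=> i e e' e'0 ee H d dd de iS; have /andP[dp _] := dd.
  have [m0 KC] := H d dd (lt_le_trans de ee) iS; split => //; apply: (le_trans KC).
  rewrite ler_wpM2r ?(ltW m0)// ler_wpM2r ?exprn_ge0 ?(ltW dp)//.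
  by rewrite lef_pV2 ?posrE// (lt_le_trans e'0).
move=> i; have [[d' [dd' iS']]|nS] := pselect (exists d' : R, 0 < d' < d0 /\ i \in S d');
  last first.
  by exists 1 => // d dd _ iS; exfalso; apply: nS; exists d.
have [/(_ i iS')[ib1 ib2 _] _] := conf d' dd'.
have [c1 [C1 [eta1 [c10 C10 eta10 van1]]]] := begins_vanishes internal1 kt1 tk1 beginE1 ib1.
have [c2 [C2 [eta2 [c20 C20 eta20 van2]]]] := begins_vanishes xi2_internal kt2 tk2 beginE2 ib2.
have [C C0 ratio] := corner_bounds c10 C10 c20 C20 van1 van2.
exists (Num.min C^-1 (Num.min 1 (Num.min eta1 eta2))).
  by rewrite !lt_min invr_gt0 C0 ltr01 eta10 eta20.
move=> d dd; rewrite !lt_min => /and4P[dC d1 deta1 deta2] iS; have /andP[dp _] := dd.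
have [oOm _ bg _ _] := trimmed dd; have [/(_ i iS)[_ _ /active_support_box iE] _] := conf d dd.
have [m0 KC] := ratio _ d oOm bg dp (ltW d1) (ltW deta1) (ltW deta2) iE; split => //.
apply: (le_trans KC); rewrite ler_wpM2r ?(ltW m0)// ler_wpM2r ?exprn_ge0 ?(ltW dp)//.
rewrite -[leLHS]invrK lef_pV2 ?posrE ?invr_gt0 ?lt_min ?C0 ?eta10 ?eta20 ?ltr01//.
  by rewrite ge_min lexx.
by rewrite invr_gt0 C0.
Qed.

(** Around a corner the ratios of small functions are bounded and may tend to 0, so the lower bound
    for the last eigenvalue is taken from a large function. *)
Lemma configuration_c_asymptotics (xi1 : R) : internal_knot U1 xi1 ->
  configuration_c U1 U2 gamma Om GamD d0 xi1 xi2 ->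
  (if (deg U1 == 1%N) && (deg U2 == 1%N) then bigO_at0 (fun d => lambda_1 d) (fun=> 1)
   else bigO_at0 (fun d => lambda_1 d) (fun d => d ^+ (deg U1 + deg U2 - 2)) /\
        equiv_at0 (fun d => d ^+ (deg U1 + deg U2 - 2))
                  (fun d => size_ell d `^ ((deg U1 + deg U2 - 2)%:R / 2))) /\
  equiv_at0 (fun d => lambda_n d) (fun=> 1).
Proof.
move=> internal1 conf.
have [k1 [kt1 tk1 lt1 _ beginE1]] := internal_knotP internal1.
have [k2 [kt2 tk2 lt2 _ beginE2]] := internal_knotP xi2_internal.
have [e e0 smallP] := uniform_corner internal1 conf kt1 tk1 beginE1 kt2 tk2 beginE2.
have shape (d : R) : 0 < d < d0 -> forall i : bindex U1 U2, i \in S d ->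
    [/\ begins_at (bspline U2 i.2) xi2, xi1 < xi1 + d &
      interior (active_support (Om d) i) = box xi1 (xi1 + d) xi2 (xi2 + d)].
  move=> dd i iS; have [/(_ i iS)[_ ib iE] _] := conf d dd; split => //.
    by rewrite ltrDl; case/andP: dd.
  exact: active_support_box iE.
have [c' [C' [c'0 C'0 largeP]]] := large_ratios two_lt_n1 gamma01 d0_gt0 trimmed
  xi2_internal ell_small (X1 := fun _ _ => xi1) (X2 := fun _ d => xi1 + d) shape.
pose eta : R := Num.min (Num.min e d0) 1.
have eta0 : 0 < eta by rewrite /eta !lt_min e0 d0_gt0 ltr01.
have etaP (d : R) : 0 < d < eta -> [/\ 0 < d, 0 < d < d0, d < e & d < 1].
  by rewrite /eta !lt_min => /andP[-> /andP[/andP[-> ->] ->]].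
have mass0 (d : R) : 0 < d < eta -> forall i : bindex U1 U2, i \in A d -> 0 < mass (Om d) i.
  move=> /etaP[dp dd de d1] i iA; have [iS|iS] := boolP (i \in S d).
    by have [] := smallP i d dd de iS.
  by have [/(_ i iA iS)[]] := largeP d dd.
have e'0 : 0 < e^-1 by rewrite invr_gt0.
split; last first.
  apply: (@equiv_at0_intro _ _ _ c' (#|{: bindex U1 U2}|%:R * (e^-1 + C')) eta) => // d dd.
  have [dp dd0 de d1] := etaP _ dd; rewrite !mulr1; split => //.
    have [_ [i [iA m0 /andP[cK _]]]] := largeP d dd0.
    have /andP[_ h] := eigenvalue_bounds (trimmed dd0) (mass0 d dd) iA.
    by apply: le_trans h; rewrite ler_pdivlMr.
  have [_ [i0 [i0A _ _]]] := largeP d dd0.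
  apply: (eigenvalue_last_upper (trimmed dd0) (mass0 d dd) i0A).
    by rewrite addr_ge0// ltW.
  move=> i iA; have [iS|iS] := boolP (i \in S d).
    have [m0 KC] := smallP i d dd0 de iS; apply: (le_trans KC).
    rewrite ler_wpM2r ?(ltW m0)//; apply: (@le_trans _ _ e^-1); last by rewrite lerDl ltW.
    by rewrite ler_piMr ?(ltW e'0)// exprn_ile1// ltW.
  have [/(_ i iA iS)[m0 KC] _] := largeP d dd0; apply: (le_trans KC).
  by rewrite ler_wpM2r ?(ltW m0)// lerDr ltW.
have [sizeX _] := @square_size (fun=> xi1) (fun=> xi2) (deg U1 + deg U2 - 2)
  (fun d dd i iS => let: And3 _ _ iE := shape d dd i iS in iE).
case: ifP => _.
  apply: (bigO_at0_intro C'0 eta0) => d dd; rewrite mulr1; have [_ dd0 _ _] := etaP _ dd.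
  have [_ [i [iA m0 /andP[_ KC]]]] := largeP d dd0.
  have /andP[h _] := eigenvalue_bounds (trimmed dd0) (mass0 d dd) iA.
  by apply: (le_trans h); rewrite ler_pdivrMr.
split => //; apply: (bigO_at0_intro e'0 eta0) => d dd; have [dp dd0 de d1] := etaP _ dd.
have [/andP[_ k1N] /andP[_ k2N]] := (span_bounds kt1 lt1, span_bounds kt2 lt2).
(* The smoothest B-splines in both directions, of orders p1 - 1 and p2 - 1, give the exponent p1 +
   p2 - 2. *)
pose i : bindex U1 U2 := (Ordinal k1N, Ordinal k2N).
have iS : i \in S d by have [_ /(_ i)] := conf d dd0; apply; apply/begins_atP.
have [m0 KC] := smallP i d dd0 de iS.
have /andP[h _] := eigenvalue_bounds (trimmed dd0) (mass0 d dd) (small_active iS).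
apply: (le_trans h); rewrite ler_pdivrMr//; apply: (le_trans KC).
rewrite /= !subnn !subn0 (_ : (deg U1 + deg U2 - 2 = (deg U1).-1 + (deg U2).-1)%N)//.
by have := deg_gt0 U1; have := deg_gt0 U2; clear; case: (deg U1) (deg U2) => [|a] [|b]; lia.
Qed.

End Configurations.

Unset Implicit Arguments.

(* The bound on nbasis U1 holds as soon as the first direction has an internal
   knot, and rules out only a single linear element in that direction.  There,
   with Dirichlet conditions on both lateral sides up to the knot xi2, every
   active basis function can be small, and the claims fail. *)
Theorem mainTheorem5 (R : realType) (U1 U2 : spline_space R)
    (two_lt_n1 : (2 < nbasis U1)%N)
    (gamma : R) (gamma01 : 0 <= gamma <= 1)
    (d0 : R) (d0_gt0 : 0 < d0)
    (Om GamD : R -> set (R * R))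
    (trimmed : forall d, 0 < d < d0 -> trimmed_domain U1 U2 (Om d) (GamD d))
    (xi2 : R) (xi2_internal : internal_knot U2 xi2)
    (ell : R -> bindex U1 U2)
    (ell_small : forall d, 0 < d < d0 ->
       ell d \in small_basis U1 U2 gamma (Om d) (GamD d)) :
  let p1 := deg U1 in
  let p2 := deg U2 in
  let kappa2 := continuity_at U2 xi2 in
  let lambda_1 d := eigenvalue_first U1 U2 (Om d) (GamD d) in
  let lambda_n d := eigenvalue_last U1 U2 (Om d) (GamD d) in
  let size_ell d := area (active_support (Om d) (ell d)) in
  [/\ configuration_a U1 U2 gamma Om GamD d0 xi2 ->
        (if (p2 <= 2)%N then bigO_at0 lambda_1 (fun=> 1)
         else bigO_at0 lambda_1 (fun d => d ^+ (p2 - 2)) /\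
              equiv_at0 (fun d => d ^+ (p2 - 2))
                        (fun d => size_ell d ^+ (p2 - 2))) /\
        (if kappa2 == 0%N then
           equiv_at0 lambda_n (fun d => d^-1) /\
           equiv_at0 (fun d => d^-1) (fun d => (size_ell d)^-1)
         else equiv_at0 lambda_n (fun=> 1)),
      configuration_b U1 U2 gamma Om GamD d0 xi2 ->
        (if (p2 <= 2)%N then bigO_at0 lambda_1 (fun=> 1)
         else bigO_at0 lambda_1 (fun d => d ^+ (p2 - 2)) /\
              equiv_at0 (fun d => d ^+ (p2 - 2))
                        (fun d => size_ell d `^ ((p2 - 2)%:R / 2))) /\
        (if kappa2 == 0%N then
           equiv_at0 lambda_n (fun d => d^-1) /\
           equiv_at0 (fun d => d^-1) (fun d => size_ell d `^ (- 2^-1))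
         else equiv_at0 lambda_n (fun=> 1)) &
      forall xi1 : R, internal_knot U1 xi1 ->
      configuration_c U1 U2 gamma Om GamD d0 xi1 xi2 ->
        (if (p1 == 1%N) && (p2 == 1%N) then bigO_at0 lambda_1 (fun=> 1)
         else bigO_at0 lambda_1 (fun d => d ^+ (p1 + p2 - 2)) /\
              equiv_at0 (fun d => d ^+ (p1 + p2 - 2))
                        (fun d => size_ell d `^ ((p1 + p2 - 2)%:R / 2))) /\
        equiv_at0 lambda_n (fun=> 1)].
Proof.
move=> p1 p2 kappa2 lambda_1 lambda_n size_ell; split=> [conf|conf|xi1 internal1 conf].
- exact (configuration_a_asymptotics two_lt_n1 gamma01 d0_gt0 trimmed xi2_internal ell_small conf).
- exact (configuration_b_asymptotics two_lt_n1 gamma01 d0_gt0 trimmed xi2_internal ell_small conf).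
exact (configuration_c_asymptotics two_lt_n1 gamma01 d0_gt0 trimmed xi2_internal ell_small
  internal1 conf).
Qed.
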